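(* Suppose that there exist positive constants $\tilde c_1, c_1, c_2, \tilde c_3, c_3, c_4, c_5, c_6$ (independent of $n$) such that, for all $n\ge 1$: 1. $\tilde c_1 \le \sigma_{X^{(n)}} := \mathrm{Var}(X^{(n)})^{1/2} \le c_1$; 2. $\rho_{X^{(n)}} := \mathbb{E}\big[|X^{(n)}-\mathbb{E}[X^{(n)}]|^3\big] \le c_2^3 \sigma_{X^{(n)}}^3$; 3. with $Y'^{(n)} := Y^{(n)} - X^{(n)}\,\mathrm{Cov}(X^{(n)},Y^{(n)})/\sigma_{X^{(n)}}^2$ and $\sigma_{Y'^{(n)}} := \mathrm{Var}(Y'^{(n)})^{1/2}$, there exists $\eta_0>0$ (independent of $n$) such that for all $s\in[-\pi,\pi]$ and $t\in[0,\eta_0]$, $$\Big|\mathbb{E}\big[e^{i(sX^{(n)}+tY'^{(n)})}\big]\Big| \le 1 - c_5\big(\sigma_{X^{(n)}}^2 s^2 + \sigma_{Y'^{(n)}}^2 t^2\big);$$ 4. $k_n = N_n\mathbb{E}[X^{(n)}] + O(\sigma_{X^{(n)}} N_n^{1/2})$ as $n\to\infty$; 5. $\tilde c_3 \le \sigma_{Y^{(n)}} := \mathrm{Var}(Y^{(n)})^{1/2} \le c_3$; 6. $\rho_{Y^{(n)}} := \mathbb{E}\big[|Y^{(n)}-\mathbb{E}[Y^{(n)}]|^3\big] \le c_4^3 \sigma_{Y^{(n)}}^3$; 7. the correlation $r_n := \mathrm{Cov}(X^{(n)},Y^{(n)})\,\sigma_{X^{(n)}}^{-1}\sigma_{Y^{(n)}}^{-1}$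 satisfies $|r_n|\le c_6<1$, so that $\tau_n^2 := \sigma_{Y^{(n)}}^2(1-r_n^2) \ge \tilde c_3^2(1-c_6^2) > 0$ (with $\tau_n>0$). Then the following hold. (a) There exists $\tilde c_5>0$ (independent of $n$) such that $\mathbb{P}(S_n=k_n) \ge \dfrac{\tilde c_5}{2\pi\sigma_{X^{(n)}}N_n^{1/2}}$. (b) For $N_n \ge N_0 := \max(3, c_2^6, c_4^6)$, $$\sup_{x\in\mathbb{R}} \left|\mathbb{P}\left(\frac{U_n - N_n\mathbb{E}[Y^{(n)}] - r_n\sigma_{Y^{(n)}}\sigma_{X^{(n)}}^{-1}(k_n - N_n\mathbb{E}[X^{(n)}])}{N_n^{1/2}\tau_n}\le x\right) - \Phi(x)\right| \le \frac{C}{N_n^{1/2}},$$ where $\Phi$ is the standard normal distribution function and $C>0$ is a constant depending only on $\tilde c_1, c_1, c_2, \tilde c_3, c_3, c_4, c_5, \tilde c_5, c_6$. (c) There exist positive constants $c_7, c_8$ depending only on $\tilde c_1, c_1, c_2, \tilde c_3, c_3, c_4, c_5, \tilde c_5, c_6$ such that $$\Big|\mathbb{E}[U_n] - N_n\mathbb{E}[Y^{(n)}] - r_n\frac{\sigma_{Y^{(n)}}}{\sigma_{X^{(n)}}}(k_n - N_n\mathbb{E}[X^{(n)}])\Big| \le c_7 \quad\text{and}\quad \big|\mathrm{Var}(U_n) - N_n\tau_n^2\big| \le c_8 N_n^{1/2}.$$ If moreover $N_n \ge \tilde N_0 := \max(N_0, 4c_8^2/\tilde c_3^2)$, then $$\sup_{x\in\mathbb{R}}\left|\mathbb{P}\left(\frac{U_n-\mathbb{E}[U_n]}{\mathrm{Var}(U_n)^{1/2}}\le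 x\right) - \Phi(x)\right| \le \frac{\tilde C}{N_n^{1/2}},$$ where $\tilde C$ is a constant depending only on $\tilde c_1, c_1, c_2, \tilde c_3, c_3, c_4, c_5, \tilde c_5, c_6$.
   Context: For each $n\ge 1$, $(X^{(n)},Y^{(n)})$ is a pair of random variables with $X^{(n)}$ integer-valued and $Y^{(n)}$ real-valued. $(N_n)_{n\ge1}$ is a sequence of positive integers with $N_n\to+\infty$. For each $n$, $(X_i^{(n)},Y_i^{(n)})_{1\le i\le N_n}$ are i.i.d. copies of $(X^{(n)},Y^{(n)})$, and $S_n := \sum_{i=1}^{N_n}X_i^{(n)}$, $T_n := \sum_{i=1}^{N_n}Y_i^{(n)}$. The integers $k_n\in\mathbb{Z}$ satisfy $\mathbb{P}(S_n=k_n)>0$ for all $n$, and $U_n$ is a random variable distributed as $T_n$ conditioned on $S_n=k_n$. *)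

(* Defs.v *)
From mathcomp Require Import all_boot all_order all_algebra.
From mathcomp Require Import complex.
From mathcomp Require Import all_classical all_reals all_analysis.

Set Implicit Arguments.
Unset Strict Implicit.
Unset Printing Implicit Defensive.

Import Order.TTheory GRing.Theory Num.Theory.
Import numFieldNormedType.Exports.

Local Open Scope classical_set_scope.
Local Open Scope ring_scope.

Section moments.
Context {d : measure_display} {T : measurableType d} {R : realType}.
Variable P : probability T R.

Definition mean (X : T -> R) : R := fine 'E_P[X].

(* A strictly positive lower bound on [sigma P X] forces 'V_P[X] to be finite,
   since [fine +oo = 0]. *)
Definition sigma (X : T -> R) : R := Num.sqrt (fine 'V_P[X]).

Definition cov (X Y : T -> R) : R := fine (covariance P X Y).

(* Kept in \bar R, so that an upper bound by a real includes the existence of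
   the third moment. *)
Definition rho (X : T -> R) : \bar R :=
  'E_P[fun w => `|X w - mean X| ^+ 3].

Definition corr (X Y : T -> R) : R := cov X Y / (sigma X * sigma Y).

Definition tau (X Y : T -> R) : R :=
  Num.sqrt (sigma Y ^+ 2 * (1 - corr X Y ^+ 2)).

(* The variable Y' of the paper, uncorrelated with X. *)
Definition residual (X Y : T -> R) : T -> R :=
  fun w => Y w - X w * (cov X Y / sigma X ^+ 2).

Definition Cexpectation (Z : T -> R[i]) : R[i] :=
  Complex (mean (fun w => complex.Re (Z w))) (mean (fun w => complex.Im (Z w))).

Definition expi (x : R) : R[i] := Complex (cos x) (sin x).

Definition joint_char_fun (X Y : T -> R) (s t : R) : R[i] :=
  Cexpectation (fun w => expi (s * X w + t * Y w)).

Definition cond_prob (A B : set T) : \bar R := (P (A `&` B) / P B)%E.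

(* The mass is compared on measurable sets only: the pushforward of P is also
   defined, with junk values, on non-measurable sets. *)
Definition mutually_independent {d' : measure_display}
    {T' : measurableType d'} {I : finType} (Z : I -> T -> T') : Prop :=
  forall (J : {set I}) (B : I -> set T'), (forall i, measurable (B i)) ->
    P (\bigcap_(i in [set` J]) (Z i @^-1` B i)) =
    (\prod_(i in J) P (Z i @^-1` B i))%E.

Definition std_normal_cdf (x : R) : \bar R := normal_prob 0 1 `]-oo, x].

Definition dist_to_normal (Z : T -> R) : \bar R :=
  ereal_sup [set `|P [set w | (Z w <= x)%R] - std_normal_cdf x|%E | x in [set: R]].

End moments.

Section laws.
Context {R : realType} {d1 d2 : measure_display}.
Context {T1 : measurableType d1} {T2 : measurableType d2}.
Variables (P1 : probability T1 R) (P2 : probability T2 R).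

Definition same_law {d' : measure_display} {T' : measurableType d'}
    (Z1 : T1 -> T') (Z2 : T2 -> T') : Prop :=
  forall A : set T', measurable A -> P1 (Z1 @^-1` A) = P2 (Z2 @^-1` A).

Definition iid_copies {m : nat} (Xs Ys : 'I_m -> T1 -> R) (X Y : T2 -> R) : Prop :=
  mutually_independent P1 (fun i w => (Xs i w, Ys i w)) /\
  forall i, same_law (fun w => (Xs i w, Ys i w)) (fun w => (X w, Y w)).

(* U, on (T2, P2), is distributed as V, on (T1, P1), conditioned on B. *)
Definition has_cond_law (U : T2 -> R) (V : T1 -> R) (B : set T1) : Prop :=
  forall A : set R, measurable A ->
    P2 (U @^-1` A) = cond_prob P1 (V @^-1` A) B.

End laws.

Definition rsum {T : Type} {R : realType} {m : nat} (Xs : 'I_m -> T -> R) : T -> R :=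
  fun w => \sum_(i < m) Xs i w.

Definition threshold {R : realType} (c2 c4 : R) : R :=
  Num.max 3 (Num.max (c2 ^+ 6) (c4 ^+ 6)).

(* Main.v *)
(* Let A = X - E[X] and let B be the centered residual of Y, so that B and AB have mean zero. For
   phi(s, t) = E[exp(i(sA + tB))] this alone gives phi(s, t) = exp(- tau^2 t^2 / 2) phi(s, 0) + O(|t| (s^2 + t^2)),
   with a better error for the part that is even in t; no Gaussian approximation in s is made. Raising to the power N and
   integrating over s in [-pi, pi] inverts the Fourier transform on the event S = k. Division by P(S = k) >= c / sqrt N then gives
   |E[exp(itU')] - exp(- N tau^2 t^2 / 2)| <= C |t| exp(- c N t^2) for the recentered conditioned sum U' and |t| <= eta.
   Letting t tend to 0 in this bound and in its even version controls the mean and the variance of U', and a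
   smoothing inequality turns it into a bound on the Kolmogorov distance, under either normalization.
   Part (a) compares P(S = k) with the integral over [-pi, pi] of a Gaussian density. *)
Require Import Defs.
From mathcomp Require Import all_boot all_order all_algebra.
From mathcomp Require Import complex.
From mathcomp Require Import all_classical all_reals all_analysis measurable_realfun.
From mathcomp Require Import ring lra zify.

Set Implicit Arguments.
Unset Strict Implicit.
Unset Printing Implicit Defensive.

Import Order.TTheory GRing.Theory Num.Theory.
Import numFieldNormedType.Exports.

Local Open Scope classical_set_scope.
Local Open Scope complex_scope.
Local Open Scope ring_scope.

(** * Complex-valued expectations *)

(** Dividing by [P(S = k)] costs a factor [sqrt N]. The integration over [s] wins it back: in the
    first-order bound the error keeps a factor [exp(- c N s^2)], whose average over [-pi, pi] is O(1
    / sqrt N). No approximation in [s] is needed because the inverted integral at t = 0 is exactly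
    [P(S = k)]: the factor [exp(- N tau^2 t^2 / 2)] comes out of the integral and the rest cancels
    in the quotient. An error of first order in t suffices for the mean and for the Kolmogorov
    distance. The variance asks for an error O(sqrt N t^2), which the averages over t and -t
    satisfy; hence the expansions have even companions. Coefficients of |t|^3 may grow with N there,
    because t tends to 0 with N fixed. Integrals over intervals are written as expectations under
    uniform laws, so that one calculus of expectations serves throughout. The truncated Gaussian
    cosine integral serves twice: on [-M, M] with M large for the normal characteristic function,
    and on [-pi, pi] for part (a). *)

Lemma eq_ler {d} {T : porderType d} (x y : T) : x = y -> (x <= y)%O.
Proof. by move->. Qed.

Section cnorm.
Context {R : realType}.
Implicit Types z u : R[i].

(** The norm of [R[i]] takes its values in [R[i]]; a modulus with values in [R] turns all estimates
    into real inequalities. *)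
Definition cnorm z : R := ComplexField.Normc.normc z.

Lemma cnormE z : cnorm z = Num.sqrt (complex.Re z ^+ 2 + complex.Im z ^+ 2).
Proof. by case: z. Qed.

Lemma normrC_cnorm z : `|z| = (cnorm z)%:C.
Proof. by rewrite normc_def cnormE. Qed.

Lemma cnorm_ge0 z : 0 <= cnorm z.
Proof. by rewrite cnormE sqrtr_ge0. Qed.

Lemma cnorm0 : cnorm 0 = 0.
Proof. by rewrite cnormE/= expr0n/= addr0 sqrtr0. Qed.

Lemma cnormM z u : cnorm (z * u) = cnorm z * cnorm u.
Proof. exact: ComplexField.Normc.normcM. Qed.

Lemma cnormD z u : cnorm (z + u) <= cnorm z + cnorm u.
Proof. exact: le_normcD. Qed.

Lemma cnormN z : cnorm (- z) = cnorm z.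
Proof. exact: normcN. Qed.

Lemma cnormB z u : cnorm (z - u) <= cnorm z + cnorm u.
Proof. by rewrite -(cnormN u); exact: cnormD. Qed.

Lemma cnorm_real (x : R) : cnorm x%:C = `|x|.
Proof. by rewrite cnormE/= expr0n/= addr0 sqrtr_sqr. Qed.

Lemma cnorm1 : cnorm 1 = 1.
Proof. by rewrite (cnorm_real 1) normr1. Qed.

Lemma cnormX z n : cnorm (z ^+ n) = cnorm z ^+ n.
Proof.
by elim: n => [|n IH]; rewrite ?expr0 ?cnorm1// !exprS cnormM IH.
Qed.

Lemma cnorm_expi (x : R) : cnorm (expi x) = 1.
Proof. by rewrite cnormE/= cos2Dsin2 sqrtr1. Qed.

Lemma normr_Re_le z : `|complex.Re z| <= cnorm z.
Proof. by rewrite cnormE -sqrtr_sqr ler_wsqrtr// lerDl sqr_ge0. Qed.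

Lemma normr_Im_le z : `|complex.Im z| <= cnorm z.
Proof. by rewrite cnormE -sqrtr_sqr ler_wsqrtr// lerDr sqr_ge0. Qed.

Lemma cnorm_le z : cnorm z <= `|complex.Re z| + `|complex.Im z|.
Proof.
rewrite cnormE; case: z => a b /=.
rewrite -[leRHS]ger0_norm ?addr_ge0// -sqrtr_sqr.
apply: ler_wsqrtr; rewrite sqrrD !real_normK ?num_real// -addrA lerD2l lerDr.
by rewrite mulrn_wge0// mulr_ge0.
Qed.

Lemma cnorm_eq0 z : (cnorm z == 0) = (z == 0).
Proof.
apply/eqP/eqP => [|->]; last exact: cnorm0.
exact: ComplexField.Normc.eq0_normc.
Qed.

Lemma expiD (x y : R) : expi (x + y) = expi x * expi y.
Proof.
rewrite /expi cosD sinD; apply/eqP; rewrite eq_complex/= eqxx/=.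
by rewrite addrC (mulrC (cos x)) (mulrC (sin x)) (mulrC (sin y)) (mulrC (cos y)) addrC.
Qed.

Lemma expi0 : expi 0 = 1 :> R[i].
Proof. by rewrite /expi cos0 sin0. Qed.

Lemma expi_sum I (r : seq I) (F : I -> R) :
  expi (\sum_(i <- r) F i) = \prod_(i <- r) expi (F i).
Proof.
elim: r => [|i r IH]; first by rewrite !big_nil expi0.
by rewrite !big_cons expiD IH.
Qed.

(** Telescoping: at each step of the recursion in [n] one factor is [z - u] and all the others are
    bounded by [M]. *)
Lemma cnorm_subX z u (M : R) n : cnorm z <= M -> cnorm u <= M ->
  cnorm (z ^+ n - u ^+ n) <= n%:R * cnorm (z - u) * M ^+ n.-1.
Proof.
move=> zM uM; have M0 : 0 <= M by exact: le_trans (cnorm_ge0 z) zM.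
elim: n => [|n IH]; first by rewrite !expr0 subrr cnorm0 !mul0r.
have -> : z ^+ n.+1 - u ^+ n.+1 = (z - u) * z ^+ n + u * (z ^+ n - u ^+ n).
  by rewrite !exprS; ring.
apply: le_trans (cnormD _ _) _; rewrite !cnormM cnormX.
have h1 : cnorm (z - u) * cnorm z ^+ n <= cnorm (z - u) * M ^+ n.
  by rewrite ler_wpM2l ?cnorm_ge0// lerXn2r ?nnegrE ?cnorm_ge0.
apply: le_trans (lerD h1 (ler_pM _ _ uM IH)) _; rewrite ?cnorm_ge0//.
rewrite /=; case: n {IH h1} => [|n] /=; first by rewrite !mul0r mulr0 addr0 mul1r.
rewrite -[n.+2]addn1 natrD !mulrDl mul1r addrC lerD2r//.
by apply: eq_ler; rewrite exprS; ring.
Qed.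

(** The linear term is kept exact, so that averaging it over two values of [z] can produce a
    cancellation; what remains is quadratic in [z - u]. *)
Lemma cnorm_subX2 z u (M : R) n : cnorm z <= M -> cnorm u <= M ->
  cnorm (z ^+ n - u ^+ n - n%:R * (z - u) * u ^+ n.-1) <=
  (n * n.-1)%:R * cnorm (z - u) ^+ 2 * M ^+ n.-2.
Proof.
move=> zM uM; have M0 : 0 <= M by exact: le_trans (cnorm_ge0 z) zM.
elim: n => [|n IH]; first by rewrite !expr0 subrr !mul0r subrr cnorm0.
case: n IH => [|n] IH.
  by rewrite muln0 !mul0r !expr1 expr0 mul1r mulr1 subrr cnorm0.
have -> : z ^+ n.+2 - u ^+ n.+2 - n.+2%:R * (z - u) * u ^+ n.+1 =
   u * (z ^+ n.+1 - u ^+ n.+1 - n.+1%:R * (z - u) * u ^+ n)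
   + (z - u) * (z ^+ n.+1 - u ^+ n.+1).
  by rewrite -[n.+2%:R]natr1 !exprS; ring.
apply: le_trans (cnormD _ _) _; rewrite !cnormM.
have h1 := ler_wpM2l (cnorm_ge0 (z - u)) (cnorm_subX n.+1 zM uM).
have h2 := ler_pM (cnorm_ge0 _) (cnorm_ge0 _) uM IH.
apply: le_trans (lerD h2 h1) _; rewrite /=.
set d := cnorm (z - u).
have -> : M * ((n.+1 * n)%:R * d ^+ 2 * M ^+ n.-1) = (n.+1 * n)%:R * d ^+ 2 * M ^+ n.
  by case: n {IH h1 h2} => [|n]; rewrite ?muln0 ?mul0r ?mulr0//= [M ^+ n.+1]exprS; ring.
have -> : d * (n.+1%:R * d * M ^+ n) = n.+1%:R * d ^+ 2 * M ^+ n by ring.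
rewrite -!mulrDl -natrD; apply: ler_wpM2r; first exact: exprn_ge0.
by apply: ler_wpM2r; rewrite ?sqr_ge0// ler_nat; nia.
Qed.

End cnorm.

#[global] Arguments cnorm {R} z : simpl never.

Lemma ler_1cube {R : realDomainType} (a : R) : 0 <= a -> a <= 1 + a ^+ 3.
Proof.
move=> a0; have [a1|a1] := leP a 1; first by have := exprn_ge0 3 a0; lra.
have : a <= a ^+ 3 by rewrite exprS ler_peMr// expr_ge1// ltW.
lra.
Qed.

Section mean.
Context {d : measure_display} {T : measurableType d} {R : realType}.
Variable P : probability T R.
Implicit Types f g : T -> R.

Definition rintegrable f := P.-integrable [set: T] (EFin \o f).

Lemma meanE f : mean P f = \int[P]_w f w.
Proof. by rewrite /mean unlock. Qed.

Lemma EmeanE f : rintegrable f -> 'E_P[f]%E = (mean P f)%:E.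
Proof.
by move=> fi; rewrite /mean fineK// unlock; exact: integrable_fin_num.
Qed.

Lemma eq_mean f g : f =1 g -> mean P f = mean P g.
Proof. by move=> /funext ->. Qed.

Lemma rintegrable_measurable f : rintegrable f -> measurable_fun setT f.
Proof. by move=> /integrableP[/measurable_EFinP]. Qed.

Lemma measurable_level f (c : R) : measurable_fun setT f -> measurable [set w | f w = c].
Proof.
move=> mf; rewrite (_ : [set w | _] = f @^-1` [set c])//.
by rewrite -[X in measurable X]setTI; exact: mf.
Qed.

Lemma measurable_sublevel f (c : R) : measurable_fun setT f -> measurable [set w | f w <= c].
Proof. by move=> mf; rewrite -[X in measurable X]setTI; exact: measurable_fun_le. Qed.

Lemma rintegrable_bounded (M : R) f : measurable_fun setT f ->
  (forall w, `|f w| <= M) -> rintegrable f.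
Proof.
move=> mf fM; apply: measurable_bounded_integrable => //.
  exact: le_lt_trans (probability_le1 P measurableT) (ltry _).
by exists M; split => [|x Mx w _]; [exact: num_real|apply: le_trans (fM w) (ltW _)].
Qed.

Lemma rintegrable_cst (c : R) : rintegrable (fun=> c).
Proof. exact: (@rintegrable_bounded `|c|). Qed.

Lemma rintegrableD f g : rintegrable f -> rintegrable g ->
  rintegrable (fun w => f w + g w).
Proof. by move=> fi gi; apply: (eq_integrable _ ((EFin \o f) \+ (EFin \o g))%E) => //; exact: integrableD. Qed.

Lemma rintegrableB f g : rintegrable f -> rintegrable g ->
  rintegrable (fun w => f w - g w).
Proof. by move=> fi gi; apply: (eq_integrable _ ((EFin \o f) \- (EFin \o g))%E) => //; exact: integrableB. Qed.

Lemma rintegrableN f : rintegrable f -> rintegrable (fun w => - f w).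
Proof. by move=> fi; apply: (eq_integrable _ (\- (EFin \o f))%E) => //; exact: integrableN. Qed.

Lemma rintegrableZ (c : R) f : rintegrable f -> rintegrable (fun w => c * f w).
Proof. by move=> fi; apply: (eq_integrable _ (fun x => c%:E * (EFin \o f) x)%E) => //; exact: integrableZl. Qed.

Lemma rintegrable_le f g : measurable_fun setT f -> rintegrable g ->
  (forall w, `|f w| <= g w) -> rintegrable f.
Proof.
move=> mf gi fg; apply: (le_integrable _ _ _ gi) => //.
  exact/measurable_EFinP.
by move=> w _ /=; rewrite lee_fin (le_trans (fg w))// ler_norm.
Qed.

Lemma rintegrable_of_cube f : measurable_fun setT f -> rintegrable (fun w => `|f w| ^+ 3) ->
  rintegrable f.
Proof.
move=> mf f3; apply: rintegrable_le (rintegrableD (rintegrable_cst 1) f3) _ => // w.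
exact: ler_1cube.
Qed.

Lemma rintegrable_sqr_of_cube f : measurable_fun setT f -> rintegrable (fun w => `|f w| ^+ 3) ->
  rintegrable (fun w => f w ^+ 2).
Proof.
move=> mf f3; apply: rintegrable_le (rintegrableD (rintegrable_cst 1) f3) _ => [|w].
  exact: measurable_funX.
rewrite ger0_norm ?sqr_ge0// -(real_normK (num_real (f w))).
have := normr_ge0 (f w); move: (`|f w|) => a a0; have [a1|a1] := leP a 1.
  have : a ^+ 2 <= 1 by rewrite exprn_ile1.
  by have := exprn_ge0 3 a0; lra.
have : a ^+ 2 <= a ^+ 3 by rewrite [leRHS]exprSr ler_peMr ?sqr_ge0// ltW.
lra.
Qed.

Lemma rintegrable_mul_of_sqr f g : measurable_fun setT f -> measurable_fun setT g ->
  rintegrable (fun w => f w ^+ 2) -> rintegrable (fun w => g w ^+ 2) ->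
  rintegrable (fun w => f w * g w).
Proof.
move=> mf mg f2 g2; apply: rintegrable_le (rintegrableD f2 g2) _ => [|w].
  exact: measurable_funM.
rewrite normrM -(real_normK (num_real (f w))) -(real_normK (num_real (g w))).
have := sqr_ge0 (`|f w| - `|g w|); rewrite sqrrB.
have := sqr_ge0 `|f w|; have := sqr_ge0 `|g w|; lra.
Qed.

Lemma rintegrable_norm f : rintegrable f -> rintegrable (fun w => `|f w|).
Proof. by move=> fi; exact: (integrable_norm fi). Qed.

Lemma rintegrable_mul_bounded (M : R) f g : rintegrable f -> measurable_fun setT g ->
  (forall w, `|g w| <= M) -> rintegrable (fun w => g w * f w).
Proof.
move=> fi mg gM; apply: (@rintegrable_le _ (fun w => M * `|f w|)).
- by apply: measurable_funM => //; exact: rintegrable_measurable.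
- exact/rintegrableZ/rintegrable_norm.
- by move=> w; rewrite normrM ler_wpM2r.
Qed.

Lemma mean_cst (c : R) : mean P (fun=> c) = c.
Proof. by rewrite /mean expectation_cst. Qed.

Lemma meanD f g : rintegrable f -> rintegrable g ->
  mean P (fun w => f w + g w) = mean P f + mean P g.
Proof. by move=> fi gi; rewrite !meanE RintegralD. Qed.

Lemma meanB f g : rintegrable f -> rintegrable g ->
  mean P (fun w => f w - g w) = mean P f - mean P g.
Proof. by move=> fi gi; rewrite !meanE RintegralB. Qed.

Lemma meanZ (c : R) f : rintegrable f -> mean P (fun w => c * f w) = c * mean P f.
Proof. by move=> fi; rewrite !meanE RintegralZl. Qed.

Lemma meanN f : rintegrable f -> mean P (fun w => - f w) = - mean P f.
Proof.
move=> fi; rewrite -[RHS]mulN1r -meanZ//; apply: eq_mean => w.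
by rewrite mulN1r.
Qed.

Lemma le_mean f g : rintegrable f -> rintegrable g -> (forall w, f w <= g w) ->
  mean P f <= mean P g.
Proof. by move=> fi gi fg; rewrite !meanE le_Rintegral. Qed.

Lemma mean_ge0 f : (forall w, 0 <= f w) -> 0 <= mean P f.
Proof. by move=> f0; rewrite meanE Rintegral_ge0. Qed.

Lemma normr_mean_le f g : rintegrable f -> rintegrable g ->
  (forall w, `|f w| <= g w) -> `|mean P f| <= mean P g.
Proof.
move=> fi gi fg; rewrite ler_norml -meanN//; apply/andP; split; apply: le_mean => //.
- exact: rintegrableN.
- by move=> w; have := fg w; rewrite ler_norml => /andP[].
- by move=> w; have := fg w; rewrite ler_norml => /andP[].
Qed.

Lemma mean_indic (A : set T) : measurable A -> mean P (\1_A) = fine (P A).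
Proof. by move=> mA; rewrite /mean expectation_indic. Qed.

(** Monotone convergence along the truncations. It serves laws for which only the expectations of
    bounded functions are accessible at first. *)
Lemma rintegrable_truncation (C : R) f : measurable_fun setT f -> (forall w, 0 <= f w) ->
  (forall n, mean P (fun w => Num.min (f w) n%:R) <= C) -> rintegrable f.
Proof.
move=> mf f0 hC.
pose g n (w : T) := (Num.min (f w) n%:R)%:E : \bar R.
have mg n : measurable_fun setT (fun w => Num.min (f w) n%:R).
  by apply: measurable_minr => //; exact: measurable_cst.
have g0 n w : (0 <= g n w)%E by rewrite lee_fin le_min f0 ler0n.
have mg' n : measurable_fun setT (g n) by apply/measurable_EFinP; exact: mg.
have hg n : (\int[P]_w g n w <= C%:E)%E.
  have bg w : `|Num.min (f w) n%:R| <= n%:R :> R.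
    by rewrite ger0_norm ?ge_min ?lexx ?orbT// le_min f0 ler0n.
  have := EmeanE (rintegrable_bounded (mg n) bg).
  by rewrite unlock => ->; rewrite lee_fin.
apply/integrableP; split; first exact/measurable_EFinP.
apply: (@le_lt_trans _ _ C%:E); last exact: ltry.
have nd w : nondecreasing_seq (g^~ w).
  move=> m n mn; rewrite lee_fin le_min !ge_min lexx/=; apply/orP; right.
  by rewrite ler_nat.
have cf w : limn (g^~ w) = `|(f w)%:E|%E.
  rewrite gee0_abs ?lee_fin//.
  apply/cvg_lim => //; apply: cvg_near_cst; near=> n.
  rewrite /g min_l//; near: n; exact: nbhs_infty_ger.
under eq_integral do rewrite /= -[(`|_|)%:E]/(`|(f _)%:E|%E) -cf.
rewrite monotone_convergence//.
apply: lime_le; last by apply: nearW => n; exact: hg.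
apply: ereal_nondecreasing_is_cvgn => m n mn; apply: ge0_le_integral => //.
by move=> w _; exact: nd.
Unshelve. all: end_near. Qed.

Definition cintegrable (Z : T -> R[i]) :=
  rintegrable (fun w => complex.Re (Z w)) /\ rintegrable (fun w => complex.Im (Z w)).

Definition cmeasurable (Z : T -> R[i]) :=
  measurable_fun setT (fun w => complex.Re (Z w)) /\
  measurable_fun setT (fun w => complex.Im (Z w)).

Lemma cintegrable_measurable Z : cintegrable Z -> cmeasurable Z.
Proof. by move=> [h1 h2]; split; exact: rintegrable_measurable. Qed.

Lemma eq_Cexp Z U : Z =1 U -> Cexpectation P Z = Cexpectation P U.
Proof. by move=> /funext ->. Qed.

Lemma cintegrable_bounded (M : R) Z : cmeasurable Z ->
  (forall w, cnorm (Z w) <= M) -> cintegrable Z.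
Proof.
move=> [m1 m2] ZM; split; apply: (@rintegrable_bounded M) => // w.
- exact: le_trans (normr_Re_le _) (ZM w).
- exact: le_trans (normr_Im_le _) (ZM w).
Qed.

Lemma cintegrableD Z U : cintegrable Z -> cintegrable U -> cintegrable (fun w => Z w + U w).
Proof.
move=> [z1 z2] [u1 u2]; split.
- rewrite (_ : (fun w => _) = fun w => complex.Re (Z w) + complex.Re (U w)); first exact: rintegrableD.
  by apply/funext => w; case: (Z w); case: (U w).
- rewrite (_ : (fun w => _) = fun w => complex.Im (Z w) + complex.Im (U w)); first exact: rintegrableD.
  by apply/funext => w; case: (Z w); case: (U w).
Qed.

Lemma CexpD Z U : cintegrable Z -> cintegrable U ->
  Cexpectation P (fun w => Z w + U w) = Cexpectation P Z + Cexpectation P U.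
Proof.
move=> [z1 z2] [u1 u2]; apply/eqP; rewrite eq_complex /= -!meanD//.
by apply/andP; split; apply/eqP/eq_mean => w; case: (Z w); case: (U w).
Qed.

Lemma cintegrableZ (c : R[i]) Z : cintegrable Z -> cintegrable (fun w => c * Z w).
Proof.
move=> [z1 z2]; case: c => a b; split.
- rewrite (_ : (fun w => _) = fun w => a * complex.Re (Z w) - b * complex.Im (Z w)).
    by apply: rintegrableB; exact: rintegrableZ.
  by apply/funext => w; case: (Z w).
- rewrite (_ : (fun w => _) = fun w => a * complex.Im (Z w) + b * complex.Re (Z w)).
    by apply: rintegrableD; exact: rintegrableZ.
  by apply/funext => w; case: (Z w).
Qed.

Lemma CexpZ (c : R[i]) Z : cintegrable Z ->
  Cexpectation P (fun w => c * Z w) = c * Cexpectation P Z.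
Proof.
move=> [z1 z2]; case: c => a b; apply/eqP; rewrite eq_complex /=.
rewrite -!meanZ// -meanB -?meanD//; try exact: rintegrableZ.
by apply/andP; split; apply/eqP/eq_mean => w; case: (Z w).
Qed.

Lemma cintegrableB Z U : cintegrable Z -> cintegrable U -> cintegrable (fun w => Z w - U w).
Proof.
move=> Zi Ui; under eq_fun do rewrite -[- _]mulN1r.
by apply: cintegrableD => //; exact: cintegrableZ.
Qed.

Lemma CexpB Z U : cintegrable Z -> cintegrable U ->
  Cexpectation P (fun w => Z w - U w) = Cexpectation P Z - Cexpectation P U.
Proof.
move=> Zi Ui; under eq_fun do rewrite -[- _]mulN1r.
by rewrite CexpD ?CexpZ ?mulN1r//; exact: cintegrableZ.
Qed.

Lemma cintegrable_real f : rintegrable f -> cintegrable (fun w => (f w)%:C).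
Proof. by move=> fi; split => //=; exact: rintegrable_cst. Qed.

Lemma Cexp_real f : Cexpectation P (fun w => (f w)%:C) = (mean P f)%:C.
Proof. by rewrite /Cexpectation/= mean_cst. Qed.

Lemma Cexp_cst (c : R[i]) : Cexpectation P (fun=> c) = c.
Proof. by case: c => a b; rewrite /Cexpectation/= !mean_cst. Qed.

(** Multiplication by the conjugate of [z = E[Z]] rotates the expectation onto the positive
    half-line, where [|z|^2] is the mean of a real part. This gives the constant 1, which separate
    bounds on the real and imaginary parts would lose. *)
Lemma cnorm_Cexp_le Z g : cintegrable Z -> rintegrable g ->
  (forall w, cnorm (Z w) <= g w) -> cnorm (Cexpectation P Z) <= mean P g.
Proof.
move=> Zi gi Zg; set z := Cexpectation P Z.
have [->|z0] := eqVneq z 0.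
  by rewrite cnorm0 mean_ge0// => w; exact: le_trans (cnorm_ge0 _) (Zg w).
have nz : 0 < cnorm z by rewrite lt_neqAle cnorm_ge0 andbT eq_sym cnorm_eq0.
have zz : z^*%C * z = (cnorm z ^+ 2)%:C.
  rewrite cnormE sqr_sqrtr ?addr_ge0 ?sqr_ge0//.
  by case: (z) => a b; apply/eqP; rewrite eq_complex/= !expr2; apply/andP; split; apply/eqP; ring.
have nzJ : cnorm z^*%C = cnorm z by rewrite !cnormE; case: (z) => a b /=; rewrite sqrrN.
rewrite -(ler_pM2l nz) -expr2.
have -> : cnorm z ^+ 2 = complex.Re (z^*%C * z) by rewrite zz.
rewrite -CexpZ// /=.
have [zi _] := cintegrableZ z^*%C Zi.
rewrite -meanZ//; apply: le_mean => // [|w]; first exact: rintegrableZ.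
apply: le_trans (ler_norm _) _; apply: le_trans (normr_Re_le _) _.
by rewrite cnormM nzJ ler_wpM2l// ltW.
Qed.

Lemma cmeasurable_expi f : measurable_fun setT f -> cmeasurable (fun w => expi (f w)).
Proof.
move=> mf; split => /=.
- by apply: measurableT_comp => //; apply: continuous_measurable_fun; exact: continuous_cos.
- by apply: measurableT_comp => //; apply: continuous_measurable_fun; exact: continuous_sin.
Qed.

Lemma cintegrable_expi f : measurable_fun setT f -> cintegrable (fun w => expi (f w)).
Proof.
move=> mf; apply: (@cintegrable_bounded 1); first exact: cmeasurable_expi.
by move=> w; rewrite cnorm_expi.
Qed.

Lemma cmeasurableM Z U : cmeasurable Z -> cmeasurable U -> cmeasurable (fun w => Z w * U w).
Proof.
move=> [z1 z2] [u1 u2]; split.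
- rewrite (_ : (fun w => _) = fun w => complex.Re (Z w) * complex.Re (U w) - complex.Im (Z w) * complex.Im (U w)).
    by apply: measurable_funB; exact: measurable_funM.
  by apply/funext => w; case: (Z w); case: (U w).
- rewrite (_ : (fun w => _) = fun w => complex.Re (Z w) * complex.Im (U w) + complex.Im (Z w) * complex.Re (U w)).
    by apply: measurable_funD; exact: measurable_funM.
  by apply/funext => w; case: (Z w); case: (U w).
Qed.

Lemma cmeasurable_prod I (r : seq I) (F : I -> T -> R[i]) :
  (forall i, cmeasurable (F i)) -> cmeasurable (fun w => \prod_(i <- r) F i w).
Proof.
move=> mF; elim: r => [|i r IH].
  by under eq_fun do rewrite big_nil; split; exact: measurable_cst.
by under eq_fun do rewrite big_cons; exact: cmeasurableM.
Qed.

End mean.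

(** * Exchange of expectations over two probability spaces *)

Section mean_fubini.
Context {d1 d2 : measure_display} {T1 : measurableType d1} {T2 : measurableType d2}.
Context {R : realType} (P : probability T1 R) (Q : probability T2 R).

Section dominated.
Variables (g : T1 -> R) (f : T1 * T2 -> R).
Hypotheses (gi : rintegrable P g) (mf : measurable_fun setT f).
Hypothesis fg : forall x y, `|f (x, y)| <= g x.

Let int_f : (P \x Q)%E.-integrable setT (EFin \o f).
Proof.
apply/integrable12ltyP; first exact/measurable_EFinP.
apply: (@le_lt_trans _ _ (\int[P]_x (g x)%:E)%E); last first.
  by have [_] := integrableP _ _ _ gi; apply: le_lt_trans; apply: le_integral => //;
    [exact: integrable_abse|move=> x _ /=; rewrite lee_fin ler_norm].
apply: ge0_le_integral => //.
- by move=> x _; apply: integral_ge0.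
- apply: (@measurable_fun_fubini_tonelli_F _ _ _ _ _ Q (fun z => `|(EFin \o f) z|%E)) => //.
  by apply: measurableT_comp => //; exact/measurable_EFinP.
- by have [] := integrableP _ _ _ gi.
- move=> x _; apply: (@le_trans _ _ (\int[Q]_y (g x)%:E)%E).
    apply: ge0_le_integral => //.
    + apply: measurableT_comp => //; apply/measurable_EFinP.
      by apply: measurableT_comp => //; exact: pair1_measurable.
    + by move=> y _; rewrite /= lee_fin.
  by rewrite integral_cst//= probability_setT mule1.
Qed.

Let int1 x : rintegrable Q (fun y => f (x, y)).
Proof.
apply: (@rintegrable_bounded _ _ _ _ (g x)) => //.
by apply: measurableT_comp => //; exact: pair1_measurable.
Qed.

Let int2 y : rintegrable P (fun x => f (x, y)).
Proof.
apply: (@rintegrable_le _ _ _ _ _ g) => //.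
by apply: measurableT_comp => //; exact: pair2_measurable.
Qed.

Let mean1E x : (mean Q (fun y => f (x, y)))%:E = (\int[Q]_y (f (x, y))%:E)%E.
Proof. by rewrite -EmeanE ?unlock//; exact: int1. Qed.

Let mean2E y : (mean P (fun x => f (x, y)))%:E = (\int[P]_x (f (x, y))%:E)%E.
Proof. by rewrite -EmeanE ?unlock//; exact: int2. Qed.

(** The dominating function depends on the first variable only. This covers the kernel integrals of
    the smoothing inequality, which are bounded by [|y - W|] and not by a constant. *)
Lemma mean_fubini_dominated :
  mean P (fun x => mean Q (fun y => f (x, y))) =
  mean Q (fun y => mean P (fun x => f (x, y))).
Proof.
rewrite !meanE /Rintegral; under eq_integral do rewrite mean1E.
under [in RHS]eq_integral do rewrite mean2E.
by congr fine; exact: (Fubini int_f).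
Qed.

Lemma rintegrable_mean1 : rintegrable P (fun x => mean Q (fun y => f (x, y))).
Proof.
rewrite /rintegrable (_ : _ \o _ = fun x => (\int[Q]_y (f (x, y))%:E)%E).
  exact: (integrable_fubini_F int_f).
by apply/funext => x; rewrite /= mean1E.
Qed.

Lemma rintegrable_mean2 : rintegrable Q (fun y => mean P (fun x => f (x, y))).
Proof.
apply: (@rintegrable_bounded _ _ _ _ (mean P g)).
  apply/measurable_EFinP; rewrite (_ : _ \o _ = fun y => (\int[P]_x (f (x, y))%:E)%E).
    exact: (measurable_fubini_G int_f).
  by apply/funext => y; rewrite /= mean2E.
by move=> y; apply: normr_mean_le => //; exact: int2.
Qed.

End dominated.

Lemma mean_fubini (M : R) (f : T1 * T2 -> R) : measurable_fun setT f ->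
  (forall z, `|f z| <= M) ->
  mean P (fun x => mean Q (fun y => f (x, y))) =
  mean Q (fun y => mean P (fun x => f (x, y))).
Proof.
move=> mf fM; apply: (@mean_fubini_dominated (fun=> M)) => //.
exact: rintegrable_cst.
Qed.

Lemma Cexp_fubini (M : R) (f : T1 * T2 -> R[i]) : cmeasurable f ->
  (forall z, cnorm (f z) <= M) ->
  Cexpectation P (fun x => Cexpectation Q (fun y => f (x, y))) =
  Cexpectation Q (fun y => Cexpectation P (fun x => f (x, y))).
Proof.
move=> [m1 m2] fM; apply/eqP; rewrite eq_complex/=; apply/andP; split; apply/eqP.
- apply: (@mean_fubini M (fun z => complex.Re (f z))) => // z.
  exact: le_trans (normr_Re_le _) (fM z).
- apply: (@mean_fubini M (fun z => complex.Im (f z))) => // z.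
  exact: le_trans (normr_Im_le _) (fM z).
Qed.

Lemma cintegrable_Cexp1 (M : R) (f : T1 * T2 -> R[i]) : cmeasurable f ->
  (forall z, cnorm (f z) <= M) -> cintegrable P (fun x => Cexpectation Q (fun y => f (x, y))).
Proof.
move=> [m1 m2] fM; split; rewrite /=.
- apply: (@rintegrable_mean1 (fun=> M) (fun z => complex.Re (f z))) => //.
    exact: rintegrable_cst.
  by move=> x y; exact: le_trans (normr_Re_le _) (fM _).
- apply: (@rintegrable_mean1 (fun=> M) (fun z => complex.Im (f z))) => //.
    exact: rintegrable_cst.
  by move=> x y; exact: le_trans (normr_Im_le _) (fM _).
Qed.

Lemma cintegrable_Cexp2 (M : R) (f : T1 * T2 -> R[i]) : cmeasurable f ->
  (forall z, cnorm (f z) <= M) -> cintegrable Q (fun y => Cexpectation P (fun x => f (x, y))).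
Proof.
move=> [m1 m2] fM; split; rewrite /=.
- apply: (@rintegrable_mean2 (fun=> M) (fun z => complex.Re (f z))) => //.
    exact: rintegrable_cst.
  by move=> x y; exact: le_trans (normr_Re_le _) (fM _).
- apply: (@rintegrable_mean2 (fun=> M) (fun z => complex.Im (f z))) => //.
    exact: rintegrable_cst.
  by move=> x y; exact: le_trans (normr_Im_le _) (fM _).
Qed.

End mean_fubini.

(** * One-variable calculus, Taylor bounds and averages over an interval *)

Section calculus.
Context {R : realType}.
Implicit Types f g : R -> R.

(** It replaces differentiation under the integral sign: for the parameter integrals below, a
    quadratic remainder is obtained by averaging a pointwise one. *)
Lemma is_derive_quadratic f (x l C : R) :
  (forall h, `|f (x + h) - f x - h * l| <= C * h ^+ 2) -> is_derive x 1 f l.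
Proof.
move=> fC.
have C0 : 0 <= C by have := le_trans (normr_ge0 _) (fC 1); rewrite expr1n mulr1.
suff h : (h^-1 *: ((f \o shift x) (h *: 1) - f x) @[h --> 0^'] --> l).
  apply: DeriveDef; last exact/cvg_lim.
  by apply/cvg_ex; exists l.
apply/cvgrPdist_le => e e0; near=> h.
have h0 : h != 0 by near: h; exact: nbhs_dnbhs_neq.
rewrite /= /GRing.scale /= mulr1 (addrC h).
have -> : l - h^-1 * (f (x + h) - f x) = - (h^-1 * (f (x + h) - f x - h * l)).
  by field.
rewrite normrN normrM normfV ler_pdivrMl ?normr_gt0//.
apply: le_trans (fC h) _; rewrite -real_normK ?num_real// expr2 mulrCA.
rewrite ler_wpM2l//.
have he : `|h| <= e / (C + 1).
  near: h; apply: dnbhs0_le; rewrite divr_gt0//; lra.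
apply: le_trans (ler_wpM2l C0 he) _.
rewrite mulrCA ler_piMr ?(ltW e0)// ler_pdivrMr; lra.
Unshelve. all: by end_near. Qed.

Lemma derive_le_itv f g (f' g' : R -> R) (a x : R) :
  (forall y, a < y -> is_derive y 1 f (f' y)) -> (forall y, a < y -> is_derive y 1 g (g' y)) ->
  {within `[a, x], continuous f} -> {within `[a, x], continuous g} ->
  f a <= g a -> (forall y, a < y -> y < x -> f' y <= g' y) -> a <= x -> f x <= g x.
Proof.
move=> df dg cf cg fga fg'.
rewrite le_eqVlt => /predU1P[<-//|ax].
have dh y : y \in `]a, x[ -> is_derive y 1 (fun y => g y - f y) (g' y - f' y).
  rewrite in_itv/= => /andP[ay _].
  have := df y ay; have := dg y ay => h1 h2; exact: is_deriveB.
have ch : {within `[a, x], continuous (fun y => g y - f y)}.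
  by move=> z; apply: cvgB; [exact: cg|exact: cf].
have [c] := MVT ax dh ch.
rewrite in_itv/= => /andP[ac cx] e.
have : 0 <= g x - f x - (g a - f a).
  by rewrite e mulr_ge0 ?subr_ge0 ?fg'// ltW.
by move=> h; have := addr_ge0 h (_ : 0 <= g a - f a); rewrite subrK !subr_ge0; apply.
Qed.

Lemma derive_le f g (f' g' : R -> R) (a x : R) :
  (forall y, a < y -> is_derive y 1 f (f' y)) -> (forall y, a < y -> is_derive y 1 g (g' y)) ->
  {within `[a, x], continuous f} -> {within `[a, x], continuous g} ->
  f a <= g a -> (forall y, a < y -> f' y <= g' y) -> a <= x -> f x <= g x.
Proof.
move=> df dg cf cg fga fg'; apply: (derive_le_itv df dg cf cg fga) => y ay _.
exact: fg'.
Qed.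

Lemma derivable_continuousT f : (forall x : R, derivable f x 1) -> continuous f.
Proof.
by move=> df x; apply: differentiable_continuous; apply/derivable1_diffP; exact: df.
Qed.

Lemma is_derive_continuousT f (f' : R -> R) :
  (forall y : R, is_derive y 1 f (f' y)) -> continuous f.
Proof.
by move=> df; apply: derivable_continuousT => x; have := df x => -[].
Qed.

Lemma derive_leT f g (f' g' : R -> R) (a x : R) :
  (forall y : R, is_derive y 1 f (f' y)) -> (forall y : R, is_derive y 1 g (g' y)) ->
  f a <= g a -> (forall y, a < y -> f' y <= g' y) -> a <= x -> f x <= g x.
Proof.
move=> df dg; apply: (@derive_le f g f' g') => //.
- by apply: continuous_subspaceT; exact: is_derive_continuousT df.
- by apply: continuous_subspaceT; exact: is_derive_continuousT dg.
Qed.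

(** This bound and the ones that follow climb by one degree at a time: through [derive_leT], each is
    the integral of a bound of lower degree on the derivative. *)
Lemma sin_le (x : R) : 0 <= x -> sin x <= x.
Proof.
move=> x0; apply: (@derive_leT sin id cos (fun=> 1) 0) => //.
by rewrite sin0.
Qed.

Lemma oneBcos_le (x : R) : 0 <= x -> 1 - cos x <= x.
Proof.
move=> x0; apply: (@derive_leT (fun x => 1 - cos x) id sin (fun=> 1) 0) => //.
  by move=> y; apply: is_derive_eq; rewrite /GRing.scale/=; ring.
by rewrite cos0 subrr.
Qed.

Lemma oneBcos_le2 (x : R) : 0 <= x -> 1 - cos x <= x ^+ 2 / 2.
Proof.
move=> x0; apply: (@derive_leT (fun x => 1 - cos x) (fun x => x ^+ 2 / 2) sin id 0) => //.
- by move=> y; apply: is_derive_eq; rewrite /GRing.scale/=; ring.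
- by move=> y; apply: is_derive_eq; rewrite /GRing.scale/=; field.
- by rewrite cos0 subrr expr0n mul0r.
- by move=> y y0; apply: sin_le; exact: ltW.
Qed.

Lemma subr_sin_le2 (x : R) : 0 <= x -> x - sin x <= x ^+ 2 / 2.
Proof.
move=> x0; apply: (@derive_leT (fun x => x - sin x) (fun x => x ^+ 2 / 2) (fun x => 1 - cos x) id 0) => //.
- by move=> y; apply: is_derive_eq; rewrite /GRing.scale/=; field.
- by rewrite sin0 subrr expr0n mul0r.
- by move=> y y0; apply: oneBcos_le; exact: ltW.
Qed.

Lemma subr_sin_le3 (x : R) : 0 <= x -> x - sin x <= x ^+ 3 / 6.
Proof.
move=> x0; apply: (@derive_leT (fun x => x - sin x) (fun x => x ^+ 3 / 6) (fun x => 1 - cos x) (fun x => x ^+ 2 / 2) 0) => //.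
- by move=> y; apply: is_derive_eq; rewrite /GRing.scale/=; field.
- by rewrite sin0 subrr expr0n mul0r.
- by move=> y y0; apply: oneBcos_le2; exact: ltW.
Qed.

Lemma cos_sub_le3 (x : R) : 0 <= x -> cos x - 1 + x ^+ 2 / 2 <= x ^+ 3 / 6.
Proof.
move=> x0; apply: (@derive_leT (fun x => cos x - 1 + x ^+ 2 / 2) (fun x => x ^+ 3 / 6) (fun x => x - sin x) (fun x => x ^+ 2 / 2) 0) => //.
- by move=> y; apply: is_derive_eq; rewrite /GRing.scale/=; field.
- by move=> y; apply: is_derive_eq; rewrite /GRing.scale/=; field.
- by rewrite cos0 subrr !expr0n !mul0r addr0.
- by move=> y y0; apply: subr_sin_le2; exact: ltW.
Qed.

Lemma cos_ge2 (x : R) : 0 <= x -> 0 <= cos x - 1 + x ^+ 2 / 2.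
Proof. by move=> /oneBcos_le2; lra. Qed.

Lemma normr_sin_le (x : R) : `|sin x| <= `|x|.
Proof.
wlog x0 : x / 0 <= x.
  move=> h; have [/h//|x0] := leP 0 x; rewrite -(normrN (sin x)) -(normrN x) -sinN.
  by apply: h; rewrite oppr_ge0 ltW.
rewrite (ger0_norm x0) ler_norml sin_le// andbT.
have [x1|x1] := leP x 1; last by rewrite (le_trans _ (sin_geN1 x))// lerN2 ltW.
have := subr_sin_le2 x0; have : x ^+ 2 / 2 <= x * 1 / 2 by rewrite expr2 ler_pM2r// ler_wpM2l.
lra.
Qed.

Lemma normr_oneBcos_le (x : R) : `|1 - cos x| <= x ^+ 2 / 2.
Proof.
rewrite ger0_norm ?subr_ge0 ?cos_le1//.
by rewrite -(real_normK (num_real x)) -cos_norm; exact: oneBcos_le2.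
Qed.

Lemma normr_oneBcos_le1 (x : R) : `|1 - cos x| <= `|x|.
Proof.
by rewrite ger0_norm ?subr_ge0 ?cos_le1// -cos_norm; exact: oneBcos_le.
Qed.

Lemma normr_sin_sub_le (x : R) : `|sin x - x| <= x ^+ 2 / 2.
Proof.
wlog x0 : x / 0 <= x.
  move=> h; have [/h//|x0] := leP 0 x; rewrite -normrN -(sqrrN x) opprD -sinN.
  by apply: h; rewrite oppr_ge0 ltW.
by rewrite distrC ger0_norm ?subr_ge0 ?sin_le// subr_sin_le2.
Qed.

Lemma normr_sin_sub_le3 (x : R) : `|sin x - x| <= `|x| ^+ 3 / 6.
Proof.
wlog x0 : x / 0 <= x.
  move=> h; have [/h//|x0] := leP 0 x; rewrite -normrN -(normrN x) opprD -sinN.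
  by apply: h; rewrite oppr_ge0 ltW.
by rewrite distrC !ger0_norm ?subr_ge0 ?sin_le// subr_sin_le3.
Qed.

Lemma normr_cos_sub_le3 (x : R) : `|cos x - 1 + x ^+ 2 / 2| <= `|x| ^+ 3 / 6.
Proof.
rewrite -(real_normK (num_real x)) -cos_norm.
have x0 := normr_ge0 x; move: `|x| x0 => y y0.
by rewrite ger0_norm ?cos_ge2// cos_sub_le3.
Qed.

Lemma cnorm_expi_sub1 (x : R) : cnorm (expi x - 1) <= 2 * `|x|.
Proof.
apply: le_trans (cnorm_le _) _; rewrite /= subr0 distrC.
by have := normr_oneBcos_le1 x; have := normr_sin_le x; lra.
Qed.

Lemma cnorm_expi_sub2 (x : R) : cnorm (expi x - 1 - Complex 0 x) <= x ^+ 2.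
Proof.
apply: le_trans (cnorm_le _) _; rewrite /= !subr0 distrC.
by have := normr_oneBcos_le x; have := normr_sin_sub_le x; lra.
Qed.

Lemma cnorm_expi_sub3 (x : R) :
  cnorm (expi x - 1 - Complex 0 x + (x ^+ 2 / 2)%:C) <= `|x| ^+ 3.
Proof.
apply: le_trans (cnorm_le _) _; rewrite /= !subr0 addr0.
have := normr_cos_sub_le3 x; have := normr_sin_sub_le3 x.
have : 0 <= `|x| ^+ 3 by rewrite exprn_ge0.
lra.
Qed.

Lemma sin_add_le (x h : R) : `|sin (x + h) - sin x - h * cos x| <= h ^+ 2.
Proof.
rewrite sinD.
have -> : sin x * cos h + cos x * sin h - sin x - h * cos x =
  - (sin x * (1 - cos h)) + cos x * (sin h - h) by ring.
apply: le_trans (ler_normD _ _) _; rewrite normrN !normrM.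
have := normr_oneBcos_le h; have := normr_sin_sub_le h.
have := sin_max x; have := cos_max x.
have := normr_ge0 (1 - cos h); have := normr_ge0 (sin h - h).
move: (`|sin x|) (`|cos x|) (`|1 - cos h|) (`|sin h - h|) => A B C D; nra.
Qed.

Lemma cos_add_le (x h : R) : `|cos (x + h) - cos x + h * sin x| <= h ^+ 2.
Proof.
rewrite cosD.
have -> : cos x * cos h - sin x * sin h - cos x + h * sin x =
  - (cos x * (1 - cos h)) - sin x * (sin h - h) by ring.
apply: le_trans (ler_normB _ _) _; rewrite normrN !normrM.
have := normr_oneBcos_le h; have := normr_sin_sub_le h.
have := sin_max x; have := cos_max x.
have := normr_ge0 (1 - cos h); have := normr_ge0 (sin h - h).
move: (`|sin x|) (`|cos x|) (`|1 - cos h|) (`|sin h - h|) => A B C D; nra.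
Qed.

Lemma expRN_le_inv (x : R) : 0 <= x -> expR (- x) <= (1 + x)^-1.
Proof.
move=> x0; rewrite expRN lef_pV2 ?posrE ?expR_gt0//; last lra.
exact: expR_ge1Dx.
Qed.

Lemma expRN_sub_le (x : R) : 0 <= x -> `|expR (- x) - 1 + x| <= x ^+ 2 / 2.
Proof.
move=> x0; rewrite ger0_norm; last by have := expR_ge1Dx (- x); lra.
apply: (@derive_leT (fun x => expR (- x) - 1 + x) (fun x => x ^+ 2 / 2) (fun x => 1 - expR (- x)) id 0) => //.
- by move=> y; apply: is_derive_eq; rewrite /GRing.scale/=; ring.
- by move=> y; apply: is_derive_eq; rewrite /GRing.scale/=; field.
- by rewrite oppr0 expR0 subrr expr0n !mul0r addr0.
- by move=> y y0; have := expR_ge1Dx (- y); lra.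
Qed.

(** Half of the exponent absorbs the linear factor. *)
Lemma mul_expRN_le (c x : R) : 0 < c -> x * expR (- (c * x)) <= 2 / c * expR (- (c * x / 2)).
Proof.
move=> c0; have -> : - (c * x) = - (c * x / 2) + - (c * x / 2) by field.
rewrite expRD mulrA; apply: ler_wpM2r; first exact: expR_ge0.
rewrite expRN ler_pdivrMr ?expR_gt0//.
have := expR_ge1Dx (c * x / 2) => h; rewrite -ler_pdivrMl ?divr_gt0// invf_div.
by lra.
Qed.

Section uniform.
Variables (a b : R) (ab : a < b).

(* clipping keeps the argument in ]a, b], outside of which the uniform law has no mass *)
Definition clip (t : R) : R := if (a < t) && (t <= b) then t else b.

Lemma clip_itv t : a < clip t <= b.
Proof. by rewrite /clip; case: ifPn => //; rewrite lexx ab. Qed.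

Lemma measurable_clip : measurable_fun setT clip.
Proof.
apply: measurable_fun_if => //.
by apply: measurable_and; [exact: measurable_fun_ltr|exact: measurable_fun_ler].
Qed.

(** Averages over an interval are encoded as expectations under the uniform law, so that the lemmas
    on [mean], Fubini included, apply to them. *)
Definition unif_mean (f : R -> R) : R := mean (uniform_prob ab) (fun t => f (clip t)).

Lemma clip_id t : a < t <= b -> clip t = t.
Proof. by rewrite /clip => ->. Qed.

Lemma unif_mean_int (f : R -> R) : continuous f ->
  rintegrable (uniform_prob ab) (fun t => f (clip t)).
Proof.
move=> cf.
have cfab : {within `[a, b], continuous f} by exact: continuous_subspaceT.
have [c1 _ fmax] := EVT_max (ltW ab) cfab.
have [c2 _ fmin] := EVT_min (ltW ab) cfab.
apply: (@rintegrable_bounded _ _ _ _ (`|f c1| + `|f c2|)) => [|t].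
  by apply: (measurableT_comp (continuous_measurable_fun cf)); exact: measurable_clip.
have clab : clip t \in `[a, b].
  by have /andP[h1 h2] := clip_itv t; rewrite in_itv/= (ltW h1).
have := fmax _ clab; have := fmin _ clab.
have := ler_norm (f c1); have := ler_norm (- f c2); rewrite normrN.
have := normr_ge0 (f c1); have := normr_ge0 (f c2).
rewrite ler_norml; lra.
Qed.

Lemma unif_meanE (f : R -> R) : continuous f ->
  unif_mean f = (b - a)^-1 * \int[lebesgue_measure]_(x in `[a, b]) f x.
Proof.
move=> cf.
have cfab : {within `[a, b], continuous f} by exact: continuous_subspaceT.
have [c2 _ fmin] := EVT_min (ltW ab) cfab.
have clab t : clip t \in `[a, b].
  by have /andP[h1 h2] := clip_itv t; rewrite in_itv/= (ltW h1).
have fi := unif_mean_int cf.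
(* [integral_uniform] takes a nonnegative integrand; subtracting the minimum [f c2] provides one. *)
pose g t := f t - f c2.
have cg : continuous g by move=> x; apply: cvgB; [exact: cf|exact: cvg_cst].
have e1 : unif_mean f = mean (uniform_prob ab) (fun t => g (clip t)) + f c2.
  by rewrite /g meanB ?mean_cst ?subrK//; exact: rintegrable_cst.
have il h : continuous h -> lebesgue_measure.-integrable `[a, b] (EFin \o h).
  move=> ch; apply: continuous_compact_integrable; first exact: segment_compact.
  exact: continuous_subspaceT.
rewrite e1 meanE /Rintegral integral_uniform; last 2 first.
- apply/measurable_EFinP; apply: (measurableT_comp (continuous_measurable_fun cg)).
  exact: measurable_clip.
- by move=> x; rewrite lee_fin subr_ge0 fmin.
have -> : (\int[lebesgue_measure]_(x in `[a, b]) (g (clip x))%:E =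
   \int[lebesgue_measure]_(x in `[a, b]) (g x)%:E)%E.
  rewrite -!integral_itv_obnd_cbnd.
  - by apply: eq_integral => x; rewrite inE/= in_itv/= => h; rewrite clip_id.
  - by apply: measurable_funTS; apply/measurable_EFinP; exact: continuous_measurable_fun.
  - apply: measurable_funTS; apply/measurable_EFinP; apply: (measurableT_comp (continuous_measurable_fun cg)).
    exact: measurable_clip.
rewrite fineM//; last by apply: integrable_fin_num => //; exact: il.
have e2 : \int[lebesgue_measure]_(x in `[a, b]) f x =
    \int[lebesgue_measure]_(x in `[a, b]) g x + f c2 * (b - a).
  rewrite /g RintegralB//; [|exact: il|exact/il/cst_continuous].
  by rewrite Rintegral_cst//= lebesgue_measure_itv/= lte_fin ab -EFinB/= subrK.
rewrite /Rintegral in e2; rewrite e2/=; field.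
by rewrite subr_eq0 gt_eqF.
Qed.

Lemma unif_mean_FTC (f F : R -> R) : (forall x : R, is_derive x 1 F (f x)) -> continuous f ->
  unif_mean f = (F b - F a) / (b - a).
Proof.
move=> dF cf; have cF : continuous F by exact: is_derive_continuousT dF.
rewrite unif_meanE// /Rintegral (@continuous_FTC2 _ f F) //.
- by rewrite -EFinB/= mulrC.
- exact: continuous_subspaceT.
- split; first by move=> x _; have := dF x => -[].
  + by apply: cvg_at_right_filter; exact: cF.
  + by apply: cvg_at_left_filter; exact: cF.
- by move=> x _; rewrite derive1E; have := dF x => dFx; exact: derive_val.
Qed.

Lemma unif_mean_linear (f g : R -> R) (c : R) : continuous f -> continuous g ->
  unif_mean (fun x => f x + c * g x) = unif_mean f + c * unif_mean g.
Proof.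
move=> cf cg; rewrite /unif_mean meanD ?meanZ//.
all: try exact: unif_mean_int.
by apply: rintegrableZ; exact: unif_mean_int.
Qed.

Lemma unif_mean_gauss_int (c : R) : 0 < c ->
  rintegrable (uniform_prob ab) (fun t => expR (- (c * clip t ^+ 2))).
Proof.
move=> c0; apply: (@rintegrable_bounded _ _ _ _ 1).
  apply: (measurableT_comp (@measurable_expR R)); apply: measurable_funN.
  by apply: measurable_funM => //; apply: measurable_funX; exact: measurable_clip.
move=> t; rewrite ger0_norm ?expR_ge0// -[leRHS]expR0 ler_expR oppr_le0.
by rewrite mulr_ge0 ?sqr_ge0// ltW.
Qed.

(** The Gaussian is majorized by [1 / (1 + c t^2)], whose antiderivative [atan (s t) / s] varies by
    less than [pi / s]; the constant 4 bounds [pi]. *)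
Lemma unif_mean_gauss_le (c : R) : 0 < c ->
  unif_mean (fun t => expR (- (c * t ^+ 2))) <= 4 / (b - a) / Num.sqrt c.
Proof.
move=> c0; set s := Num.sqrt c; have s0 : 0 < s by rewrite sqrtr_gt0.
have sc : s ^+ 2 = c by rewrite sqr_sqrtr// ltW.
have dF (x : R) : is_derive x 1 (fun t => atan (s * t) / s) ((1 + (s * x) ^+ 2)^-1).
  have d1 : is_derive x 1 (fun t => s * t) s by apply: is_derive_eq; rewrite /GRing.scale/= mulr1.
  have d2 := @is_derive1_comp _ (@atan R) (fun t => s * t) x _ _ (is_derive1_atan (s * x)) d1.
  apply: is_derive_eq; rewrite /GRing.scale/=; field.
  by rewrite [s == 0]gt_eqF// gt_eqF// ltr_pwDl// sqr_ge0.
have cF : continuous (fun x : R => (1 + (s * x) ^+ 2)^-1).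
  apply: derivable_continuousT => x.
  have n0 : 1 + (s * x) ^+ 2 != 0 by rewrite gt_eqF// ltr_pwDl// sqr_ge0.
  have dV := @is_deriveV _ (fun x => 1 + (s * x) ^+ 2) x 1 _ n0; exact: ex_derive.
apply: (@le_trans _ _ (unif_mean (fun t => (1 + (s * t) ^+ 2)^-1))); last first.
  rewrite (unif_mean_FTC dF cF) -mulrBl mulrAC ler_pM2r ?invr_gt0//.
  rewrite ler_pM2r ?invr_gt0 ?subr_gt0//.
  have := @atan_ltpi2 R (s * b); have := @atan_gtNpi2 R (s * a); have := @pihalf_lt2 R; lra.
apply: le_mean; first exact: unif_mean_gauss_int.
  exact: (unif_mean_int cF).
by move=> t; rewrite exprMn sc; apply: expRN_le_inv; rewrite mulr_ge0 ?sqr_ge0// ltW.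
Qed.

End uniform.

End calculus.

(** * Smoothing inequality *)

Section smoothing.
Context {R : realType}.
Implicit Types (kappa f g : R -> R) (u t : R).

Notation m01 := (@unif_mean R 0 1 (@ltr01 R)).
Notation c01 := (@clip R 0 1).

Lemma clip01 t : 0 < c01 t /\ c01 t <= 1.
Proof. by have /andP[] := clip_itv (@ltr01 R) t. Qed.

Lemma measurable_clipV : measurable_fun setT (fun t => (c01 t)^-1).
Proof.
rewrite (_ : (fun _ => _) = fun t => powR (c01 t) (-1)).
  by apply: (measurableT_comp (@measurable_powR R (-1))); exact: measurable_clip.
by apply/funext => t; rewrite powR_inv1// ltW//; have [] := clip01 t.
Qed.

Section kernel.
Variable kappa : R -> R.
Hypothesis mk : measurable_fun setT kappa.
Hypothesis k01 : forall t, 0 < t -> t <= 1 -> 0 <= kappa t <= 1.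

(** Up to a factor, a smoothed sign function with frequencies in ]0, 1]; [cosine_kernel] is its
    derivative. *)
Definition sine_kernel u := m01 (fun t => sin (t * u) / t * kappa t).
Definition cosine_kernel u := m01 (fun t => cos (t * u) * kappa t).

Let kc t : 0 <= kappa (c01 t) <= 1.
Proof. by have [h1 h2] := clip01 t; exact: k01. Qed.

Let mkc : measurable_fun setT (fun t => kappa (c01 t)).
Proof. by apply: measurableT_comp => //; exact: measurable_clip. Qed.

Lemma sine_kernel_bound u t : `|sin (c01 t * u) / c01 t * kappa (c01 t)| <= `|u|.
Proof.
have [h1 h2] := clip01 t; have /andP[k0 k1] := kc t.
rewrite !normrM normfV (gtr0_norm h1) (ger0_norm k0) -[leRHS]mulr1.
apply: ler_pM => //; first by rewrite divr_ge0// ltW.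
rewrite ler_pdivrMr//; apply: le_trans (normr_sin_le _) _.
by rewrite normrM (gtr0_norm h1) mulrC.
Qed.

Lemma sine_kernel_int u :
  rintegrable (uniform_prob (@ltr01 R)) (fun t => sin (c01 t * u) / c01 t * kappa (c01 t)).
Proof.
apply: (@rintegrable_bounded _ _ _ _ `|u|); last exact: sine_kernel_bound.
apply: measurable_funM => //; apply: measurable_funM; last exact: measurable_clipV.
apply: (measurableT_comp (continuous_measurable_fun (@continuous_sin R))).
by apply: measurable_funM => //; exact: measurable_clip.
Qed.

Lemma cosine_kernel_int u :
  rintegrable (uniform_prob (@ltr01 R)) (fun t => cos (c01 t * u) * kappa (c01 t)).
Proof.
apply: (@rintegrable_bounded _ _ _ _ 1).
  apply: measurable_funM => //.
  apply: (measurableT_comp (continuous_measurable_fun (@continuous_cos R))).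
  by apply: measurable_funM => //; exact: measurable_clip.
move=> t; have /andP[k0 k1] := kc t.
by rewrite normrM -[leRHS]mulr1 ler_pM ?cos_max// ger0_norm.
Qed.

Lemma normr_sine_kernel_le u : `|sine_kernel u| <= `|u|.
Proof.
rewrite -[leRHS](@mean_cst _ _ _ (uniform_prob (@ltr01 R))).
apply: normr_mean_le; [exact: sine_kernel_int|exact: rintegrable_cst|].
by move=> t; exact: sine_kernel_bound.
Qed.

Lemma sine_kernelN u : sine_kernel (- u) = - sine_kernel u.
Proof.
rewrite /sine_kernel /unif_mean -meanN; last exact: sine_kernel_int.
by apply: eq_mean => t; rewrite mulrN sinN !mulNr.
Qed.

Lemma is_derive_sine_kernel u : is_derive u 1 sine_kernel (cosine_kernel u).
Proof.
apply: (@is_derive_quadratic _ _ _ _ 1) => h; rewrite mul1r.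
rewrite /sine_kernel /cosine_kernel /unif_mean -meanZ; last exact: cosine_kernel_int.
have i1 := sine_kernel_int (u + h); have i2 := sine_kernel_int u.
have i3 := rintegrableZ h (cosine_kernel_int u).
have i12 := rintegrableB i1 i2.
rewrite -meanB// -meanB//.
rewrite -[leRHS](@mean_cst _ _ _ (uniform_prob (@ltr01 R))).
apply: normr_mean_le => [| |t]; [exact: rintegrableB|exact: rintegrable_cst|].
have [h1 h2] := clip01 t; have /andP[k0 k1] := kc t.
move: (c01 t) h1 h2 k0 k1 => {}t h1 h2 k0 k1.
have -> : sin (t * (u + h)) / t * kappa t - sin (t * u) / t * kappa t - h * (cos (t * u) * kappa t)
  = (sin (t * u + t * h) - sin (t * u) - (t * h) * cos (t * u)) / t * kappa t.
  by rewrite mulrDr; field; rewrite gt_eqF.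
rewrite !normrM normfV (gtr0_norm h1) (ger0_norm k0) -[leRHS]mulr1.
apply: ler_pM => //; first by rewrite divr_ge0// ltW.
rewrite ler_pdivrMr//; apply: le_trans (sin_add_le _ _) _.
rewrite exprMn mulrC ler_wpM2l ?sqr_ge0// expr2 ler_piMr// ltW//.
Qed.

End kernel.

(** The double zero at 1 makes the cosine transform decay like [u^-3]. Hence [sine_kernel]
    approaches its limit at rate [u^-2], the order of the lower bound of [fejer_bump]. *)
Definition smooth_cutoff t := (1 - t ^+ 2) ^+ 2.
(** The cosine transform of this triangle is the Fejer kernel, which is nonnegative. *)
Definition tent t := 1 - t.

Lemma measurable_smooth_cutoff : measurable_fun setT smooth_cutoff.
Proof.
by apply: measurable_funX; apply: measurable_funB => //; exact: measurable_funX.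
Qed.

Lemma measurable_tent : measurable_fun setT tent.
Proof. exact: measurable_funB. Qed.

Lemma smooth_cutoff01 t : 0 < t -> t <= 1 -> 0 <= smooth_cutoff t <= 1.
Proof.
move=> t0 t1; rewrite /smooth_cutoff sqr_ge0/=.
have h : 0 <= 1 - t ^+ 2 <= 1 by rewrite expr2; nra.
move: (1 - t ^+ 2) h => y h; rewrite expr2; nra.
Qed.

Lemma tent01 t : 0 < t -> t <= 1 -> 0 <= tent t <= 1.
Proof. by move=> t0 t1; rewrite /tent; lra. Qed.

Notation H := (sine_kernel smooth_cutoff).
Notation Fej := (sine_kernel tent).
Notation Fj := (cosine_kernel tent).

Let FTC01 f (F : R -> R) : (forall x : R, is_derive x 1 F (f x)) -> continuous f ->
  m01 f = F 1 - F 0.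
Proof. by move=> dF cf; rewrite (unif_mean_FTC (@ltr01 R) dF cf) subr0 divr1. Qed.

Lemma fejer_kernelE u : u != 0 -> Fj u = (1 - cos u) / u ^+ 2.
Proof.
move=> u0; rewrite /cosine_kernel.
have dF (x : R) : is_derive x 1 (fun t => (1 - t) * sin (t * u) / u - cos (t * u) / u ^+ 2)
    (cos (x * u) * tent x).
  by apply: is_derive_eq; rewrite /GRing.scale/= /tent; field; rewrite u0.
rewrite (FTC01 dF); first by rewrite !mul0r !mul1r sin0 cos0; field.
by apply: derivable_continuousT => x; exact: ex_derive.
Qed.

Lemma fejer_kernel_ge0 u : 0 <= Fj u.
Proof.
have [->|u0] := eqVneq u 0; last by rewrite fejer_kernelE// divr_ge0 ?sqr_ge0// subr_ge0 cos_le1.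
apply: mean_ge0 => t; have [h1 h2] := clip01 t.
by rewrite mulr0 cos0 mul1r /tent subr_ge0.
Qed.

Lemma fejer_kernel0 : Fj 0 = 2^-1.
Proof.
have dF (x : R) : is_derive x 1 (fun t => t - t ^+ 2 / 2) (cos (x * 0) * tent x).
  by apply: is_derive_eq; rewrite /GRing.scale/= /tent (mulr0 x) cos0; field.
rewrite /cosine_kernel (FTC01 dF); first by rewrite expr0n/=; field.
by apply: derivable_continuousT => x; exact: ex_derive.
Qed.

(** [Fj] vanishes at the nonzero multiples of [2 pi]. Its translate by [pi] fills these zeros, since
    one of [1 - cos u] and [1 + cos u] is always at least 1. *)
Definition fejer_bump u := Fj u + Fj (u + pi).

Lemma bump_ge u : (2 * u ^+ 2 + 2 * pi ^+ 2)^-1 <= fejer_bump u.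
Proof.
have pi2 := @pi_ge2 R.
have c0 : 0 < 2 * u ^+ 2 + 2 * pi ^+ 2.
 
  have := sqr_ge0 u; have : 0 < pi ^+ 2 :> R by rewrite exprn_gt0// pi_gt0.
  lra.
have [c1|c1] := leP (cos u) 0.
- have u0 : u != 0 by apply: contraTneq c1 => ->; rewrite cos0 -ltNge.
  apply: (@le_trans _ _ (Fj u)); last by rewrite lerDl fejer_kernel_ge0.
  have u2 : 0 < u ^+ 2 by rewrite exprn_even_gt0.
  rewrite fejer_kernelE// ler_pdivlMr// mulrC ler_pdivrMr//.
  have := sqr_ge0 (@pi R); nra.
- have [u0|u0] := eqVneq (u + pi) 0.
    have -> : fejer_bump u = Fj u + 2^-1 by rewrite /fejer_bump u0 fejer_kernel0.
    apply: (@le_trans _ _ 2^-1); last by rewrite lerDr fejer_kernel_ge0.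
    rewrite lef_pV2 ?posrE//; have := sqr_ge0 u; nra.
  apply: (@le_trans _ _ (Fj (u + pi))); last by rewrite lerDr fejer_kernel_ge0.
  have u2 : 0 < (u + pi) ^+ 2 by rewrite exprn_even_gt0.
  rewrite fejer_kernelE// cosDpi ler_pdivlMr// mulrC ler_pdivrMr//.
  have h : (u + pi) ^+ 2 <= 2 * u ^+ 2 + 2 * pi ^+ 2 by have := sqr_ge0 (u - pi); nra.
  by apply: le_trans h _; rewrite ler_peMl ?(ltW c0)//; lra.
Qed.

(** Repeated integration by parts. The boundary terms of order [1 / u] and [1 / u^2] vanish at both
    ends, at 1 because of the double zero of the cutoff. *)
Lemma cosine_smooth_cutoffE u : u != 0 -> cosine_kernel smooth_cutoff u =
  4 / u ^+ 3 * (- 2 * sin u - 6 * cos u / u + 6 * sin u / u ^+ 2).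
Proof.
move=> u0; rewrite /cosine_kernel.
have dF (x : R) : is_derive x 1 (fun t => (1 - t ^+ 2) ^+ 2 * sin (t * u) / u +
  4 / u * (- t * (1 - t ^+ 2) * cos (t * u) / u + 1 / u * ((1 - 3 * t ^+ 2) * sin (t * u) / u
   + 6 / u * (- t * cos (t * u) / u + sin (t * u) / u ^+ 2)))) (cos (x * u) * smooth_cutoff x).
  apply: is_derive_eq; rewrite /GRing.scale/= /smooth_cutoff; field.
  by rewrite u0.
rewrite (FTC01 dF); first by rewrite !mul0r !mul1r sin0 cos0 expr0n !expr1n; field.
by apply: derivable_continuousT => x; exact: ex_derive.
Qed.

Lemma cosine_smooth_cutoff_le u : 1 <= u -> `|cosine_kernel smooth_cutoff u| <= 56 / u ^+ 3.
Proof.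
move=> u1; have u0 : 0 < u by lra.
rewrite cosine_smooth_cutoffE ?gt_eqF// normrM ger0_norm; last by rewrite divr_ge0// exprn_ge0// ltW.
have -> : 56 / u ^+ 3 = 4 / u ^+ 3 * 14 by field; rewrite gt_eqF.
apply: ler_wpM2l; first by rewrite divr_ge0// exprn_ge0// ltW.
have ui : u^-1 <= 1 by rewrite invf_le1.
have ui0 : 0 <= u^-1 by rewrite invr_ge0 ltW.
have h1 : `|cos u / u| <= 1.
  by rewrite normrM -[leRHS]mulr1 ler_pM ?cos_max// ger0_norm.
have h2 : `|sin u / u ^+ 2| <= 1.
  by rewrite normrM -[leRHS]mulr1 ler_pM ?sin_max// -exprVn ger0_norm ?exprn_ile1// exprn_ge0.
have h3 := sin_max u.
move: h1 h2 h3; rewrite !ler_norml; lra.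
Qed.

Let fejS (u : R) : is_derive u 1 Fej (Fj u).
Proof. exact: is_derive_sine_kernel measurable_tent tent01 u. Qed.

Let HS (u : R) : is_derive u 1 H (cosine_kernel smooth_cutoff u).
Proof. exact: is_derive_sine_kernel measurable_smooth_cutoff smooth_cutoff01 u. Qed.

(** [Fej] is nondecreasing because its derivative is the Fejer kernel, so the value at 1 decides;
    there [sin t / t >= 5 / 6], and [1 - t] has integral 1 / 2 over [0, 1]. *)
Lemma Fej_ge u : 1 <= u -> 5 / 12 <= Fej u.
Proof.
move=> u1; apply: (@le_trans _ _ (Fej 1)); last first.
  apply: (@derive_leT _ (fun=> Fej 1) Fej (fun=> 0) Fj 1 u) => // y _.
  exact: fejer_kernel_ge0.
have -> : 5 / 12 = m01 (fun t => 5 / 6 * (1 - t)) :> R.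
  have dF (x : R) : is_derive x 1 (fun t => 5 / 6 * (t - t ^+ 2 / 2)) (5 / 6 * (1 - x)).
    by apply: is_derive_eq; rewrite /GRing.scale/=; field.
  rewrite (FTC01 dF); first by rewrite expr0n/=; field.
  by apply: derivable_continuousT => x; exact: ex_derive.
apply: le_mean; last 2 first.
- exact: (sine_kernel_int measurable_tent tent01).
- move=> t; have [h1 h2] := clip01 t; move: (c01 t) h1 h2 => {}t h1 h2.
  rewrite mulr1; apply: ler_wpM2r; first by rewrite /tent subr_ge0.
  rewrite ler_pdivlMr//; have := subr_sin_le3 (ltW h1).
  have : t ^+ 3 <= t by rewrite exprS expr2; nra.
  lra.
- apply: (@rintegrable_bounded _ _ _ _ 1).
    by apply: measurable_funM => //; apply: measurable_funB => //; exact: measurable_clip.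
  by move=> t; have [h1 h2] := clip01 t; rewrite ler_norml; lra.
Qed.

(** [(1 - t^2)^2 - (1 - t) = t (1 - 2 t + t^3)]: the factor [t] removes the singularity of the
    kernel, and integration by parts gives the decay [1 / u]. The constant is 14 = 1 + 1 + 6 + 6,
    one summand for each boundary term. *)
Lemma H_sub_Fej u : 1 <= u -> `|H u - Fej u| <= 14 / u.
Proof.
move=> u1; have u0 : u != 0 by rewrite gt_eqF//; lra.
rewrite /sine_kernel /unif_mean -meanB; last 2 first.
- exact: (sine_kernel_int measurable_smooth_cutoff smooth_cutoff01).
- exact: (sine_kernel_int measurable_tent tent01).
rewrite (_ : mean _ _ = m01 (fun t => sin (t * u) * (1 - 2 * t + t ^+ 3))); last first.
  apply: eq_mean => t; have [h1 h2] := clip01 t.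
  by rewrite /smooth_cutoff /tent; field; rewrite gt_eqF.
have dF (x : R) : is_derive x 1 (fun t => - cos (t * u) * (1 - 2 * t + t ^+ 3) / u + 1 / u *
   ((- 2 + 3 * t ^+ 2) * sin (t * u) / u - 6 / u * (- t * cos (t * u) / u + sin (t * u) / u ^+ 2)))
   (sin (x * u) * (1 - 2 * x + x ^+ 3)).
  by apply: is_derive_eq; rewrite /GRing.scale/=; field; rewrite u0.
rewrite (FTC01 dF); last by apply: derivable_continuousT => x; exact: ex_derive.
rewrite !mul0r !mul1r sin0 cos0 !expr0n !expr1n /=.
have ui : u^-1 <= 1 by rewrite invf_le1//; lra.
have ui0 : 0 <= u^-1 by rewrite invr_ge0; lra.
set e := (X in `|X|).
have -> : e = u^-1 * (1 + sin u / u + 6 * (cos u / u ^+ 2) - 6 * (sin u / u ^+ 3)).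
  by rewrite /e; field.
rewrite normrM ger0_norm// mulrC ler_wpM2r//.
have h1 : `|sin u / u| <= 1.
  by rewrite normrM -[leRHS]mulr1 ler_pM ?sin_max// ger0_norm.
have h2 : `|cos u / u ^+ 2| <= 1.
  by rewrite normrM -[leRHS]mulr1 ler_pM ?cos_max// -exprVn ger0_norm ?exprn_ile1// exprn_ge0.
have h3 : `|sin u / u ^+ 3| <= 1.
  by rewrite normrM -[leRHS]mulr1 ler_pM ?sin_max// -exprVn ger0_norm ?exprn_ile1// exprn_ge0.
move: h1 h2 h3; rewrite !ler_norml; lra.
Qed.

(** The limit of [H] at infinity (its value is [pi / 2]), encoded as a supremum since the proof
    needs its existence and its sign. The term [28 / u^2] is the integral over [u, +oo[ of the bound
    [56 / u^3] on the derivative of [H]. *)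
Definition kernel_limit : R := sup [set H u - 28 / u ^+ 2 | u in [set u | 1 <= u]].
Notation L := kernel_limit.

Let derive_tail (c y : R) : 0 < y -> is_derive y 1 (fun u => c / u ^+ 2) (- 2 * c / y ^+ 3).
Proof.
move=> y0; have yn : y ^+ 2 != 0 by rewrite expf_neq0// gt_eqF.
have dV := @is_deriveV _ (fun u => u ^+ 2) y 1 _ yn.
apply: is_derive_eq.
by rewrite /GRing.scale/=; field; rewrite gt_eqF.
Qed.

(** The sign [(-1) ^+ s] treats [H] and [- H] together: both become nondecreasing once the tail
    bound is subtracted, which encloses the limit from both sides. *)
Let H_tail (s : bool) u v : 1 <= u -> u <= v ->
  (-1) ^+ s * H u - 28 / u ^+ 2 <= (-1) ^+ s * H v - 28 / v ^+ 2.
Proof.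
move=> u1 uv.
pose h y := (-1) ^+ s * H y - 28 / y ^+ 2.
pose h' y := (-1) ^+ s * cosine_kernel smooth_cutoff y + 56 / y ^+ 3.
have dh (y : R) : 0 < y -> is_derive y 1 h (h' y).
  move=> y0; have d1 := HS y; have d2 := derive_tail 28 y0.
  apply: is_derive_eq; rewrite /GRing.scale/= /h'.
  by ring.
apply: (@derive_le _ (fun=> h u) h (fun=> 0) h' u v) => //.
- by move=> y uy; apply: dh; lra.
- by apply: continuous_subspaceT => z; exact: cst_continuous.
- apply: continuous_in_subspaceT => z; rewrite inE/= in_itv/= => /andP[uz _].
  apply: differentiable_continuous; apply/derivable1_diffP.
  by have z0 : 0 < z by [lra]; have := dh z z0 => -[].
- move=> y uy; have y1 : 1 <= y by lra.
  have := cosine_smooth_cutoff_le y1; rewrite /h' ler_norml.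
  by case: s {h h' dh}; rewrite ?expr1 ?expr0; lra.
Qed.

Lemma kernel_limit_sandwich u : 1 <= u -> `|L - H u| <= 28 / u ^+ 2.
Proof.
move=> u1.
have key v w : 1 <= v -> 1 <= w -> H v - 28 / v ^+ 2 <= H w + 28 / w ^+ 2.
  move=> v1 w1; set m := Num.max v w.
  have := H_tail false v1 (_ : v <= m); have := H_tail true w1 (_ : w <= m).
  rewrite /m !le_max !lexx orbT => /(_ isT) h1 /(_ isT) h2.
  move: h1 h2; rewrite expr0 expr1 -/m.
  have : 0 <= 28 / m ^+ 2 by rewrite divr_ge0// sqr_ge0.
  lra.
have ubd : ubound [set H u - 28 / u ^+ 2 | u in [set u | 1 <= u]] (H u + 28 / u ^+ 2).
  by move=> _ [v /= v1 <-]; exact: key.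
have hL : H u - 28 / u ^+ 2 <= L.
  by apply: ub_le_sup; [exists (H u + 28 / u ^+ 2)|exists u].
have hU : L <= H u + 28 / u ^+ 2.
  by apply: ge_sup => //; exists (H u - 28 / u ^+ 2), u.
by rewrite ler_norml; lra.
Qed.

(** At [u = 100] the errors [14 / u] and [28 / u^2] are small against [5 / 12]. *)
Lemma kernel_limit_gt0 : 0 < L.
Proof.
have h100 : 1 <= 100%:R :> R by rewrite ler1n.
have := kernel_limit_sandwich h100; have := H_sub_Fej h100; have := Fej_ge h100.
rewrite !ler_norml; lra.
Qed.

Definition smooth_step u := (1 + H u / L) / 2.

(* Both [smooth_step] and [fejer_bump] are trigonometric integrals over frequencies in [0, 1], so their means under a law only involve its characteristic function there. *)
Lemma smooth_step_bump : exists2 C : R, 0 < C & forall u,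
  `|(0 <= u)%R%:R - smooth_step u| <= C * fejer_bump u.
Proof.
have L0 := kernel_limit_gt0.
have pi0 : 0 <= pi ^+ 2 :> R by exact: sqr_ge0.
(* Chosen so that [D * (2 * L) = 2 * L + 28], which covers both the bound [28 / u^2] for [u >= 1]
   and the bound [L + u] for [u < 1]. *)
pose D : R := 1 + 14 / L.
have D0 : 0 < D by rewrite addr_gt0// divr_gt0.
suff key u : 0 <= u -> `|1 - smooth_step u| <= D * (2 + 2 * pi ^+ 2) / (2 * u ^+ 2 + 2 * pi ^+ 2).
  exists (D * (2 + 2 * pi ^+ 2)) => [|u]; first by rewrite mulr_gt0//; lra.
  apply: le_trans (ler_wpM2l _ (bump_ge u)); last by rewrite mulr_ge0 ?(ltW D0)//; lra.
  have [u0|u0] := leP 0 u; first exact: key.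
  have -> : 0 - smooth_step u = - (1 - smooth_step (- u)).
    rewrite /smooth_step (sine_kernelN measurable_smooth_cutoff smooth_cutoff01).
    by field; rewrite gt_eqF.
  by rewrite normrN -(sqrrN u); apply: key; rewrite oppr_ge0 ltW.
move=> u0; have -> : 1 - smooth_step u = (L - H u) / (2 * L).
  by rewrite /smooth_step; field; rewrite gt_eqF.
have c0 : 0 < 2 * u ^+ 2 + 2 * pi ^+ 2.
  have := sqr_ge0 u; have : 0 < pi ^+ 2 :> R by rewrite exprn_gt0// pi_gt0.
  lra.
rewrite normrM normfV (gtr0_norm (_ : 0 < 2 * L)); last by rewrite mulr_gt0.
rewrite ler_pdivrMr ?mulr_gt0//.
have eD : D * (2 * L) = 2 * L + 28 by rewrite /D; field; rewrite gt_eqF.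
have -> : D * (2 + 2 * pi ^+ 2) / (2 * u ^+ 2 + 2 * pi ^+ 2) * (2 * L)
   = (2 * L + 28) * ((2 + 2 * pi ^+ 2) / (2 * u ^+ 2 + 2 * pi ^+ 2)).
  by rewrite -eD; ring.
have [u1|u1] := leP 1 u.
  apply: le_trans (kernel_limit_sandwich u1) _.
  have u2 : 0 < u ^+ 2 by rewrite exprn_gt0//; lra.
  apply: ler_pM => //; [by rewrite invr_ge0 ltW|lra|].
  rewrite ler_pdivlMr// mulrC ler_pdivrMr//.
  have : 1 <= u ^+ 2 by rewrite expr_ge1.
  nra.
have h1 := normr_sine_kernel_le measurable_smooth_cutoff smooth_cutoff01 u.
have : 1 <= (2 + 2 * pi ^+ 2) / (2 * u ^+ 2 + 2 * pi ^+ 2).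
  rewrite ler_pdivlMr// mul1r; have : u ^+ 2 <= 1 by rewrite expr_le1// ltW.
  lra.
move=> h2; apply: (@le_trans _ _ ((2 * L + 28) * 1)); last by rewrite ler_wpM2l//; lra.
apply: le_trans (ler_normB _ _) _; rewrite (gtr0_norm L0).
move: h1; rewrite (ger0_norm u0); lra.
Qed.

End smoothing.

(** * Means of the kernels and the smoothing inequality *)

Section smoothing.
Context {R : realType}.
Implicit Types (kappa f g : R -> R) (u t : R).

Notation m01 := (@unif_mean R 0 1 (@ltr01 R)).
Notation c01 := (@clip R 0 1).
Notation H := (sine_kernel smooth_cutoff).
Notation Fj := (cosine_kernel tent).
Notation L := kernel_limit.

Section expectation.
Context {d : measure_display} {T : measurableType d}.
Variables (P : probability T R) (W : T -> R).
Hypothesis Wi : rintegrable P W.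

Definition charfun t := Cexpectation P (fun w => expi (t * W w)).

Let mW : measurable_fun setT W. Proof. exact: rintegrable_measurable Wi. Qed.

Let iyW y : rintegrable P (fun w => y - W w).
Proof. by apply: rintegrableB => //; exact: rintegrable_cst. Qed.

Let iW t : cintegrable P (fun w => expi (t * W w)).
Proof. by apply: cintegrable_expi; exact: measurable_funM. Qed.

Lemma mean_sin_charfun t y : mean P (fun w => sin (t * (y - W w))) =
  sin (t * y) * complex.Re (charfun t) - cos (t * y) * complex.Im (charfun t).
Proof.
have [h1 h2] := iW t.
rewrite /charfun /= -!meanZ// -meanB; [|exact: rintegrableZ..].
by apply: eq_mean => w; rewrite mulrBr sinB.
Qed.

Lemma mean_cos_charfun t y : mean P (fun w => cos (t * (y - W w))) =
  cos (t * y) * complex.Re (charfun t) + sin (t * y) * complex.Im (charfun t).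
Proof.
have [h1 h2] := iW t.
rewrite /charfun /= -!meanZ// -meanD; [|exact: rintegrableZ..].
by apply: eq_mean => w; rewrite mulrBr cosB.
Qed.

Section kernel.
Variable kappa : R -> R.
Hypothesis mk : measurable_fun setT kappa.
Hypothesis k01 : forall t, 0 < t -> t <= 1 -> 0 <= kappa t <= 1.

Let mc2 : measurable_fun setT (fun z : T * R => c01 z.2).
Proof. by apply: (measurableT_comp (@measurable_clip R 0 1)); exact: measurable_snd. Qed.

Let mW1 y : measurable_fun setT (fun z : T * R => y - W z.1).
Proof. by apply: measurable_funB => //; apply: measurableT_comp => //; exact: measurable_fst. Qed.

Let mk2 : measurable_fun setT (fun z : T * R => kappa (c01 z.2)).
Proof. by apply: (measurableT_comp mk); exact: mc2. Qed.

Let f1 y (z : T * R) := sin (c01 z.2 * (y - W z.1)) / c01 z.2 * kappa (c01 z.2).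
Let f2 y (z : T * R) := cos (c01 z.2 * (y - W z.1)) * kappa (c01 z.2).

Let mf1 y : measurable_fun setT (f1 y).
Proof.
apply: measurable_funM => //; apply: measurable_funM.
  apply: (measurableT_comp (continuous_measurable_fun (@continuous_sin R))).
  by apply: measurable_funM; [exact: mc2|exact: mW1].
by apply: (measurableT_comp measurable_clipV); exact: measurable_snd.
Qed.

Let mf2 y : measurable_fun setT (f2 y).
Proof.
apply: measurable_funM => //.
apply: (measurableT_comp (continuous_measurable_fun (@continuous_cos R))).
by apply: measurable_funM; [exact: mc2|exact: mW1].
Qed.

Let f1le y w t : `|f1 y (w, t)| <= `|y - W w|.
Proof. exact: sine_kernel_bound. Qed.

Let f2le y w t : `|f2 y (w, t)| <= 1.
Proof.
have [h1 h2] := clip01 t; have /andP[k0 k1] := k01 h1 h2.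
by rewrite normrM -[leRHS]mulr1 ler_pM ?cos_max// ger0_norm.
Qed.

Lemma rintegrable_sine_kernel y : rintegrable P (fun w => sine_kernel kappa (y - W w)).
Proof.
exact: (@rintegrable_mean1 _ _ _ _ _ P (uniform_prob (@ltr01 R)) _ _
  (rintegrable_norm (iyW y)) (mf1 y) (f1le y)).
Qed.

Lemma rintegrable_cosine_kernel y : rintegrable P (fun w => cosine_kernel kappa (y - W w)).
Proof.
exact: (@rintegrable_mean1 _ _ _ _ _ P (uniform_prob (@ltr01 R)) _ _
  (rintegrable_cst P 1) (mf2 y) (f2le y)).
Qed.

(** Fubini under the domination [|y - W|]; this is where the integrability of [W] enters. *)
Lemma mean_sine_kernel y : mean P (fun w => sine_kernel kappa (y - W w)) =
  m01 (fun t => mean P (fun w => sin (t * (y - W w))) / t * kappa t).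
Proof.
rewrite /sine_kernel /unif_mean.
rewrite (@mean_fubini_dominated _ _ _ _ _ P (uniform_prob (@ltr01 R)) _ _
  (rintegrable_norm (iyW y)) (mf1 y) (f1le y)).
apply: eq_mean => t; rewrite mulrAC -mulrA mulrC -meanZ; last first.
  apply: (@rintegrable_bounded _ _ _ _ 1) => [|w]; last exact: sin_max.
  apply: (measurableT_comp (continuous_measurable_fun (@continuous_sin R))).
  by apply: measurable_funM => //; exact: measurable_funB.
by apply: eq_mean => w; rewrite /f1/=; ring.
Qed.

Lemma mean_cosine_kernel y : mean P (fun w => cosine_kernel kappa (y - W w)) =
  m01 (fun t => mean P (fun w => cos (t * (y - W w))) * kappa t).
Proof.
rewrite /cosine_kernel /unif_mean.
rewrite (@mean_fubini_dominated _ _ _ _ _ P (uniform_prob (@ltr01 R)) _ _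
  (rintegrable_cst P 1) (mf2 y) (f2le y)).
apply: eq_mean => t; rewrite mulrC -meanZ; last first.
  apply: (@rintegrable_bounded _ _ _ _ 1) => [|w]; last exact: cos_max.
  apply: (measurableT_comp (continuous_measurable_fun (@continuous_cos R))).
  by apply: measurable_funM => //; exact: measurable_funB.
by apply: eq_mean => w; rewrite /f2/= mulrC.
Qed.

Lemma rintegrable_sine_transform y : rintegrable (uniform_prob (@ltr01 R))
  (fun t => mean P (fun w => sin (c01 t * (y - W w))) / c01 t * kappa (c01 t)).
Proof.
have := @rintegrable_mean2 _ _ _ _ _ P (uniform_prob (@ltr01 R)) _ _
  (rintegrable_norm (iyW y)) (mf1 y) (f1le y).
congr rintegrable; apply/funext => t; rewrite [RHS]mulrAC -mulrA mulrC -meanZ; last first.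
  apply: (@rintegrable_bounded _ _ _ _ 1) => [|w]; last exact: sin_max.
  apply: (measurableT_comp (continuous_measurable_fun (@continuous_sin R))).
  by apply: measurable_funM => //; exact: measurable_funB.
by apply: eq_mean => w; rewrite /f1/=; ring.
Qed.

Lemma rintegrable_cosine_transform y : rintegrable (uniform_prob (@ltr01 R))
  (fun t => mean P (fun w => cos (c01 t * (y - W w))) * kappa (c01 t)).
Proof.
have := @rintegrable_mean2 _ _ _ _ _ P (uniform_prob (@ltr01 R)) _ _
  (rintegrable_cst P 1) (mf2 y) (f2le y).
congr rintegrable; apply/funext => t; rewrite [RHS]mulrC -meanZ; last first.
  apply: (@rintegrable_bounded _ _ _ _ 1) => [|w]; last exact: cos_max.
  apply: (measurableT_comp (continuous_measurable_fun (@continuous_cos R))).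
  by apply: measurable_funM => //; exact: measurable_funB.
by apply: eq_mean => w; rewrite /f2/= mulrC.
Qed.

End kernel.

Lemma rintegrable_smooth_step x : rintegrable P (fun w => smooth_step (x - W w)).
Proof.
rewrite (_ : (fun _ => _) = fun w => 2^-1 + (2 * L)^-1 * H (x - W w)).
  apply: rintegrableD; first exact: rintegrable_cst.
  apply: rintegrableZ; exact: (rintegrable_sine_kernel measurable_smooth_cutoff smooth_cutoff01).
by apply/funext => w; rewrite /smooth_step; field; rewrite gt_eqF// kernel_limit_gt0.
Qed.

Lemma rintegrable_bump x : rintegrable P (fun w => fejer_bump (x - W w)).
Proof.
apply: rintegrableD; first exact: (rintegrable_cosine_kernel measurable_tent tent01).
rewrite (_ : (fun _ => _) = fun w => Fj ((x + pi) - W w)).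
  exact: (rintegrable_cosine_kernel measurable_tent tent01).
by apply/funext => w; congr (Fj _); ring.
Qed.

Lemma mean_bump x : mean P (fun w => fejer_bump (x - W w)) =
  mean P (fun w => Fj (x - W w)) + mean P (fun w => Fj (x + pi - W w)).
Proof.
rewrite -meanD; [|exact: (rintegrable_cosine_kernel measurable_tent tent01)..].
by apply: eq_mean => w; rewrite /fejer_bump; congr (_ + Fj _); ring.
Qed.

Lemma mean_smooth_step x : mean P (fun w => smooth_step (x - W w)) =
  2^-1 + (2 * L)^-1 * mean P (fun w => H (x - W w)).
Proof.
have h := rintegrable_sine_kernel measurable_smooth_cutoff smooth_cutoff01 x.
rewrite -[in RHS]meanZ// -[X in X + _](mean_cst P) -meanD; last 2 first.
- exact: rintegrable_cst.
- exact: rintegrableZ.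
by apply: eq_mean => w; rewrite /smooth_step; field; rewrite gt_eqF// kernel_limit_gt0.
Qed.

Lemma cdf_smooth_step C x : 0 < C ->
  (forall u, `|(0 <= u)%R%:R - smooth_step u| <= C * fejer_bump u) ->
  `|fine (P [set w | W w <= x]) - mean P (fun w => smooth_step (x - W w))|
  <= C * mean P (fun w => fejer_bump (x - W w)).
Proof.
move=> C0 hC.
have mA : measurable [set w | W w <= x].
  by apply: measurable_sublevel; exact: rintegrable_measurable Wi.
rewrite -mean_indic// -meanB; last 2 first.
- apply: (@rintegrable_bounded _ _ _ _ 1) => [|w]; first exact: measurable_indic.
  by rewrite indicE; case: (_ \in _); rewrite ?normr1 ?normr0.
- exact: rintegrable_smooth_step.
rewrite -meanZ; last exact: rintegrable_bump.
apply: normr_mean_le.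
- apply: rintegrableB; last exact: rintegrable_smooth_step.
  apply: (@rintegrable_bounded _ _ _ _ 1) => [|w]; first exact: measurable_indic.
  by rewrite indicE; case: (_ \in _); rewrite ?normr1 ?normr0.
- by apply: rintegrableZ; exact: rintegrable_bump.
move=> w; apply: le_trans (hC _).
rewrite indicE subr_ge0 (_ : (w \in _) = (W w <= x))//.
by apply/idP/idP; rewrite inE.
Qed.

End expectation.

(** Replacing the indicator by [smooth_step] costs the mean of [fejer_bump] under both laws. Under
    [Q] this mean is O(1 / sqrt a) by the decay of the characteristic function, an argument that
    takes the place of a bounded density in the classical inequality. Under [P] the difference of
    the characteristic functions is added. *)
Lemma smoothing_inequality : exists2 C : R, 0 < C & forall
    d1 d2 (T1 : measurableType d1) (T2 : measurableType d2)
    (P : probability T1 R) (Q : probability T2 R) (W : T1 -> R) (Z : T2 -> R) (K a : R),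
  rintegrable P W -> rintegrable Q Z -> 0 <= K -> 0 < a ->
  (forall t, 0 < t -> t <= 1 ->
    cnorm (charfun P W t - charfun Q Z t) <= K * t * expR (- (a * t ^+ 2))) ->
  (forall t, 0 < t -> t <= 1 -> cnorm (charfun Q Z t) <= expR (- (a * t ^+ 2))) ->
  forall x, `|fine (P [set w | W w <= x]) - fine (Q [set w | Z w <= x])| <= C * (K + 1) / Num.sqrt a.
Proof.
have [C1 C10 hC1] := @smooth_step_bump R.
have L0 := @kernel_limit_gt0 R.
pose C := 4 / L + 16 * C1.
exists (2 * (C + 8 * C1)); first by rewrite mulr_gt0// !addr_gt0 ?mulr_gt0 ?invr_gt0.
move=> d1 d2 T1 T2 P Q W Z K a Wi Zi K0 a0 hWZ hZ x.
set g := 4 / Num.sqrt a.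
have m01_gauss_le : m01 (fun t => expR (- (a * t ^+ 2))) <= g.
  by have := unif_mean_gauss_le (@ltr01 R) a0; rewrite subr0 divr1.
have g0 : 0 < g by rewrite divr_gt0// sqrtr_gt0.
have gE : rintegrable (uniform_prob (@ltr01 R)) (fun t => expR (- (a * c01 t ^+ 2))).
  exact: unif_mean_gauss_int.
have Hdiff y : `|mean P (fun w => H (y - W w)) - mean Q (fun w => H (y - Z w))| <= 2 * K * g.
  rewrite (mean_sine_kernel Wi measurable_smooth_cutoff smooth_cutoff01).
  rewrite (mean_sine_kernel Zi measurable_smooth_cutoff smooth_cutoff01).
  have i1 := rintegrable_sine_transform Wi measurable_smooth_cutoff smooth_cutoff01 y.
  have i2 := rintegrable_sine_transform Zi measurable_smooth_cutoff smooth_cutoff01 y.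
  apply: le_trans (ler_wpM2l _ m01_gauss_le); last by rewrite mulr_ge0.
  rewrite /unif_mean -meanB// -meanZ//.
  apply: normr_mean_le; [exact: rintegrableB|exact: rintegrableZ|].
  move=> t; have [h1 h2] := clip01 t; have /andP[k0 k1] := smooth_cutoff01 h1 h2.
  have hd := hWZ _ h1 h2; rewrite !mean_sin_charfun//.
  move: (c01 t) h1 h2 k0 k1 hd => {}t h1 h2 k0 k1.
  have := normr_Re_le (charfun P W t - charfun Q Z t).
  have := normr_Im_le (charfun P W t - charfun Q Z t).
  case: (charfun P W t) => A B; case: (charfun Q Z t) => A' B' /=.
  set D := cnorm _ => hB hA hD.
  move: (smooth_cutoff t) k0 k1 => k k0 k1.
  have -> : (sin (t * y) * A - cos (t * y) * B) / t * k - (sin (t * y) * A' - cos (t * y) * B') / t * k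
      = (sin (t * y) * (A - A') - cos (t * y) * (B - B')) / t * k by ring.
  rewrite !normrM normfV (gtr0_norm h1) (ger0_norm k0).
  (* The factor [1 / t] of the kernel cancels with the factor [t] of the assumed bound. *)
  apply: (@le_trans _ _ (2 * D / t)).
    rewrite -[leRHS]mulr1; apply: ler_pM => //; first by rewrite divr_ge0// ltW.
    rewrite ler_pM2r ?invr_gt0//.
    apply: le_trans (ler_normB _ _) _; rewrite !normrM mulrDl mul1r.
    by apply: lerD; rewrite -[leRHS]mul1r ler_pM// ?sin_max ?cos_max.
  by rewrite ler_pdivrMr//; apply: le_trans (ler_wpM2l _ hD) _ => //; apply: eq_ler; ring.
have Bdiff y : `|mean P (fun w => Fj (y - W w)) - mean Q (fun w => Fj (y - Z w))| <= 2 * K * g.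
  rewrite (mean_cosine_kernel Wi measurable_tent tent01).
  rewrite (mean_cosine_kernel Zi measurable_tent tent01).
  have i1 := rintegrable_cosine_transform Wi measurable_tent tent01 y.
  have i2 := rintegrable_cosine_transform Zi measurable_tent tent01 y.
  apply: le_trans (ler_wpM2l _ m01_gauss_le); last by rewrite mulr_ge0.
  rewrite /unif_mean -meanB// -meanZ//.
  apply: normr_mean_le; [exact: rintegrableB|exact: rintegrableZ|].
  move=> t; have [h1 h2] := clip01 t; have /andP[k0 k1] := tent01 h1 h2.
  have hd := hWZ _ h1 h2; rewrite !mean_cos_charfun//.
  move: (c01 t) h1 h2 k0 k1 hd => {}t h1 h2 k0 k1.
  have := normr_Re_le (charfun P W t - charfun Q Z t).
  have := normr_Im_le (charfun P W t - charfun Q Z t).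
  case: (charfun P W t) => A B; case: (charfun Q Z t) => A' B' /=.
  set D := cnorm _ => hB hA hD.
  move: (tent t) k0 k1 => k k0 k1.
  have -> : (cos (t * y) * A + sin (t * y) * B) * k - (cos (t * y) * A' + sin (t * y) * B') * k
      = (cos (t * y) * (A - A') + sin (t * y) * (B - B')) * k by ring.
  rewrite !normrM (ger0_norm k0).
  apply: (@le_trans _ _ (2 * D)).
    rewrite -[leRHS]mulr1; apply: ler_pM => //.
    apply: le_trans (ler_normD _ _) _; rewrite !normrM mulrDl mul1r.
    by apply: lerD; rewrite -[leRHS]mul1r ler_pM// ?sin_max ?cos_max.
  apply: le_trans (ler_wpM2l _ hD) _ => //; rewrite -!mulrA ler_wpM2l// ler_wpM2l//.
  by rewrite ler_piMl// expR_ge0.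
have BZ y : mean Q (fun w => Fj (y - Z w)) <= 2 * g.
  rewrite (mean_cosine_kernel Zi measurable_tent tent01).
  have i2 := rintegrable_cosine_transform Zi measurable_tent tent01 y.
  apply: le_trans (ler_wpM2l _ m01_gauss_le) => //.
  rewrite /unif_mean -meanZ//.
  apply: le_mean => //; first exact: rintegrableZ.
  move=> t; have [h1 h2] := clip01 t; have /andP[k0 k1] := tent01 h1 h2.
  have hd := hZ _ h1 h2; rewrite !mean_cos_charfun//.
  move: (c01 t) h1 h2 k0 k1 hd => {}t h1 h2 k0 k1.
  have := normr_Re_le (charfun Q Z t).
  have := normr_Im_le (charfun Q Z t).
  case: (charfun Q Z t) => A' B' /=.
  set D := cnorm _ => hB hA hD.
  apply: le_trans (ler_norm _) _; rewrite normrM (ger0_norm k0).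
  apply: (@le_trans _ _ (2 * D)).
    rewrite -[leRHS]mulr1; apply: ler_pM => //.
    apply: le_trans (ler_normD _ _) _; rewrite !normrM mulrDl mul1r.
    by apply: lerD; rewrite -[leRHS]mul1r ler_pM// ?sin_max ?cos_max.
  exact: ler_wpM2l.
have hZ1 := cdf_smooth_step Zi x C10 hC1.
have hW1 := cdf_smooth_step Wi x C10 hC1.
rewrite !mean_bump// !mean_smooth_step// in hZ1 hW1.
have hh : `|(2 * L)^-1 * (mean P (fun w => H (x - W w)) - mean Q (fun w => H (x - Z w)))| <= (2 * L)^-1 * (2 * K * g).
  by rewrite normrM ger0_norm ?invr_ge0 ?mulr_ge0 ?(ltW L0)// ler_wpM2l// ?invr_ge0 ?mulr_ge0 ?(ltW L0).
move: (Bdiff x) (Bdiff (x + pi)) (BZ x) (BZ (x + pi)) hh hW1 hZ1.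
move: (mean P (fun w => Fj (x - W w))) (mean P (fun w => Fj (x + pi - W w))) => b1 b2.
move: (mean Q (fun w => Fj (x - Z w))) (mean Q (fun w => Fj (x + pi - Z w))) => b3 b4.
move: (mean P (fun w => H (x - W w))) (mean Q (fun w => H (x - Z w))) => e1 e2.
move: (fine (P _)) (fine (Q _)) => p q h1 h2 h3 h4 h5 h6 h7.
have h8 : C1 * (b1 + b2) <= C1 * (4 * g + 4 * K * g).
  by rewrite ler_pM2l//; move: h1 h2; rewrite !ler_norml; lra.
have h9 : C1 * (b3 + b4) <= C1 * (4 * g).
  by rewrite ler_pM2l//; lra.
have -> : 2 * (C + 8 * C1) * (K + 1) / Num.sqrt a = (C + 8 * C1) * (K + 1) * (g / 2) by rewrite /g; field; rewrite gt_eqF// sqrtr_gt0.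
have -> : (C + 8 * C1) * (K + 1) * (g / 2) = 2 * (K + 1) * g / L + 12 * C1 * (K + 1) * g.
  by rewrite /C; field; rewrite gt_eqF.
have h10 : (2 * L)^-1 * (2 * K * g) <= 2 * (K + 1) * g / L.
  have -> : (2 * L)^-1 * (2 * K * g) = (K * g) / L by field; rewrite gt_eqF.
  by rewrite ler_pM2r ?invr_gt0//; have := mulr_ge0 K0 (ltW g0); lra.
have h11 : 0 <= C1 * g by rewrite mulr_ge0 ?ltW.
have h12 : 0 <= C1 * g * K by rewrite mulr_ge0.
rewrite mulrBr in h5.
move: h5 h6 h7; rewrite !ler_norml; lra.
Qed.

End smoothing.

(** * Characteristic function of the normal law *)

Section gaussian_truncated.
Context {R : realType}.
Variables (M v theta : R) (M0 : 0 < M) (v0 : 0 < v).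

Lemma ltNM : - M < M. Proof. by rewrite gtrN. Qed.

Notation e x := (expR (- (v * x ^+ 2 / 2))).

(** The phase [theta] treats cosine and sine transforms together. With [v = 1] and [M] large this
    leads to the normal law; with [M = pi] and a large [v] it is the main term of a lattice
    probability. *)
Definition gauss_cos (t : R) := unif_mean ltNM (fun x => cos (t * x + theta) * e x).
Let gauss_xsin (t : R) := unif_mean ltNM (fun x => x * sin (t * x + theta) * e x).

Lemma continuous_cos_gauss (t : R) : continuous ((fun x => cos (t * x + theta) * e x) : R -> R).
Proof. by apply: derivable_continuousT => x; exact: ex_derive. Qed.

Let cs (t : R) : continuous ((fun x => x * sin (t * x + theta) * e x) : R -> R).
Proof. by apply: derivable_continuousT => x; exact: ex_derive. Qed.

Let e_le1 x : 0 <= e x <= 1.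
Proof.
rewrite expR_ge0 -[leRHS]expR0 ler_expR oppr_le0/=.
by rewrite divr_ge0// mulr_ge0 ?(ltW v0)// sqr_ge0.
Qed.

Let clipM t : `|clip (- M) M t| <= M.
Proof. by have /andP[/ltW h1 h2] := clip_itv ltNM t; rewrite ler_norml h1. Qed.

Let is_derive_gauss_cos (t : R) : is_derive t 1 gauss_cos (- gauss_xsin t).
Proof.
apply: (@is_derive_quadratic _ _ _ _ (M ^+ 2)) => h.
have i1 := unif_mean_int ltNM (@continuous_cos_gauss (t + h)); have i2 := unif_mean_int ltNM (@continuous_cos_gauss t).
have i3 := rintegrableZ h (unif_mean_int ltNM (@cs t)).
have i12 := rintegrableB i1 i2.
rewrite mulrN opprK /gauss_cos /gauss_xsin /unif_mean -meanZ; last exact: (unif_mean_int ltNM (@cs t)).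
rewrite -meanB// -meanD//.
rewrite -[leRHS](@mean_cst _ _ _ (uniform_prob ltNM)).
apply: normr_mean_le => [| |x]; [exact: rintegrableD|exact: rintegrable_cst|].
move: (clip _ _ _) (clipM x) => {}x xM; have /andP[e0 e1] := e_le1 x.
move: (expR _) e0 e1 => E e0 e1.
have -> : cos ((t + h) * x + theta) * E - cos (t * x + theta) * E + h * (x * sin (t * x + theta) * E)
   = (cos (t * x + theta + h * x) - cos (t * x + theta) + h * x * sin (t * x + theta)) * E.
  by rewrite (_ : (t + h) * x + theta = t * x + theta + h * x); ring.
rewrite normrM (ger0_norm e0) -[leRHS]mulr1; apply: ler_pM => //.
apply: le_trans (cos_add_le _ _) _; rewrite exprMn mulrC ler_wpM2r ?sqr_ge0//.
by rewrite -(real_normK (num_real x)) lerXn2r ?nnegrE ?(ltW M0).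
Qed.

Let bd t : R := (sin (t * M + theta) - sin (- (t * M) + theta)) / 2.

Let bd_le t : `|bd t| <= 1.
Proof.
have := sin_max (t * M + theta); have := sin_max (- (t * M) + theta).
by rewrite /bd !ler_norml; lra.
Qed.

(** Integration by parts on the Gaussian. Together with the derivative of [gauss_cos] it gives the
    differential equation [g' = - (t / v) g], up to a boundary term of size at most
    [e M / (M v)]. *)
Let parts (t : R) : t * gauss_cos t - v * gauss_xsin t = bd t * e M / M.
Proof.
have dF (x : R) : is_derive x 1 (fun x => sin (t * x + theta) * e x)
   (t * (cos (t * x + theta) * e x) + (- v) * (x * sin (t * x + theta) * e x)).
  by apply: is_derive_eq; rewrite /GRing.scale/=; field.
have ct : continuous ((fun x => t * (cos (t * x + theta) * e x)) : R -> R).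
  by apply: derivable_continuousT => x; exact: ex_derive.
have := unif_mean_FTC ltNM dF.
rewrite unif_mean_linear//.
have -> : unif_mean ltNM (fun x => t * (cos (t * x + theta) * e x)) = t * gauss_cos t.
  by rewrite /unif_mean meanZ//; exact: (unif_mean_int ltNM (@continuous_cos_gauss t)).
rewrite mulNr => ->; last first.
  by apply: derivable_continuousT => x; exact: ex_derive.
have -> : M - - M = 2 * M by ring.
by rewrite mulrN sqrrN /bd; field; rewrite gt_eqF.
Qed.

Lemma gauss_cos_approx (t : R) : 0 <= t ->
  `|gauss_cos t - expR (- (t ^+ 2 / (2 * v))) * gauss_cos 0| <= t * (e M / (M * v)).
Proof.
move=> t0; set D := _ / (M * v).
have D0 : 0 <= D by rewrite divr_ge0 ?expR_ge0// mulr_ge0// ltW.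
(* The integrating factor leaves only the boundary term in the derivative. *)
pose g (s : R) := gauss_cos s * expR (s ^+ 2 / (2 * v)).
pose g' (s : R) := expR (s ^+ 2 / (2 * v)) * (bd s * D).
have dg (s : R) : is_derive s 1 g (g' s).
  have d1 := is_derive_gauss_cos s.
  apply: is_derive_eq; rewrite /GRing.scale/= /g' /D.
  have -> : gauss_xsin s = (s * gauss_cos s - bd s * e M / M) / v.
    by rewrite -parts; field; rewrite gt_eqF.
  by field; rewrite !gt_eqF.
pose E := expR (t ^+ 2 / (2 * v)) * D.
have E0 : 0 <= E by rewrite mulr_ge0 ?expR_ge0.
have g'E s : 0 < s -> s < t -> `|g' s| <= E.
  move=> s0 st; rewrite /g' /E normrM (ger0_norm (expR_ge0 _)); apply: ler_pM => //.
  - by rewrite ler_expR ler_pM2r ?invr_gt0 ?mulr_gt0// lerXn2r ?nnegrE// ltW//.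
  - by rewrite normrM (ger0_norm D0) ler_piMl.
have cl (c1 c2 : R) : continuous ((fun s => c1 + s * c2) : R -> R).
  by apply: derivable_continuousT => x; exact: ex_derive.
have dl (c1 c2 x : R) : is_derive x 1 ((fun s => c1 + s * c2) : R -> R) c2.
  by apply: is_derive_eq; rewrite /GRing.scale/=; ring.
have cg : continuous g by exact: is_derive_continuousT dg.
have hU : g t <= g 0 + t * E.
  apply: (@derive_le_itv _ g (fun s => g 0 + s * E) g' (fun=> E) 0 t) => //.
  - exact: continuous_subspaceT.
  - exact: continuous_subspaceT.
  - by rewrite mul0r addr0.
  - by move=> y y0 yt; have := g'E _ y0 yt; rewrite ler_norml => /andP[].
have hL : g 0 + t * - E <= g t.
  apply: (@derive_le_itv _ (fun s => g 0 + s * - E) g (fun=> - E) g' 0 t) => //.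
  - exact: continuous_subspaceT.
  - exact: continuous_subspaceT.
  - by rewrite mul0r addr0.
  - by move=> y y0 yt; have := g'E _ y0 yt; rewrite ler_norml => /andP[].
have g0 : g 0 = gauss_cos 0 by rewrite /g expr0n mul0r expR0 mulr1.
have gt' : gauss_cos t = expR (- (t ^+ 2 / (2 * v))) * g t.
  by rewrite /g mulrCA -expRD addNr expR0 mulr1.
rewrite gt' -g0 -mulrBr normrM ger0_norm ?expR_ge0//.
have -> : t * D = expR (- (t ^+ 2 / (2 * v))) * (t * E).
  transitivity (expR (- (t ^+ 2 / (2 * v))) * expR (t ^+ 2 / (2 * v)) * (t * D)).
    by rewrite -expRD addNr expR0 mul1r.
  by rewrite /E; ring.
by rewrite ler_wpM2l ?expR_ge0// ler_norml; lra.
Qed.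

End gaussian_truncated.

Section gaussian.
Context {R : realType}.
Notation N01 := (normal_prob (0:R) 1).
Notation e x := (expR (- (1 * x ^+ 2 / 2))).
Notation peak := (@normal_peak R 1).

Lemma integral_normal_prob (f : R -> \bar R) (U : set R) : measurable U -> measurable_fun U f ->
  (\int[N01]_(x in U) `|f x| < +oo)%E ->
  (\int[N01]_(x in U) f x = \int[lebesgue_measure]_(x in U) (f x * (normal_pdf 0 1 x)%:E))%E.
Proof.
move=> mU mf finf.
have dom := normal_prob_dominates (0 : R) 1.
have fi : N01.-integrable U f by apply/integrableP.
rewrite -(Radon_Nikodym_change_of_variables dom mU fi)/=.
apply: ae_eq_integral => //.
- by apply: emeasurable_funM => //; apply: measurable_funTS.
- apply: emeasurable_funM => //; apply: measurable_funTS; apply/measurable_EFinP.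
  exact: measurable_normal_pdf.
- apply: ae_eqe_mul2l.
  apply: integral_ae_eq => //.
  + by apply: (integrableS measurableT) => //; exact: Radon_Nikodym_integrable.
  + by apply: measurable_funTS; apply/measurable_EFinP; exact: measurable_normal_pdf.
  + by move=> E EU mE; rewrite -Radon_Nikodym_integral.
Qed.

Let pdfE (x : R) : normal_pdf 0 1 x = peak * e x.
Proof.
rewrite normal_pdfE ?oner_neq0//; congr (_ * _); rewrite /normal_fun.
by rewrite subr0 expr1n mul1r mulNr.
Qed.

Lemma gauss_cos0E (M v theta : R) (M0 : 0 < M) : gauss_cos v theta M0 0 = cos theta * gauss_cos v 0 M0 0.
Proof.
rewrite /gauss_cos /unif_mean -meanZ; last exact: (unif_mean_int (ltNM M0) (@continuous_cos_gauss R v 0 0)).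
by apply: eq_mean => x; rewrite !mul0r !add0r cos0 mul1r.
Qed.

Let mcos (t theta : R) : measurable_fun setT (fun x : R => cos (t * x + theta)).
Proof.
apply: (measurableT_comp (continuous_measurable_fun (@continuous_cos R))).
by apply: measurable_funD => //; exact: measurable_funM.
Qed.

Lemma normal_mean_trunc (M : R) (M0 : 0 < M) (t theta : R) :
  mean N01 (fun x => \1_(`[- M, M]%classic) x * cos (t * x + theta)) =
  peak * (2 * M) * gauss_cos 1 theta M0 t.
Proof.
have cc := @continuous_cos_gauss R 1 theta t.
rewrite /gauss_cos unif_meanE//.
have -> : M - - M = 2 * M by ring.
rewrite mulrA mulfK ?gt_eqF ?mulr_gt0// meanE.
have -> : \int[N01]_w (\1_(`[- M, M]%classic) w * cos (t * w + theta)) =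
   \int[N01]_(w in `[- M, M]) cos (t * w + theta).
  rewrite [RHS]Rintegral_mkcond; apply: eq_Rintegral => x _.
  by rewrite patchE indicE; case: ifPn => _; rewrite ?mul1r ?mul0r.
rewrite /Rintegral integral_normal_prob//; last 2 first.
- by apply: measurable_funTS; apply/measurable_EFinP; exact: mcos.
- have ic : rintegrable N01 (fun x => cos (t * x + theta)).
    by apply: (@rintegrable_bounded _ _ _ _ 1); [exact: mcos|move=> x; exact: cos_max].
  have : N01.-integrable `[- M, M] (EFin \o (fun x => cos (t * x + theta))).
    by apply: (integrableS measurableT) => //; exact: measurable_itv.
  by move=> /integrableP[].
rewrite -[RHS]RintegralZl//; last first.
  apply: continuous_compact_integrable; first exact: segment_compact.
  exact: continuous_subspaceT.
rewrite /Rintegral; congr fine; apply: eq_integral => x _.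
by rewrite pdfE -EFinM; congr (_%:E); ring.
Qed.

Let prob_itv (M : R) := fine (N01 `[- M, M]%classic).

(** Outside [-M, M] only the mass counts. Inside, the mass and the transform are values of the same
    truncated integral, at 0 and at [t], so that the Gaussian integral itself need not be
    evaluated. *)
Lemma normal_mean_approx (M : R) (t theta : R) : 0 < M -> 0 <= t ->
  `|mean N01 (fun x => cos (t * x + theta)) - expR (- (t ^+ 2 / 2)) * cos theta|
  <= 2 * (1 - prob_itv M) + 2 * peak * t * e M.
Proof.
move=> M0 t0; set A := `[- M, M]%classic.
have mA : measurable A by exact: measurable_itv.
have ic : rintegrable N01 (fun x => cos (t * x + theta)).
  by apply: (@rintegrable_bounded _ _ _ _ 1); [exact: mcos|move=> x; exact: cos_max].
have i1 : rintegrable N01 (\1_A : R -> R).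
  apply: (@rintegrable_bounded _ _ _ _ 1) => [|w]; first exact: measurable_indic.
  by rewrite indicE; case: (_ \in _); rewrite ?normr1 ?normr0.
have iA : rintegrable N01 (fun x => \1_A x * cos (t * x + theta)).
  apply: (@rintegrable_mul_bounded _ _ _ _ 1) => // w.
  by rewrite indicE; case: (_ \in _); rewrite ?normr1 ?normr0.
have p1 : prob_itv M = mean N01 (\1_A : R -> R) by rewrite mean_indic.
have p2 : prob_itv M = peak * (2 * M) * gauss_cos 1 0 M0 0.
  rewrite -normal_mean_trunc p1; apply: eq_mean => x.
  by rewrite mul0r add0r cos0 mulr1.
have h1 : `|mean N01 (fun x => cos (t * x + theta)) - mean N01 (fun x => \1_A x * cos (t * x + theta))|
    <= 1 - prob_itv M.
  rewrite p1 -[X in _ <= X - _](mean_cst N01) -!meanB//; last exact: rintegrable_cst.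
  apply: normr_mean_le; [exact: rintegrableB|by apply: rintegrableB => //; exact: rintegrable_cst|].
  move=> x; rewrite indicE; case: (_ \in _); first by rewrite mul1r !subrr normr0.
  by rewrite mul0r !subr0 cos_max.
have h2 := gauss_cos_approx theta M0 (@ltr01 R) t0.
rewrite normal_mean_trunc in h1.
have pk0 : 0 <= peak by exact: normal_peak_ge0.
have h3 : `|peak * (2 * M) * gauss_cos 1 theta M0 t - expR (- (t ^+ 2 / 2)) * cos theta * prob_itv M|
    <= 2 * peak * t * e M.
  rewrite p2; rewrite gauss_cos0E mulr1 in h2.
  have -> : peak * (2 * M) * gauss_cos 1 theta M0 t -
      expR (- (t ^+ 2 / 2)) * cos theta * (peak * (2 * M) * gauss_cos 1 0 M0 0) =
     peak * (2 * M) * (gauss_cos 1 theta M0 t - expR (- (t ^+ 2 / 2)) * (cos theta * gauss_cos 1 0 M0 0)) by ring.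
  rewrite normrM ger0_norm; last by rewrite mulr_ge0// mulr_ge0// ltW.
  apply: le_trans (ler_wpM2l _ h2) _; first by rewrite mulr_ge0// mulr_ge0// ltW.
  apply: eq_ler; rewrite mulr1; field.
  by rewrite gt_eqF.
have p01 : prob_itv M <= 1.
  by rewrite -lee_fin fineK ?fin_num_measure//; exact: probability_le1.
have h4 : `|expR (- (t ^+ 2 / 2)) * cos theta| <= 1.
  rewrite normrM -[leRHS]mulr1 ler_pM ?cos_max// ger0_norm ?expR_ge0//.
  by rewrite -[leRHS]expR0 ler_expR oppr_le0 divr_ge0// sqr_ge0.
move: (expR (- (t ^+ 2 / 2)) * cos theta) h3 h4 => E h3 h4.
have h5 : `|E - E * prob_itv M| <= 1 - prob_itv M.
  rewrite -{1}[E]mulr1 -mulrBr normrM [X in _ * X]ger0_norm ?subr_ge0//.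
  by rewrite ler_piMl// subr_ge0.
move: h1 h3 h5; rewrite !ler_norml; lra.
Qed.

Let prob_itv_cvg (eps : R) : 0 < eps -> exists2 M, 0 < M & 1 - prob_itv M + e M <= eps.
Proof.
move=> eps0.
pose F n := `[- n.+1%:R, n.+1%:R]%classic : set R.
have mF n : measurable (F n) by exact: measurable_itv.
have UF : \bigcup_n F n = setT.
  apply/seteqP; split => // x _; exists (Num.truncn `|x|) => //=.
  rewrite /F/= in_itv/= -ler_norml; apply: ltW; exact: truncnS_gt.
have ndF : nondecreasing_seq F.
  move=> m n mn; apply/subsetPset => x; rewrite /F/= !in_itv/= -!ler_norml => h.
  by apply: le_trans h _; rewrite ler_nat.
have e1 : N01 (\bigcup_n F n) = 1%E by rewrite UF; exact: probability_setT.
have : (N01 \o F) n @[n --> \oo] --> N01 (\bigcup_n F n).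
  by apply: nondecreasing_cvg_mu => //; rewrite UF.
rewrite e1 => /fine_cvgP[_ cF].
have hE : \forall n \near \oo, `|1 - prob_itv n.+1%:R| <= eps / 2.
  by move/cvgrPdist_le : cF => /(_ _ (divr_gt0 eps0 (ltr0n _ 2))).
have hN : \forall n \near \oo, 4 / eps <= n%:R :> R by exact: nbhs_infty_ger.
near \oo => n.
have h1 : `|1 - prob_itv n.+1%:R| <= eps / 2 by near: n.
have h2 : 4 / eps <= n%:R :> R by near: n.
exists n.+1%:R => //.
have h3 : e (n.+1%:R : R) <= eps / 2.
  apply: le_trans (expRN_le_inv _) _; first by rewrite divr_ge0// mul1r sqr_ge0.
  rewrite -[leRHS]invrK lef_pV2 ?posrE ?invr_gt0 ?divr_gt0//.
  rewrite invf_div mul1r.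
  have h4 : 4 / eps = 2 * (2 / eps) by field; rewrite gt_eqF.
  have n1 : 1 <= n.+1%:R :> R by rewrite ler1n.
  have : n%:R <= n.+1%:R :> R by rewrite ler_nat.
  rewrite expr2; nra.
by move: h1; rewrite ler_norml; lra.
Unshelve. all: end_near. Qed.

Lemma normal_mean_cos (t theta : R) : 0 <= t ->
  mean N01 (fun x => cos (t * x + theta)) = expR (- (t ^+ 2 / 2)) * cos theta.
Proof.
move=> t0; apply/eqP; rewrite -subr_eq0 -normr_le0; apply/ler_addgt0Pl => eps eps0.
rewrite addr0.
pose c := 2 + 2 * peak * t.
have c0 : 0 < c by rewrite ltr_pwDl// mulr_ge0// mulr_ge0// normal_peak_ge0.
have [M M0 hM] := prob_itv_cvg (divr_gt0 eps0 c0).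
apply: le_trans (normal_mean_approx theta M0 t0) _.
have p01 : 0 <= 1 - prob_itv M.
  by rewrite subr_ge0 -lee_fin fineK ?fin_num_measure//; exact: probability_le1.
have pk : 0 <= 2 * peak * t by rewrite mulr_ge0// mulr_ge0// normal_peak_ge0.
have eM := expR_ge0 (- (1 * M ^+ 2 / 2)).
move: hM; rewrite ler_pdivlMr// /c; nra.
Qed.

Lemma charfun_normal (c t : R) : 0 <= c -> 0 <= t ->
  charfun N01 (fun z => c * z) t = (expR (- (c ^+ 2 * t ^+ 2 / 2)))%:C.
Proof.
move=> c0 t0; apply/eqP; rewrite eq_complex/=; apply/andP; split; apply/eqP.
- transitivity (mean N01 (fun x => cos (c * t * x + 0))).
    by apply: eq_mean => z; rewrite addr0 mulrA (mulrC t).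
  by rewrite normal_mean_cos ?mulr_ge0// cos0 mulr1 exprMn.
- transitivity (mean N01 (fun x => cos (c * t * x - pi / 2))).
    by apply: eq_mean => z; rewrite cosBpihalf mulrA (mulrC t).
  by rewrite normal_mean_cos ?mulr_ge0// cosN cos_pihalf mulr0.
Qed.

(** Passing from variance 1 to variance 4 absorbs the linear factor:
    [x^2 / 2 = 3 x^2 / 8 + x^2 / 8]. The first absolute moment is then compared with a density of
    total mass 1. *)
Let abs_pdf_le (x : R) :
  `|x| * normal_pdf 0 1 x <= 8 / 3 * (peak / normal_peak 2) * normal_pdf 0 2 x.
Proof.
have p2 : 0 < normal_peak (2 : R) by exact: normal_peak_gt0.
have -> : normal_pdf 0 2 x = normal_peak 2 * expR (- (x ^+ 2 / 8)).
  rewrite normal_pdfE//; congr (_ * _); rewrite /normal_fun subr0 mulNr.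
  by congr (expR (- (_ / _))); rewrite -natrX -mulrnA.
rewrite pdfE.
have -> : 8 / 3 * (peak / normal_peak 2) * (normal_peak 2 * expR (- (x ^+ 2 / 8))) =
   peak * (8 / 3 * expR (- (x ^+ 2 / 8))) by field; rewrite gt_eqF.
rewrite mulrCA; apply: ler_wpM2l; first exact: normal_peak_ge0.
have -> : - (1 * x ^+ 2 / 2) = - (3 / 8 * x ^+ 2) - x ^+ 2 / 8 by field.
rewrite expRD mulrA; apply: ler_wpM2r; first exact: expR_ge0.
rewrite expRN ler_pdivrMr ?expR_gt0//.
have := expR_ge1Dx (3 / 8 * x ^+ 2); rewrite -(real_normK (num_real x)).
have := sqr_ge0 (`|x| - 1); rewrite sqrrB; move: (expR _) => E; nra.
Qed.

Lemma rintegrable_normal (c : R) : rintegrable N01 (fun z => c * z).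
Proof.
apply: rintegrableZ.
pose C := 8 / 3 * (peak / normal_peak 2).
have C0 : 0 <= C by rewrite mulr_ge0// divr_ge0// normal_peak_ge0.
have mp s : measurable_fun setT (fun x : R => (normal_pdf 0 s x)%:E).
  by apply/measurable_EFinP; exact: measurable_normal_pdf.
suff h : rintegrable N01 (fun z : R => `|z|).
  by apply: rintegrable_le h _ => //; exact: measurable_id.
apply: (@rintegrable_truncation _ _ _ _ C) => [|//|n]; first exact: measurableT_comp.
have mm : measurable_fun setT (fun x : R => Num.min `|x| n%:R).
  by apply: measurable_minr => //; exact: measurableT_comp.
have bf (x : R) : `|Num.min `|x| n%:R| <= n%:R :> R.
  by rewrite ger0_norm ?ge_min ?lexx ?orbT// le_min normr_ge0 ler0n.
have ib := rintegrable_bounded N01 mm bf.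
rewrite -lee_fin -EmeanE// unlock integral_normal_prob//; last by have /integrableP[] := ib.
apply: (@le_trans _ _ (\int[lebesgue_measure]_x (C%:E * (normal_pdf 0 2 x)%:E))%E); last first.
  rewrite ge0_integralZl//; last by move=> x _; rewrite lee_fin normal_pdf_ge0.
    by rewrite integral_normal_pdf mule1.
  exact: mp.
apply: ge0_le_integral => //.
- by move=> x _; rewrite mule_ge0// ?lee_fin ?normal_pdf_ge0// le_min normr_ge0 ler0n.
- by apply: emeasurable_funM; [apply/measurable_EFinP; exact: mm|exact: mp].
- by apply: emeasurable_funM; [exact: measurable_cst|exact: mp].
- move=> x _; rewrite lee_fin; apply: le_trans (abs_pdf_le x).
  by rewrite ler_wpM2r ?normal_pdf_ge0// ge_min lexx.
- by apply/measurable_EFinP; exact: mm.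
Qed.

End gaussian.

(** * Product rule for independent families *)

Section ae.
Context {d : measure_display} {T : measurableType d} {R : realType}.
Variable P : probability T R.

Lemma eq_mean_ae (f g : T -> R) : measurable_fun setT f -> measurable_fun setT g ->
  {ae P, forall w, f w = g w} -> mean P f = mean P g.
Proof.
move=> mf mg fg; rewrite !meanE /Rintegral; congr fine; apply: ae_eq_integral => //.
- exact/measurable_EFinP.
- exact/measurable_EFinP.
- by apply: filterS fg => w h _; rewrite h.
Qed.

Lemma eq_Cexp_ae (f g : T -> R[i]) : cmeasurable f -> cmeasurable g ->
  {ae P, forall w, f w = g w} -> Cexpectation P f = Cexpectation P g.
Proof.
move=> [f1 f2] [g1 g2] fg; apply/eqP; rewrite eq_complex/=; apply/andP; split; apply/eqP.
- by apply: eq_mean_ae => //; apply: filterS fg => w ->.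
- by apply: eq_mean_ae => //; apply: filterS fg => w ->.
Qed.

End ae.

Section independence.
Context {d d' : measure_display} {T : measurableType d} {T' : measurableType d'} {R : realType}.
Variable P : probability T R.

Let ltN11 : -1 < 1 :> R. Proof. by rewrite gtrN. Qed.

(** Layer-cake formula for values in [-1, 1]: it recovers [y] as [2 p - 1], where [p] is an average
    of indicators. *)
Lemma mean_uniform_lt (y : R) : `|y| <= 1 ->
  mean (uniform_prob ltN11) (fun u => (u < y)%R%:R) = (1 + y) / 2.
Proof.
rewrite ler_norml => /andP[y1 y2].
rewrite (_ : (fun _ => _) = \1_(`]-oo, y[%classic)); last first.
  apply/funext => u; rewrite indicE; congr (nat_of_bool _)%:R.
  by apply/idP/idP; rewrite inE/= in_itv.
rewrite mean_indic//= /uniform_prob integral_uniform_pdf.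
have -> : `]-oo, y[ `&` `[-1, 1] = `[-1, y[%classic :> set R.
  apply/seteqP; split => u /=; rewrite !in_itv/=; first by move=> [-> /andP[->]].
  by move=> /andP[-> uy]; split => //=; rewrite (le_trans (ltW uy)).
rewrite (eq_integral (cst ((1 - -1)^-1)%:E)); last first.
  move=> u; rewrite inE/= in_itv/= => /andP[u1 uy]; rewrite /uniform_pdf u1/=.
  by rewrite (le_trans (ltW uy)).
rewrite integral_cst//= lebesgue_measure_itv/= lte_fin.
have [h|h] := ltP (-1) y; first by rewrite -EFinB/=; field.
by rewrite mule0/=; lra.
Qed.

Section weak_independence.
Variable Z : T -> T'.
Hypothesis mZ : measurable_fun setT Z.

(** Fubini exchanges the level [u] and the point [w], so that a product with [f (Z w)] becomes an
    average of products with indicators of sets [u < f]. It serves both independence and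
    conditioning. *)
Lemma mean_mul_layer (g : T -> R) (f : T' -> R) :
  measurable_fun setT g -> (forall w, `|g w| <= 1) ->
  measurable_fun setT f -> (forall z, `|f z| <= 1) ->
  rintegrable (uniform_prob ltN11) (fun u => mean P (fun w => g w * \1_[set z | u < f z] (Z w))) /\
  mean P (fun w => g w * f (Z w)) =
  2 * mean (uniform_prob ltN11) (fun u => mean P (fun w => g w * \1_[set z | u < f z] (Z w))) - mean P g.
Proof.
move=> mg g1 mf f1.
pose F (z : T * R) := g z.1 * (z.2 < f (Z z.1))%R%:R.
have mF : measurable_fun setT F.
  apply: measurable_funM; first by apply: measurableT_comp => //; exact: measurable_fst.
  rewrite (_ : (fun _ => _) = fun z : T * R => if z.2 < f (Z z.1) then 1 else 0 : R).
    apply: measurable_fun_ifT => //; apply: measurable_fun_ltr; first exact: measurable_snd.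
    apply: (measurableT_comp mf); apply: (measurableT_comp mZ); exact: measurable_fst.
  by apply/funext => z; case: (_ < _).
have F1 w u : `|F (w, u)| <= (fun=> 1) w.
  by rewrite normrM -[leRHS]mulr1 ler_pM//=; case: (_ < _); rewrite ?normr1 ?normr0.
have i1 := rintegrable_cst P (1 : R).
have eF u : mean P (fun w => g w * \1_[set z | u < f z] (Z w)) = mean P (fun w => F (w, u)).
  apply: eq_mean => w; rewrite /F/= indicE; congr (_ * (nat_of_bool _)%:R).
  by apply/idP/idP; rewrite inE.
have gi : rintegrable P g by exact: (@rintegrable_bounded _ _ _ _ 1).
under eq_fun do rewrite eF.
split; first exact: (@rintegrable_mean2 _ _ _ _ _ P (uniform_prob ltN11) _ _ i1 mF F1).
rewrite -(@mean_fubini_dominated _ _ _ _ _ P (uniform_prob ltN11) _ _ i1 mF F1) -meanZ; last exact: (@rintegrable_mean1 _ _ _ _ _ P (uniform_prob ltN11) _ _ i1 mF F1).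
rewrite -meanB//; last by apply: rintegrableZ; exact: (@rintegrable_mean1 _ _ _ _ _ P (uniform_prob ltN11) _ _ i1 mF F1).
apply: eq_mean => w; rewrite /F/= meanZ ?mean_uniform_lt//; first by field.
apply: (@rintegrable_bounded _ _ _ _ 1) => [|u].
  rewrite (_ : (fun _ => _) = fun u : R => if u < f (Z w) then 1 else 0 : R).
    by apply: measurable_fun_ifT => //; exact: measurable_fun_ltr.
  by apply/funext => z; case: (_ < _).
by case: (_ < _); rewrite ?normr1 ?normr0.
Qed.

(* writing [f] as an average of indicators of its superlevel sets reduces the product rule to indicators *)
Lemma mean_mul_indep (g : T -> R) (f : T' -> R) :
  measurable_fun setT g -> (forall w, `|g w| <= 1) ->
  (forall B, measurable B -> mean P (fun w => g w * \1_B (Z w)) = mean P g * mean P (fun w => \1_B (Z w))) ->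
  measurable_fun setT f -> (forall z, `|f z| <= 1) ->
  mean P (fun w => g w * f (Z w)) = mean P g * mean P (fun w => f (Z w)).
Proof.
move=> mg g1 hg mf f1.
have [_ ->] := mean_mul_layer mg g1 mf f1.
have n11 (w : T) : `|1 : R| <= 1 by rewrite normr1.
have [i1 e1] := mean_mul_layer (@measurable_cst _ _ T R setT 1) n11 mf f1.
have ec : mean P (cst 1 : T -> R) = 1 by exact: mean_cst.
have ef : mean P (fun w => cst 1 w * f (Z w)) = mean P (fun w => f (Z w)).
  by apply: eq_mean => w; rewrite /= mul1r.
rewrite ec ef in e1.
rewrite e1.
have -> : mean (uniform_prob ltN11) (fun u => mean P (fun w => g w * \1_[set z | u < f z] (Z w))) =
   mean P g * mean (uniform_prob ltN11) (fun u => mean P (fun w => cst 1 w * \1_[set z | u < f z] (Z w))).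
  rewrite -meanZ//; apply: eq_mean => u; rewrite hg; last first.
    rewrite (_ : [set z | u < f z] = setT `&` f @^-1` `]u, +oo[%classic); first exact: mf.
    by apply/seteqP; split => z /=; rewrite in_itv/= andbT//; move=> [].
  by congr (_ * _); apply: eq_mean => w; rewrite /= mul1r.
by ring.
Qed.

Lemma Cexp_mul_indep (g : T -> R[i]) (f : T' -> R[i]) :
  cmeasurable g -> (forall w, cnorm (g w) <= 1) ->
  (forall B, measurable B -> Cexpectation P (fun w => g w * (\1_B (Z w))%:C) =
     Cexpectation P g * (mean P (fun w => \1_B (Z w)))%:C) ->
  cmeasurable f -> (forall z, cnorm (f z) <= 1) ->
  Cexpectation P (fun w => g w * f (Z w)) = Cexpectation P g * Cexpectation P (fun w => f (Z w)).
Proof.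
move=> [mg1 mg2] g1 hg [mf1 mf2] f1.
have hRe B : measurable B -> mean P (fun w => complex.Re (g w) * \1_B (Z w)) =
    mean P (fun w => complex.Re (g w)) * mean P (fun w => \1_B (Z w)).
  move=> /hg /(congr1 (@complex.Re R)) /=; rewrite mulr0 subr0 => <-.
  by apply: eq_mean => w; case: (g w) => a b /=; rewrite mulr0 subr0.
have hIm B : measurable B -> mean P (fun w => complex.Im (g w) * \1_B (Z w)) =
    mean P (fun w => complex.Im (g w)) * mean P (fun w => \1_B (Z w)).
  move=> /hg /(congr1 (@complex.Im R)) /=; rewrite mulr0 add0r => <-.
  by apply: eq_mean => w; case: (g w) => a b /=; rewrite mulr0 add0r.
have nRe w : `|complex.Re (g w)| <= 1 by exact: le_trans (normr_Re_le _) (g1 w).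
have nIm w : `|complex.Im (g w)| <= 1 by exact: le_trans (normr_Im_le _) (g1 w).
have fRe z : `|complex.Re (f z)| <= 1 by exact: le_trans (normr_Re_le _) (f1 z).
have fIm z : `|complex.Im (f z)| <= 1 by exact: le_trans (normr_Im_le _) (f1 z).
have int (a : T -> R) (b : T' -> R) : measurable_fun setT a -> measurable_fun setT b ->
    (forall w, `|a w| <= 1) -> (forall z, `|b z| <= 1) -> rintegrable P (fun w => a w * b (Z w)).
  move=> ma mb a1 b1; apply: (@rintegrable_bounded _ _ _ _ 1) => [|w].
    by apply: measurable_funM => //; exact: measurableT_comp.
  by rewrite normrM -[leRHS]mulr1 ler_pM.
have iRR := int _ _ mg1 mf1 nRe fRe; have iRI := int _ _ mg1 mf2 nRe fIm.
have iIR := int _ _ mg2 mf1 nIm fRe; have iII := int _ _ mg2 mf2 nIm fIm.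
apply/eqP; rewrite eq_complex/=; apply/andP; split; apply/eqP.
- rewrite -!(mean_mul_indep (f := fun z => complex.Re (f z)))//.
  rewrite -!(mean_mul_indep (f := fun z => complex.Im (f z)))//.
  rewrite -meanB//.
  by apply: eq_mean => w; case: (g w); case: (f _).
- rewrite -!(mean_mul_indep (f := fun z => complex.Re (f z)))//.
  rewrite -!(mean_mul_indep (f := fun z => complex.Im (f z)))//.
  rewrite -meanD//.
  by apply: eq_mean => w; case: (g w); case: (f _).
Qed.

End weak_independence.

Section product_rule.
Variables (m : nat) (Z : 'I_m -> T -> T').
Hypothesis mZ : forall i, measurable_fun setT (Z i).
Hypothesis indep : mutually_independent P Z.

Let indicC (B : set T') (z : T') : R[i] := (\1_B z)%:C.

Let cnorm_indicC B z : cnorm (indicC B z) <= 1.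
Proof. by rewrite cnorm_real indicE; case: (_ \in _); rewrite ?normr1 ?normr0. Qed.

Let cmeas_indicC B : measurable B -> cmeasurable (indicC B).
Proof. by move=> mB; split; [exact: measurable_indic|exact: measurable_cst]. Qed.

Let cmeas_comp (F : T' -> R[i]) i : cmeasurable F -> cmeasurable (fun w => F (Z i w)).
Proof. by move=> [h1 h2]; split; [exact: (measurableT_comp h1 (mZ i))|exact: (measurableT_comp h2 (mZ i))]. Qed.

Lemma Cexp_prod_indic (B : 'I_m -> set T') : (forall i, measurable (B i)) ->
  Cexpectation P (fun w => \prod_i indicC (B i) (Z i w)) =
  \prod_i Cexpectation P (fun w => indicC (B i) (Z i w)).
Proof.
move=> mB.
have mZB i : measurable (Z i @^-1` B i).
  by rewrite -[X in measurable X]setTI; exact: mZ.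
have e1 i : Cexpectation P (fun w => indicC (B i) (Z i w)) = (fine (P (Z i @^-1` B i)))%:C.
  by rewrite /indicC Cexp_real -(mean_indic _ (mZB i)).
under [RHS]eq_bigr do rewrite e1.
have e2 w : \prod_i indicC (B i) (Z i w) = (\1_(\bigcap_(i in [set` [set: 'I_m]%SET]) (Z i @^-1` B i)) w)%:C.
  rewrite /indicC -rmorph_prod; congr (_%:C).
  rewrite [RHS]indicE; case: (boolP (w \in _)) => [/set_mem wB|/negP wB].
    by rewrite big1// => i _; rewrite indicE mem_set//; apply: wB; rewrite /= inE.
  have [i nB] : exists i, ~ B i (Z i w).
    by apply/existsNP => h; apply: wB; apply/mem_set => i _; exact: h.
  by rewrite (bigD1 i)//= indicE memNset// mul0r.
under eq_fun do rewrite e2.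
rewrite Cexp_real mean_indic; last exact: fin_bigcap_measurable.
rewrite indep// -rmorph_prod; congr (_%:C).
rewrite (eq_bigr (fun i => (fine (P (Z i @^-1` B i)))%:E)); last first.
  by move=> i _; rewrite fineK// fin_num_measure.
rewrite prodEFin/=; apply: eq_bigl => i; by rewrite inE.
Qed.

(** Induction on a rank [n] beyond which all factors are indicators. To free the factor of index
    [n], it is first replaced by the indicator of an arbitrary [B], which the induction hypothesis
    allows; [Cexp_mul_indep] then passes from these indicators to a general function. *)
Lemma Cexp_prod_indep (F : 'I_m -> T' -> R[i]) :
  (forall i, cmeasurable (F i)) -> (forall i z, cnorm (F i z) <= 1) ->
  Cexpectation P (fun w => \prod_i F i (Z i w)) =
  \prod_i Cexpectation P (fun w => F i (Z i w)).
Proof.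
move=> mF F1.
suff key n : forall F : 'I_m -> T' -> R[i],
    (forall i, cmeasurable (F i)) -> (forall i z, cnorm (F i z) <= 1) ->
    (forall i : 'I_m, (n <= i)%N -> exists2 B, measurable B & F i = indicC B) ->
    Cexpectation P (fun w => \prod_i F i (Z i w)) =
    \prod_i Cexpectation P (fun w => F i (Z i w)).
  by apply: (key m) => // i; rewrite leqNgt ltn_ord.
elim: n => [|n IH] {}F {}mF {}F1 FB.
  have /choice[B hB] : forall i, exists B, measurable B /\ F i = indicC B.
    by move=> i; have [B mB e] := FB i (leq0n _); exists B.
  under eq_fun do under eq_bigr do rewrite (hB _).2.
  under [RHS]eq_bigr do rewrite (hB _).2.
  by apply: Cexp_prod_indic => i; exact: (hB i).1.
have [mn|nm] := leqP m n.
  by apply: IH => // i ni; have := ltn_ord i; rewrite ltnNge (leq_trans mn ni).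
pose i0 := Ordinal nm.
pose g w := \prod_(i | i != i0) F i (Z i w).
pose FF (f : T' -> R[i]) i := if i == i0 then f else F i.
have mg : cmeasurable g.
  rewrite /g; under eq_fun do rewrite -big_filter.
  by apply: cmeasurable_prod => i; exact: cmeas_comp.
have g1 w : cnorm (g w) <= 1.
  rewrite /g; elim/big_ind: _ => [|x y hx hy|//]; first by rewrite cnorm1.
  by rewrite cnormM -[leRHS]mulr1 ler_pM ?cnorm_ge0.
have hB B : measurable B -> Cexpectation P (fun w => indicC B (Z i0 w) * g w) =
   Cexpectation P (fun w => indicC B (Z i0 w)) *
     \prod_(i | i != i0) Cexpectation P (fun w => F i (Z i w)).
  move=> mB; have := IH (FF (indicC B)).
  have eL w : \prod_i FF (indicC B) i (Z i w) = indicC B (Z i0 w) * g w.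
    rewrite (bigD1 i0)//= /FF eqxx; congr (_ * _).
    by apply: eq_bigr => i /negbTE ->.
  move=> h; rewrite -(eq_Cexp P eL) {}h.
  - rewrite (bigD1 i0)//= /FF eqxx; congr (_ * _).
    by apply: eq_bigr => i /negbTE ->.
  - by move=> i; rewrite /FF; case: ifP => // _; exact: cmeas_indicC.
  - by move=> i z; rewrite /FF; case: ifP => // _; exact: cnorm_indicC.
  - move=> i ni; rewrite /FF; case: eqP => [_|/eqP ii0]; first by exists B.
    apply: FB; rewrite ltn_neqAle ni andbT; apply: contra ii0 => /eqP e.
    by apply/eqP/val_inj; rewrite /= -e.
(* Taking the whole space for [B] evaluates the product of the remaining factors. *)
have gE : Cexpectation P g = \prod_(i | i != i0) Cexpectation P (fun w => F i (Z i w)).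
  have := hB setT measurableT; rewrite /indicC.
  rewrite Cexp_real.
  have -> : mean P (fun w => \1_(@setT T') (Z i0 w) : R) = 1.
    by rewrite -[RHS](mean_cst P); apply: eq_mean => w; rewrite indicT.
  rewrite mul1r => <-; apply: eq_Cexp => w.
  by rewrite indicT mul1r.
have -> : (fun w => \prod_i F i (Z i w)) = (fun w => g w * F i0 (Z i0 w)).
  by apply/funext => w; rewrite (bigD1 i0)//= mulrC.
rewrite (Cexp_mul_indep (mZ i0))// => [|B mB].
  by rewrite gE [RHS](bigD1 i0)//= mulrC.
rewrite gE -Cexp_real mulrC -hB//.
by apply: eq_Cexp => w; rewrite mulrC.
Qed.

End product_rule.

End independence.

(** * Fourier inversion on a lattice *)

Section fourier_inversion.
Context {R : realType}.

Lemma sin_intmulpi (z : int) : sin (pi * z%:~R) = 0 :> R.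
Proof.
have h n : sin (pi * n%:R) = 0 :> R.
  elim: n => [|n IH]; first by rewrite mulr0 sin0.
  by rewrite -natr1 mulrDr mulr1 sinDpi IH oppr0.
case: z => n; first exact: h.
by rewrite NegzE mulrNz mulrN sinN h oppr0.
Qed.

Local Notation ltNpi := (ltNM (@pi_gt0 R)).

Definition Cpi_mean (f : R -> R[i]) : R[i] :=
  Cexpectation (uniform_prob ltNpi) (fun s => f (clip (- pi) pi s)).

(** Orthogonality of the characters of the circle; at a nonzero [z] the antiderivatives agree at
    both ends because [sin (pi z) = 0]. *)
Lemma Cpi_mean_expi (z : int) (c : R) :
  Cpi_mean (fun s => expi (s * z%:~R + c)) = (z == 0)%:R * expi c.
Proof.
have [->|z0] := eqVneq z 0.
  rewrite mul1r -[RHS](Cexp_cst (uniform_prob ltNpi)); apply: eq_Cexp => s.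
  by rewrite mulr0 add0r.
rewrite mul0r; set v : R := z%:~R.
have v0 : v != 0 by rewrite intr_eq0.
have sv : sin (pi * v) = 0 by exact: sin_intmulpi.
have d1 (x : R) : is_derive x 1 (fun s => sin (s * v + c) / v) (cos (x * v + c)).
  by apply: is_derive_eq; rewrite /GRing.scale/=; field.
have d2 (x : R) : is_derive x 1 (fun s => - cos (s * v + c) / v) (sin (x * v + c)).
  by apply: is_derive_eq; rewrite /GRing.scale/=; field.
have k1 : continuous ((fun s => cos (s * v + c)) : R -> R).
  by apply: derivable_continuousT => x; exact: ex_derive.
have k2 : continuous ((fun s => sin (s * v + c)) : R -> R).
  by apply: derivable_continuousT => x; exact: ex_derive.
apply/eqP; rewrite eq_complex/=; apply/andP; split; apply/eqP.
- rewrite -/(unif_mean ltNpi (fun s => cos (s * v + c))) (unif_mean_FTC ltNpi d1 k1).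
  by rewrite mulNr !sinD sinN cosN sv oppr0 !mul0r !add0r subrr mul0r.
- rewrite -/(unif_mean ltNpi (fun s => sin (s * v + c))) (unif_mean_FTC ltNpi d2 k2).
  by rewrite (mulNr pi v) !cosD sinN cosN sv oppr0 !mul0r !subr0 subrr mul0r.
Qed.

Context {d : measure_display} {T : measurableType d} (P : probability T R).

(** [V] is an integer only almost surely: it will be a shifted sum of copies, which inherit the
    values of [X] through their law alone. *)
Lemma Cpi_mean_inversion (V T0 : T -> R) :
  measurable_fun setT V -> measurable_fun setT T0 -> {ae P, forall w, V w \is a Num.int} ->
  Cpi_mean (fun s => Cexpectation P (fun w => expi (s * V w + T0 w))) =
  Cexpectation P (fun w => (\1_[set w | V w = 0] w)%:C * expi (T0 w)).
Proof.
move=> mV mT0 iV.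
pose f (z : T * R) := expi (clip (- pi) pi z.2 * V z.1 + T0 z.1).
have mf : cmeasurable f.
  apply: cmeasurable_expi; apply: measurable_funD.
    apply: measurable_funM; last by apply: measurableT_comp => //; exact: measurable_fst.
    by apply: (measurableT_comp (@measurable_clip R (- pi) pi)); exact: measurable_snd.
  by apply: measurableT_comp => //; exact: measurable_fst.
have f1 z : cnorm (f z) <= 1 by rewrite cnorm_expi.
rewrite /Cpi_mean -(Cexp_fubini P (uniform_prob ltNpi) mf f1).
have mE := measurable_level 0 mV.
apply: eq_Cexp_ae.
- by apply: cintegrable_measurable; exact: (cintegrable_Cexp1 P (uniform_prob ltNpi) mf f1).
- apply: cmeasurableM; last exact: cmeasurable_expi.
  by split; [exact: measurable_indic|exact: measurable_cst].
apply: filterS iV => w /intrP[z Vz].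
have := Cpi_mean_expi z (T0 w); rewrite /Cpi_mean -Vz => ->.
congr (_ * _); rewrite indicE -(intr_eq0 R) -Vz.
case: (eqVneq (V w) 0) => [h|h]; first by rewrite mem_set.
by rewrite memNset//; exact/eqP.
Qed.

Lemma cintegrable_Cpi (V T0 : T -> R) :
  measurable_fun setT V -> measurable_fun setT T0 ->
  cintegrable (uniform_prob ltNpi) (fun s => Cexpectation P (fun w => expi (clip (- pi) pi s * V w + T0 w))).
Proof.
move=> mV mT0.
pose f (z : T * R) := expi (clip (- pi) pi z.2 * V z.1 + T0 z.1).
have mf : cmeasurable f.
  apply: cmeasurable_expi; apply: measurable_funD.
    apply: measurable_funM; last by apply: measurableT_comp => //; exact: measurable_fst.
    by apply: (measurableT_comp (@measurable_clip R (- pi) pi)); exact: measurable_snd.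
  by apply: measurableT_comp => //; exact: measurable_fst.
have f1 z : cnorm (f z) <= 1 by rewrite cnorm_expi.
exact: (cintegrable_Cexp2 P (uniform_prob ltNpi) mf f1).
Qed.

End fourier_inversion.

(** * Expansion of the joint characteristic function *)

Lemma mul_sqr_le_cubes {R : realType} (a b : R) : 0 <= a -> 0 <= b -> a ^+ 2 * b <= a ^+ 3 + b ^+ 3.
Proof.
move=> a0 b0; have [ab|ab] := leP a b.
  have : a ^+ 2 * b <= b ^+ 2 * b by rewrite ler_wpM2r// lerXn2r.
  by have := exprn_ge0 3 a0; rewrite -exprSr; lra.
have : a ^+ 2 * b <= a ^+ 2 * a by rewrite ler_wpM2l ?sqr_ge0// ltW.
by have := exprn_ge0 3 b0; rewrite -exprSr; lra.
Qed.

Section pointwise.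
Context {R : realType}.

Let Ci (x : R) : R[i] := Complex 0 x.

Let cnormCi (x : R) : cnorm (Ci x) = `|x|.
Proof. by rewrite cnormE/= expr0n/= add0r sqrtr_sqr. Qed.

(* The subtracted terms have mean zero when [b] is centered, with variance [b2], and uncorrelated with [a]. *)
Lemma expi_expansion1 (s t a b b2 : R) : `|t| <= 1 -> 0 <= b2 ->
  cnorm (expi (s * a + t * b) - (expR (- (b2 * t ^+ 2 / 2)))%:C * expi (s * a)
         - Complex 0 (t * b) + (t * s * (a * b))%:C + (t ^+ 2 / 2 * (b ^+ 2 - b2))%:C) <=
  (3 + b2 + b2 ^+ 2) * (`|t| * (s ^+ 2 + t ^+ 2)) * (1 + `|a| ^+ 3 + `|b| ^+ 3).
Proof.
move=> t1 b20; set c := expR _.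
set z := (X in cnorm X).
(* Each of the four terms has order at least 3 in [(s, t)] and contains a factor [t]: two Taylor
   remainders in [t], then the products of a term in [t] with a remainder in [s * a]. *)
have -> : z = expi (s * a) * (expi (t * b) - 1 - Ci (t * b) + ((t * b) ^+ 2 / 2)%:C)
   + expi (s * a) * (1 - b2 * t ^+ 2 / 2 - c)%:C
   + Ci (t * b) * (expi (s * a) - 1 - Ci (s * a))
   - (t ^+ 2 / 2 * (b ^+ 2 - b2))%:C * (expi (s * a) - 1).
  rewrite /z expiD; case: (expi (s * a)) => x y; case: (expi (t * b)) => x' y'.
  by apply/eqP; rewrite eq_complex/=; apply/andP; split; apply/eqP; field.
have h1 := cnorm_expi_sub3 (t * b).
have h2 : `|1 - b2 * t ^+ 2 / 2 - c| <= (b2 * t ^+ 2 / 2) ^+ 2 / 2.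
  rewrite distrC; have := @expRN_sub_le R (b2 * t ^+ 2 / 2).
  have hx : 0 <= b2 * t ^+ 2 / 2 by rewrite divr_ge0// mulr_ge0// sqr_ge0.
  move=> /(_ hx); rewrite -/c.
  by rewrite (_ : c - (1 - _) = c - 1 + b2 * t ^+ 2 / 2)//; ring.
have h3 := cnorm_expi_sub2 (s * a).
have h4 := cnorm_expi_sub1 (s * a).
apply: (@le_trans _ _ (`|t * b| ^+ 3 + (b2 * t ^+ 2 / 2) ^+ 2 / 2 + `|t * b| * (s * a) ^+ 2
   + t ^+ 2 / 2 * (b ^+ 2 + b2) * (2 * `|s * a|))).
  apply: le_trans (cnormB _ _) _; apply: lerD.
    apply: le_trans (cnormD _ _) _; apply: lerD.
      apply: le_trans (cnormD _ _) _; apply: lerD.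
        by rewrite cnormM cnorm_expi mul1r.
      by rewrite cnormM cnorm_expi mul1r cnorm_real.
    by rewrite cnormM cnormCi ler_wpM2l.
  rewrite cnormM cnorm_real normrM ger0_norm ?divr_ge0 ?sqr_ge0//.
  apply: ler_pM => //; first by rewrite mulr_ge0 ?divr_ge0 ?sqr_ge0.
    exact: cnorm_ge0.
  rewrite ler_wpM2l ?divr_ge0 ?sqr_ge0//.
  by apply: le_trans (ler_normB _ _) _; rewrite !ger0_norm// sqr_ge0.
rewrite !normrM exprMn [(s * a) ^+ 2]exprMn.
have es := real_normK (num_real s); have et := real_normK (num_real t).
have ea := real_normK (num_real a); have eb := real_normK (num_real b).
rewrite -es -et -ea -eb.
move: (normr_ge0 s) (normr_ge0 t) (normr_ge0 a) (normr_ge0 b) t1 => s0 t0 a0 b0 t1.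
clear -s0 t0 a0 b0 t1 b20.
move: (`|s|) (`|t|) (`|a|) (`|b|) s0 t0 a0 b0 t1 => {}s {}t {}a {}b s0 t0 a0 b0 t1.
set Q := t * (s ^+ 2 + t ^+ 2); set m := 1 + a ^+ 3 + b ^+ 3.
have Q0 : 0 <= Q by rewrite mulr_ge0// addr_ge0// sqr_ge0.
have a3 : 0 <= a ^+ 3 by exact: exprn_ge0.
have b3 : 0 <= b ^+ 3 by exact: exprn_ge0.
have m1 : 1 <= m by rewrite /m; lra.
have Qt : t ^+ 3 <= Q by rewrite /Q exprS ler_wpM2l// lerDr sqr_ge0.
have Qs : t * s ^+ 2 <= Q by rewrite /Q ler_wpM2l// lerDl sqr_ge0.
have Qts : t ^+ 2 * s <= Q.
  rewrite /Q expr2 -mulrA ler_wpM2l//.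
  have := sqr_ge0 (t - s); have := sqr_ge0 t; have := sqr_ge0 s; rewrite sqrrB; lra.
have g1 : t ^+ 3 * b ^+ 3 <= Q * m.
  by apply: ler_pM => //; rewrite ?exprn_ge0// /m; lra.
have g2 : (b2 * t ^+ 2 / 2) ^+ 2 / 2 <= b2 ^+ 2 * Q * m.
  have -> : (b2 * t ^+ 2 / 2) ^+ 2 / 2 = b2 ^+ 2 * (t ^+ 3 * t) / 8 by field.
  have e1 : b2 ^+ 2 * (t ^+ 3 * t) <= b2 ^+ 2 * Q.
    rewrite ler_wpM2l ?sqr_ge0//; apply: le_trans Qt.
    by rewrite ler_piMr// exprn_ge0.
  have e2 : 0 <= b2 ^+ 2 * Q by rewrite mulr_ge0 ?sqr_ge0.
  have e3 : b2 ^+ 2 * Q <= b2 ^+ 2 * Q * m by rewrite ler_peMr.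
  lra.
have g3 : t * b * (s ^+ 2 * a ^+ 2) <= Q * m.
  have -> : t * b * (s ^+ 2 * a ^+ 2) = (t * s ^+ 2) * (a ^+ 2 * b) by ring.
  apply: ler_pM => //; rewrite ?mulr_ge0 ?sqr_ge0//.
  by have := mul_sqr_le_cubes a0 b0; rewrite /m; lra.
have g4 : t ^+ 2 / 2 * (b ^+ 2 + b2) * (2 * (s * a)) <= (1 + b2) * Q * m.
  have -> : t ^+ 2 / 2 * (b ^+ 2 + b2) * (2 * (s * a)) = (t ^+ 2 * s) * (b ^+ 2 * a + b2 * a) by field.
  have -> : (1 + b2) * Q * m = Q * (m + b2 * m) by ring.
  apply: ler_pM => //; first by rewrite mulr_ge0// sqr_ge0.
    by rewrite addr_ge0// mulr_ge0// sqr_ge0.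
  apply: lerD; first by have := mul_sqr_le_cubes b0 a0; rewrite /m; lra.
  by rewrite ler_wpM2l//; have := ler_1cube a0; rewrite /m; lra.
have -> : (3 + b2 + b2 ^+ 2) * Q * m = Q * m + b2 ^+ 2 * Q * m + Q * m + (1 + b2) * Q * m by ring.
by apply: lerD => //; apply: lerD => //; apply: lerD.
Qed.

(** With [cos (t * b)] instead of the exponential there is no term of first order in [t], and the
    error improves from [|t| (s^2 + t^2)] to [t^2 (|s| + |t|)], as the variance requires. *)
Lemma expi_expansion2 (s t a b b2 : R) : `|t| <= 1 -> 0 <= b2 ->
  cnorm (expi (s * a) * (cos (t * b) - expR (- (b2 * t ^+ 2 / 2)))%:C
         + (t ^+ 2 / 2 * (b ^+ 2 - b2))%:C) <=
  (3 + b2 + b2 ^+ 2) * (`|t| ^+ 3 + t ^+ 2 * `|s|) * (1 + `|a| ^+ 3 + `|b| ^+ 3).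
Proof.
move=> t1 b20; set c := expR _.
set z := (X in cnorm X).
have -> : z = expi (s * a) * (cos (t * b) - 1 + ((t * b) ^+ 2 / 2))%:C
   + expi (s * a) * (1 - b2 * t ^+ 2 / 2 - c)%:C
   - (t ^+ 2 / 2 * (b ^+ 2 - b2))%:C * (expi (s * a) - 1).
  rewrite /z; case: (expi (s * a)) => x y.
  by apply/eqP; rewrite eq_complex/=; apply/andP; split; apply/eqP; field.
have h1 := normr_cos_sub_le3 (t * b).
have h2 : `|1 - b2 * t ^+ 2 / 2 - c| <= (b2 * t ^+ 2 / 2) ^+ 2 / 2.
  rewrite distrC; have := @expRN_sub_le R (b2 * t ^+ 2 / 2).
  have hx : 0 <= b2 * t ^+ 2 / 2 by rewrite divr_ge0// mulr_ge0// sqr_ge0.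
  move=> /(_ hx); rewrite -/c.
  by rewrite (_ : c - (1 - _) = c - 1 + b2 * t ^+ 2 / 2)//; ring.
have h4 := cnorm_expi_sub1 (s * a).
apply: (@le_trans _ _ (`|t * b| ^+ 3 / 6 + (b2 * t ^+ 2 / 2) ^+ 2 / 2
   + t ^+ 2 / 2 * (b ^+ 2 + b2) * (2 * `|s * a|))).
  apply: le_trans (cnormB _ _) _; apply: lerD.
    apply: le_trans (cnormD _ _) _; apply: lerD.
      by rewrite cnormM cnorm_expi mul1r cnorm_real.
    by rewrite cnormM cnorm_expi mul1r cnorm_real.
  rewrite cnormM cnorm_real normrM ger0_norm ?divr_ge0 ?sqr_ge0//.
  apply: ler_pM => //; first by rewrite mulr_ge0 ?divr_ge0 ?sqr_ge0.
    exact: cnorm_ge0.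
  rewrite ler_wpM2l ?divr_ge0 ?sqr_ge0//.
  by apply: le_trans (ler_normB _ _) _; rewrite !ger0_norm// sqr_ge0.
rewrite !normrM exprMn.
have et := real_normK (num_real t); have eb := real_normK (num_real b).
rewrite -et -eb.
move: (normr_ge0 s) (normr_ge0 t) (normr_ge0 a) (normr_ge0 b) t1 => s0 t0 a0 b0 t1.
clear -s0 t0 a0 b0 t1 b20.
move: (`|s|) (`|t|) (`|a|) (`|b|) s0 t0 a0 b0 t1 => {}s {}t {}a {}b s0 t0 a0 b0 t1.
set Q := t ^+ 3 + t ^+ 2 * s; set m := 1 + a ^+ 3 + b ^+ 3.
have t3 : 0 <= t ^+ 3 by exact: exprn_ge0.
have ts : 0 <= t ^+ 2 * s by rewrite mulr_ge0 ?sqr_ge0.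
have Q0 : 0 <= Q by rewrite addr_ge0.
have a3 : 0 <= a ^+ 3 by exact: exprn_ge0.
have b3 : 0 <= b ^+ 3 by exact: exprn_ge0.
have m1 : 1 <= m by rewrite /m; lra.
have Qt : t ^+ 3 <= Q by rewrite /Q lerDl.
have Qts : t ^+ 2 * s <= Q by rewrite /Q lerDr.
have Qm : 0 <= Q * m by rewrite mulr_ge0//; lra.
have g1 : t ^+ 3 * b ^+ 3 <= Q * m.
  by apply: ler_pM => //; rewrite /m; lra.
have g2 : (b2 * t ^+ 2 / 2) ^+ 2 / 2 <= b2 ^+ 2 * Q * m.
  have -> : (b2 * t ^+ 2 / 2) ^+ 2 / 2 = b2 ^+ 2 * (t ^+ 3 * t) / 8 by field.
  have e1 : b2 ^+ 2 * (t ^+ 3 * t) <= b2 ^+ 2 * Q.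
    by rewrite ler_wpM2l ?sqr_ge0//; apply: le_trans Qt; rewrite ler_piMr.
  have e2 : 0 <= b2 ^+ 2 * Q by rewrite mulr_ge0 ?sqr_ge0.
  have e3 : b2 ^+ 2 * Q <= b2 ^+ 2 * Q * m by rewrite ler_peMr.
  lra.
have g4 : t ^+ 2 / 2 * (b ^+ 2 + b2) * (2 * (s * a)) <= (1 + b2) * Q * m.
  have -> : t ^+ 2 / 2 * (b ^+ 2 + b2) * (2 * (s * a)) = (t ^+ 2 * s) * (b ^+ 2 * a + b2 * a) by field.
  have -> : (1 + b2) * Q * m = Q * (m + b2 * m) by ring.
  apply: ler_pM => //; first by rewrite addr_ge0// mulr_ge0// sqr_ge0.
  apply: lerD; first by have := mul_sqr_le_cubes b0 a0; rewrite /m; lra.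
  by rewrite ler_wpM2l//; have := ler_1cube a0; rewrite /m; lra.
have -> : (3 + b2 + b2 ^+ 2) * Q * m = Q * m + b2 ^+ 2 * Q * m + Q * m + (1 + b2) * Q * m by ring.
lra.
Qed.

End pointwise.

Section charfun_estimates.
Context {R : realType} {d : measure_display} {T : measurableType d}.
Context (P : probability T R) (A B : T -> R).
Context (mA : measurable_fun setT A) (mB : measurable_fun setT B).
Context (A3 : rintegrable P (fun w => `|A w| ^+ 3)) (B3 : rintegrable P (fun w => `|B w| ^+ 3)).
Context (K b2 : R) (A3K : mean P (fun w => `|A w| ^+ 3) <= K).
Context (B3K : mean P (fun w => `|B w| ^+ 3) <= K).
Context (EB : mean P B = 0) (EAB : mean P (fun w => A w * B w) = 0).
Context (EBB : mean P (fun w => B w ^+ 2) = b2).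

Definition joint_cf (s t : R) := Cexpectation P (fun w => expi (s * A w + t * B w)).

Let b20 : 0 <= b2.
Proof. by rewrite -EBB; apply: mean_ge0 => w; exact: sqr_ge0. Qed.

Let K0 : 0 <= K.
Proof. by apply: le_trans A3K; apply: mean_ge0 => w; exact: exprn_ge0. Qed.

Let dom := fun w => 1 + `|A w| ^+ 3 + `|B w| ^+ 3.

Let idom : rintegrable P dom.
Proof. by apply: rintegrableD => //; apply: rintegrableD => //; exact: rintegrable_cst. Qed.

Let Edom : mean P dom <= 1 + 2 * K.
Proof.
rewrite /dom meanD//; last by apply: rintegrableD => //; exact: rintegrable_cst.
rewrite meanD//; last exact: rintegrable_cst.
rewrite mean_cst; move: A3K B3K; lra.
Qed.

Let iA := rintegrable_of_cube mA A3.
Let iB := rintegrable_of_cube mB B3.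
Let iBB := rintegrable_sqr_of_cube mB B3.
Let iAB := rintegrable_mul_of_sqr mA mB (rintegrable_sqr_of_cube mA A3) iBB.

Let gauss t : R := expR (- (b2 * t ^+ 2 / 2)).

Let Cquad (t : R) : cintegrable P (fun w => (t ^+ 2 / 2 * (B w ^+ 2 - b2))%:C) /\
  Cexpectation P (fun w => (t ^+ 2 / 2 * (B w ^+ 2 - b2))%:C) = 0.
Proof.
have h : rintegrable P (fun w => B w ^+ 2 - b2).
  by apply: rintegrableB => //; exact: rintegrable_cst.
split; first by apply: cintegrable_real; exact: rintegrableZ.
rewrite Cexp_real meanZ// meanB//; last exact: rintegrable_cst.
by rewrite EBB mean_cst subrr mulr0.
Qed.

Let Ccross (c : R) : cintegrable P (fun w => (c * (A w * B w))%:C) /\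
  Cexpectation P (fun w => (c * (A w * B w))%:C) = 0.
Proof.
split; first by apply: cintegrable_real; exact: rintegrableZ.
by rewrite Cexp_real meanZ// EAB mulr0.
Qed.

Let Clin (t : R) : cintegrable P (fun w => Complex 0 (t * B w)) /\
  Cexpectation P (fun w => Complex 0 (t * B w)) = 0.
Proof.
split; first by split; [exact: rintegrable_cst|exact: rintegrableZ].
by rewrite /Cexpectation/= mean_cst meanZ// EB mulr0.
Qed.

Let Cphi (s t : R) : cintegrable P (fun w => expi (s * A w + t * B w)).
Proof. by apply: cintegrable_expi; apply: measurable_funD; exact: measurable_funM. Qed.

Let joint_cf0 (s : R) : joint_cf s 0 = Cexpectation P (fun w => expi (s * A w)).
Proof. by apply: eq_Cexp => w; rewrite mul0r addr0. Qed.

Lemma joint_cf_expansion (s t : R) : `|t| <= 1 ->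
  cnorm (joint_cf s t - (gauss t)%:C * joint_cf s 0) <=
  (3 + b2 + b2 ^+ 2) * (1 + 2 * K) * (`|t| * (s ^+ 2 + t ^+ 2)).
Proof.
move=> t1; rewrite joint_cf0.
have i1 := Cphi s t.
have i2 : cintegrable P (fun w => expi (s * A w)).
  by apply: cintegrable_expi; exact: measurable_funM.
have [i3 e3] := Clin t; have [i4 e4] := Ccross (t * s); have [i5 e5] := Cquad t.
have i12 := cintegrableB i1 (cintegrableZ (gauss t)%:C i2).
have i123 := cintegrableB i12 i3.
have i1234 := cintegrableD i123 i4.
have i := cintegrableD i1234 i5.
rewrite -CexpZ// -CexpB//; last exact: cintegrableZ.
(* Insertion of three expectations that vanish, after which the integrand is the one that
   [expi_expansion1] bounds pointwise. *)
rewrite -[X in cnorm X]subr0 -[X in _ - X]e3 -CexpB//.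
rewrite -[X in cnorm X]addr0 -[X in _ + X]e4 -CexpD//.
rewrite -[X in cnorm X]addr0 -[X in _ + X]e5 -CexpD//.
set M := (3 + b2 + b2 ^+ 2) * (`|t| * (s ^+ 2 + t ^+ 2)).
have M0 : 0 <= M.
  by rewrite mulr_ge0 ?mulr_ge0 ?addr_ge0 ?sqr_ge0.
apply: (@le_trans _ _ (mean P (fun w => M * dom w))).
  apply: cnorm_Cexp_le i (rintegrableZ M idom) _ => w.
  exact: expi_expansion1.
rewrite meanZ// [leRHS](_ : _ = M * (1 + 2 * K)); last by rewrite /M; ring.
exact: ler_wpM2l.
Qed.

Lemma joint_cf_even_expansion (s t : R) : `|t| <= 1 ->
  cnorm ((joint_cf s t + joint_cf s (- t)) / 2 - (gauss t)%:C * joint_cf s 0) <=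
  (3 + b2 + b2 ^+ 2) * (1 + 2 * K) * (`|t| ^+ 3 + t ^+ 2 * `|s|).
Proof.
move=> t1; rewrite joint_cf0.
have i2 : cintegrable P (fun w => expi (s * A w)).
  by apply: cintegrable_expi; exact: measurable_funM.
have [i5 e5] := Cquad t.
have ce : (joint_cf s t + joint_cf s (- t)) / 2 =
    Cexpectation P (fun w => expi (s * A w) * (cos (t * B w))%:C).
  rewrite mulrC -CexpD// -CexpZ; last exact: cintegrableD.
  apply: eq_Cexp => w; rewrite mulNr !expiD /expi cosN sinN.
  move: (cos (s * A w)) (sin (s * A w)) (cos (t * B w)) (sin (t * B w)) => x y x' y'.
  rewrite -mulrDr mulrCA; congr (_ * _); apply/eqP; rewrite eq_complex/=.
  by apply/andP; split; apply/eqP; field.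
have i1 : cintegrable P (fun w => expi (s * A w) * (cos (t * B w))%:C).
  apply: (@cintegrable_bounded _ _ _ _ 1) => [|w].
    apply: cmeasurableM; first exact: (cintegrable_measurable i2).
    split; last exact: measurable_cst.
    have mtB : measurable_fun setT (fun w => t * B w) by exact: measurable_funM.
    exact: (cmeasurable_expi mtB).1.
  by rewrite cnormM cnorm_expi mul1r cnorm_real ler_norml cos_geN1 cos_le1.
have i12 := cintegrableB i1 (cintegrableZ (gauss t)%:C i2).
have i := cintegrableD i12 i5.
rewrite ce -CexpZ// -CexpB//; last exact: cintegrableZ.
rewrite -[X in cnorm X]addr0 -[X in _ + X]e5 -CexpD//.
set M := (3 + b2 + b2 ^+ 2) * (`|t| ^+ 3 + t ^+ 2 * `|s|).
have M0 : 0 <= M.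
  apply: mulr_ge0; first by rewrite ?addr_ge0 ?sqr_ge0.
  by apply: addr_ge0; [exact: exprn_ge0|rewrite mulr_ge0 ?sqr_ge0].
apply: (@le_trans _ _ (mean P (fun w => M * dom w))).
  apply: cnorm_Cexp_le i (rintegrableZ M idom) _ => w.
  have := @expi_expansion2 R s t (A w) (B w) b2 t1 b20.
  by rewrite rmorphB/= mulrBr (mulrC (gauss t)%:C).
rewrite meanZ// [leRHS](_ : _ = M * (1 + 2 * K)); last by rewrite /M; ring.
exact: ler_wpM2l.
Qed.

(** The decay on the slice [t = 0] extends to a strip. If [x] is the full quadratic exponent,
    bounded by [X0] because [pi^2 <= 16], then [exp(- x) <= 1 / (1 + x) <= 1 - x / (1 + X0)], a gain
    of at least [delta * q]. For [|t| <= delta / (2 * C1)] the expansion error takes at most half of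
    it. *)
Lemma joint_cf_decay (bl bu kappa : R) : 0 < bl -> bl <= b2 -> b2 <= bu -> 0 < kappa ->
  (forall s, - pi <= s <= pi -> cnorm (joint_cf s 0) <= 1 - kappa * s ^+ 2) ->
  let C1 := (3 + bu + bu ^+ 2) * (1 + 2 * K) in
  let delta := Num.min (bl / 2) kappa / (1 + (bu / 2 + 16 * kappa)) in
  forall s t, - pi <= s <= pi -> `|t| <= Num.min 1 (delta / (2 * C1)) ->
  let e := expR (- (delta / 2 * (s ^+ 2 + t ^+ 2))) in
  cnorm (joint_cf s t) <= e /\ cnorm ((gauss t)%:C * joint_cf s 0) <= e.
Proof.
move=> bl0 blb bbu k0 hk C1 delta s t sp; rewrite le_min => /andP[t1 tC] e.
have C10 : 0 < C1.
  by rewrite /C1; have := sqr_ge0 bu; have := K0; have := bl0; nra.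
set X0 := bu / 2 + 16 * kappa in delta e tC *.
have X00 : 0 < 1 + X0 by rewrite /X0; lra.
set m := Num.min _ _ in delta e tC *.
have m0 : 0 < m by rewrite lt_min k0 andbT; lra.
have d0 : 0 < delta by rewrite divr_gt0.
set q := s ^+ 2 + t ^+ 2.
have q0 : 0 <= q by rewrite addr_ge0 ?sqr_ge0.
pose x := b2 * t ^+ 2 / 2 + kappa * s ^+ 2.
have s16 : s ^+ 2 <= 16.
  have := @pihalf_lt2 R; have := @pi_gt0 R; move: sp; nra.
have t21 : t ^+ 2 <= 1 by rewrite -(real_normK (num_real t)) exprn_ile1.
have xX : x <= X0.
  rewrite /x /X0; apply: lerD; last by rewrite mulrC ler_wpM2r// ltW.
  by rewrite ler_wpM2r//; apply: le_trans bbu; rewrite ler_piMr.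
have x0 : 0 <= x.
  by apply: addr_ge0; rewrite ?divr_ge0// mulr_ge0 ?sqr_ge0// ltW.
have mx : m * q <= x.
  rewrite /x /q mulrDr addrC; apply: lerD.
    rewrite mulrAC ler_wpM2r ?sqr_ge0//; apply: (@le_trans _ _ (bl / 2)).
      by rewrite ge_min lexx.
    by rewrite ler_wpM2r.
  by rewrite ler_wpM2r ?sqr_ge0// ge_min lexx orbT.
have g : cnorm ((gauss t)%:C * joint_cf s 0) <= expR (- x).
  rewrite cnormM cnorm_real gtr0_norm ?expR_gt0// opprD expRD ler_wpM2l ?expR_ge0//.
  apply: le_trans (hk _ sp) _; have := expR_ge1Dx (- (kappa * s ^+ 2)); lra.
have ex : expR (- x) <= 1 - delta * q.
  apply: le_trans (expRN_le_inv x0) _.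
  rewrite -div1r ler_pdivrMr; last by rewrite ltr_pwDl.
  have dq : delta * q <= x / (1 + X0).
    by rewrite mulrAC ler_wpM2r// invr_ge0 ltW.
  have : x / (1 + X0) * (1 + x) <= x.
    by rewrite mulrAC ler_pdivrMr// ler_wpM2l// lerD2l.
  have : delta * q * (1 + x) <= x / (1 + X0) * (1 + x) by rewrite ler_wpM2r//; lra.
  lra.
have ee : 1 - delta / 2 * q <= e by exact: (expR_ge1Dx (- (delta / 2 * q))).
have dq0 : 0 <= delta * q by rewrite mulr_ge0// ltW.
split; last by apply: le_trans g _; apply: le_trans ex _; lra.
have := joint_cf_expansion s t1; rewrite -/q => h1.
have : cnorm (joint_cf s t) <= cnorm (joint_cf s t - (gauss t)%:C * joint_cf s 0) +
   cnorm ((gauss t)%:C * joint_cf s 0).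
  by apply: le_trans (cnormD _ _); rewrite subrK.
have : (3 + b2 + b2 ^+ 2) * (1 + 2 * K) * (`|t| * q) <= delta / 2 * q.
  rewrite mulrA ler_wpM2r//.
  have CC : (3 + b2 + b2 ^+ 2) * (1 + 2 * K) <= C1.
    rewrite ler_wpM2r//; first by have := K0; lra.
    by rewrite lerD ?lerD// lerXn2r// nnegrE (le_trans b20).
  apply: (@le_trans _ _ (C1 * `|t|)); first by rewrite ler_wpM2r.
  have aux (c u : R) : 0 < c -> c * (u / (2 * c)) = u / 2.
    by move=> c0; field; rewrite gt_eqF.
  by rewrite -(aux C1 delta C10) ler_pM2l.
move: g ex h1 ee; lra.
Qed.

End charfun_estimates.

(** * Powers of characteristic functions *)

Section power_estimates.
Context {R : realType}.
Implicit Types (k q t s : R) (z u : R[i]).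

(** 17 bounds [s^2 + t^2] for [|s| <= pi] and [|t| <= 1], so that passing from [N - 1] to [N] in the
    exponent costs a constant. *)
Lemma expRN_pow_pred k q (N : nat) : (0 < N)%N -> 0 <= k -> q <= 17 ->
  expR (- (k * q)) ^+ N.-1 <= expR (17 * k) * expR (- (k * N%:R * q)).
Proof.
case: N => // n _ k0 q17.
rewrite /= -expRM_natl -expRD ler_expR.
have := ler_wpM2l k0 q17; rewrite -natr1; lra.
Qed.

Lemma expRN_pow_pred2 k q (N : nat) : (1 < N)%N -> 0 <= k -> q <= 17 ->
  expR (- (k * q)) ^+ N.-2 <= expR (34 * k) * expR (- (k * N%:R * q)).
Proof.
case: N => [|[|n]]// _ k0 q17.
rewrite /= -expRM_natl -expRD ler_expR.
have := ler_wpM2l k0 q17; rewrite -[n.+2%:R]natr1 -natr1; lra.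
Qed.

(** Telescoping contributes [N e q]; half of the exponent [k N q] absorbs [N q], which makes the
    bound uniform in [N]. *)
Lemma cnorm_subX_decay k q (e : R) (N : nat) z u : (0 < N)%N -> 0 < k -> 0 <= q -> q <= 17 ->
  0 <= e -> cnorm z <= expR (- (k * q)) -> cnorm u <= expR (- (k * q)) ->
  cnorm (z - u) <= e * q ->
  cnorm (z ^+ N - u ^+ N) <= e * (expR (17 * k) * (2 / k)) * expR (- (k * N%:R * q / 2)).
Proof.
move=> N0 k0 q0 q17 e0 hz hu hzu.
apply: le_trans (cnorm_subX N hz hu) _.
have h1 := expRN_pow_pred N0 (ltW k0) q17.
have h2 := @mul_expRN_le R k (N%:R * q) k0; rewrite mulrA in h2.
have Nq : N%:R * cnorm (z - u) <= e * (N%:R * q).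
  by rewrite mulrCA ler_wpM2l.
apply: le_trans (ler_pM _ _ Nq h1) _; rewrite ?mulr_ge0 ?exprn_ge0 ?expR_ge0 ?cnorm_ge0//.
have -> : e * (N%:R * q) * (expR (17 * k) * expR (- (k * N%:R * q))) =
  e * (expR (17 * k) * (N%:R * q * expR (- (k * N%:R * q)))) by ring.
by rewrite -!mulrA; apply: ler_wpM2l => //; apply: ler_wpM2l; rewrite ?expR_ge0// !mulrA in h2 *.
Qed.

Lemma sqr_mul_expRN_le k x : 0 < k -> 0 <= x -> x ^+ 2 * expR (- (k * x)) <= 8 / k ^+ 2.
Proof.
move=> k0 x0; have h1 := mul_expRN_le x k0.
have k20 : 0 < k / 2 by rewrite divr_gt0.
have h2 := mul_expRN_le x k20.
rewrite expr2 -mulrA; apply: le_trans (ler_wpM2l x0 h1) _.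
rewrite mulrCA (mulrAC k x); apply: le_trans (ler_wpM2l _ h2) _; first by rewrite divr_ge0// ltW.
have e1 : expR (- (k / 2 * x / 2)) <= 1.
  rewrite -[leRHS]expR0 ler_expR oppr_le0 divr_ge0// mulr_ge0// ltW//.
rewrite mulrA; apply: le_trans (ler_wpM2l _ e1) _.
  by rewrite mulr_ge0// divr_ge0// ltW.
by rewrite mulr1; apply: eq_ler; field; rewrite gt_eqF.
Qed.

Lemma sqrtN_mul_le (n s : R) : 0 <= n -> Num.sqrt n * `|s| <= 1 + n * s ^+ 2.
Proof.
move=> n0; have := sqr_sqrtr n0; have := real_normK (num_real s); move=> <- en.
rewrite -[X in _ <= 1 + X * _]en; have := sqr_ge0 (Num.sqrt n * `|s| - 1).
have := sqr_ge0 (Num.sqrt n * `|s|); rewrite sqrrB exprMn; lra.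
Qed.

(** The exponential absorbs one factor [sqrt N |s|]; the other [sqrt N] will cancel with the average
    of the Gaussian over [-pi, pi]. *)
Lemma natr_mul_expRN_le k s (N : nat) : 0 < k ->
  N%:R * `|s| * expR (- (k * N%:R * s ^+ 2)) <=
  Num.sqrt N%:R * (1 + 2 / k) * expR (- (k * N%:R * s ^+ 2 / 2)).
Proof.
move=> k0; have n0 : 0 <= N%:R :> R by [].
have h := @mul_expRN_le R k (N%:R * s ^+ 2) k0; rewrite mulrA in h.
have -> : N%:R * `|s| = Num.sqrt N%:R * (Num.sqrt N%:R * `|s|) by rewrite mulrA -expr2 sqr_sqrtr.
rewrite -[leLHS]mulrA -[leRHS]mulrA; apply: ler_wpM2l; first exact: sqrtr_ge0.
apply: (@le_trans _ _ ((1 + N%:R * s ^+ 2) * expR (- (k * N%:R * s ^+ 2)))).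
  by apply: ler_wpM2r; [exact: expR_ge0|exact: sqrtN_mul_le].
rewrite [leLHS]mulrDl [leRHS]mulrDl !mul1r; apply: lerD => //.
rewrite ler_expR lerN2; have : 0 <= k * N%:R * s ^+ 2 by rewrite mulr_ge0 ?sqr_ge0// mulr_ge0// ltW.
lra.
Qed.

(** Expansion around [u] to second order at both points: the linear terms combine into the even
    error [f], and the quadratic remainders are O((N e q)^2) times an exponential that absorbs
    [(N q)^2]. *)
Lemma cnorm_addX_decay k q (e f : R) (N : nat) z z' u : (0 < N)%N -> 0 < k -> 0 <= q -> q <= 17 ->
  0 <= e -> 0 <= f ->
  cnorm z <= expR (- (k * q)) -> cnorm z' <= expR (- (k * q)) -> cnorm u <= expR (- (k * q)) ->
  cnorm (z - u) <= e * q -> cnorm (z' - u) <= e * q -> cnorm ((z + z') / 2 - u) <= f ->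
  cnorm ((z ^+ N + z' ^+ N) / 2 - u ^+ N) <=
  e ^+ 2 * (expR (34 * k) * (8 / k ^+ 2)) + f * (expR (17 * k) * (N%:R * expR (- (k * N%:R * q)))).
Proof.
move=> N0 k0 q0 q17 e0 f0 hz hz' hu hzu hzu' hf.
have half (y y' : R[i]) : cnorm ((y + y') / 2) = cnorm (y + y') / 2.
  have -> : (2 : R[i])^-1 = (2^-1)%:C by rewrite -[2 in LHS](rmorph_nat (real_complex R)) fmorphV.
  by rewrite cnormM cnorm_real ger0_norm.
have -> : (z ^+ N + z' ^+ N) / 2 - u ^+ N =
   ((z ^+ N - u ^+ N - N%:R * (z - u) * u ^+ N.-1) + (z' ^+ N - u ^+ N - N%:R * (z' - u) * u ^+ N.-1)) / 2
   + N%:R * ((z + z') / 2 - u) * u ^+ N.-1 by field.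
have rem (y : R[i]) : cnorm y <= expR (- (k * q)) -> cnorm (y - u) <= e * q ->
    cnorm (y ^+ N - u ^+ N - N%:R * (y - u) * u ^+ N.-1) <= e ^+ 2 * (expR (34 * k) * (8 / k ^+ 2)).
  move=> hy hyu; apply: le_trans (cnorm_subX2 N hy hu) _.
  have r0 : 0 <= e ^+ 2 * (expR (34 * k) * (8 / k ^+ 2)).
    by rewrite mulr_ge0 ?sqr_ge0// mulr_ge0 ?expR_ge0// divr_ge0// sqr_ge0.
  (* For [N = 1] the remainder is 0; the passage from [N - 2] to [N] asks for [N > 1]. *)
  have [N1|N1] := leqP N 1.
    have -> : N = 1%N by apply/eqP; rewrite eqn_leq N1.
    by rewrite [(1 * 1.-1)%N]/= !mul0r.
  have h1 := expRN_pow_pred2 N1 (ltW k0) q17.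
  have h2 := @sqr_mul_expRN_le k (N%:R * q) k0; rewrite mulr_ge0// in h2; have {}h2 := h2 isT.
  have h3 : (N * N.-1)%:R * cnorm (y - u) ^+ 2 <= N%:R ^+ 2 * (e * q) ^+ 2.
    apply: ler_pM; rewrite ?sqr_ge0//; first by rewrite -natrX ler_nat -mulnn leq_mul2l leq_pred orbT.
    by rewrite lerXn2r// nnegrE ?cnorm_ge0// mulr_ge0.
  apply: le_trans (ler_pM _ _ h3 h1) _; rewrite ?mulr_ge0 ?exprn_ge0 ?expR_ge0 ?sqr_ge0 ?cnorm_ge0//.
  have -> : N%:R ^+ 2 * (e * q) ^+ 2 * (expR (34 * k) * expR (- (k * N%:R * q))) =
    e ^+ 2 * (expR (34 * k) * ((N%:R * q) ^+ 2 * expR (- (k * (N%:R * q))))).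
    by rewrite -[k * N%:R * q]mulrA; ring.
  by rewrite ler_wpM2l ?sqr_ge0// ler_wpM2l ?expR_ge0.
apply: le_trans (cnormD _ _) _; apply: lerD.
  rewrite half; apply: (@le_trans _ _ ((e ^+ 2 * (expR (34 * k) * (8 / k ^+ 2)) + e ^+ 2 * (expR (34 * k) * (8 / k ^+ 2))) / 2)).
    rewrite ler_pM2r ?invr_gt0//; apply: le_trans (cnormD _ _) _.
    by apply: lerD; exact: rem.
  by lra.
rewrite !cnormM cnormX.
have -> : cnorm (N%:R : R[i]) = N%:R.
  by rewrite -(rmorph_nat (real_complex R)) cnorm_real ger0_norm.
have h1 := expRN_pow_pred N0 (ltW k0) q17.
have h2 : cnorm u ^+ N.-1 <= expR (17 * k) * expR (- (k * N%:R * q)).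
  by apply: le_trans h1; rewrite lerXn2r ?nnegrE ?cnorm_ge0 ?expR_ge0.
have -> : f * (expR (17 * k) * (N%:R * expR (- (k * N%:R * q)))) =
   N%:R * f * (expR (17 * k) * expR (- (k * N%:R * q))) by ring.
by apply: ler_pM => //; rewrite ?mulr_ge0 ?cnorm_ge0 ?exprn_ge0 ?cnorm_ge0// ler_wpM2l.
Qed.

End power_estimates.

(** * Fourier integrals restricted to the lattice event *)

Section numerators.
Context {R : realType} {d : measure_display} {T : measurableType d}.
Context (P : probability T R) (SA SB : T -> R) (m : R) (N : nat) (phi : R -> R -> R[i]).
Context (mSA : measurable_fun setT SA) (mSB : measurable_fun setT SB).
Context (lattice : {ae P, forall w, SA w - m \is a Num.int}) (N0 : (0 < N)%N).
Context (phi_sum : forall s t, Cexpectation P (fun w => expi (s * SA w + t * SB w)) = phi s t ^+ N).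

(** Divided by its value at [t = 0], this is the characteristic function of [SB] conditioned on
    [SA = m]. *)
Definition numerator (t : R) : R[i] :=
  Cexpectation P (fun w => (\1_[set w | SA w - m = 0] w)%:C * expi (t * SB w)).

Local Notation ltNpi := (ltNM (@pi_gt0 R)).

Let integrand (t s : R) : R[i] := expi (- (s * m)) * phi s t ^+ N.

Let cf_shift (s t : R) :
  Cexpectation P (fun w => expi (s * (SA w - m) + t * SB w)) = integrand t s.
Proof.
rewrite /integrand -phi_sum -CexpZ; last first.
  by apply: cintegrable_expi; apply: measurable_funD; exact: measurable_funM.
by apply: eq_Cexp => w; rewrite -expiD; congr expi; ring.
Qed.

Lemma numerator_inversion t : numerator t = Cpi_mean (integrand t).
Proof.
have mV : measurable_fun setT (fun w => SA w - m) by exact: measurable_funB.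
have mT : measurable_fun setT (fun w => t * SB w) by exact: measurable_funM.
rewrite /numerator -(Cpi_mean_inversion mV mT lattice).
by apply: eq_Cexp => s; rewrite cf_shift.
Qed.

Lemma cintegrable_integrand t :
  cintegrable (uniform_prob ltNpi) (fun s => integrand t (clip (- pi) pi s)).
Proof.
have mV : measurable_fun setT (fun w => SA w - m) by exact: measurable_funB.
have mT : measurable_fun setT (fun w => t * SB w) by exact: measurable_funM.
have h := cintegrable_Cpi P mV mT.
by under eq_fun do rewrite -cf_shift.
Qed.

Context (b2 C1 k eta : R) (C10 : 0 <= C1) (k0 : 0 < k) (eta1 : eta <= 1).
Let gauss t : R := expR (- (b2 * t ^+ 2 / 2)).
Context (phi_expansion : forall s t, - pi <= s <= pi -> `|t| <= eta ->
  cnorm (phi s t - (gauss t)%:C * phi s 0) <= C1 * (`|t| * (s ^+ 2 + t ^+ 2))).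
Context (phi_even_expansion : forall s t, - pi <= s <= pi -> `|t| <= eta ->
  cnorm ((phi s t + phi s (- t)) / 2 - (gauss t)%:C * phi s 0) <= C1 * (`|t| ^+ 3 + t ^+ 2 * `|s|)).
Context (phi_decay : forall s t, - pi <= s <= pi -> `|t| <= eta ->
  cnorm (phi s t) <= expR (- (k * (s ^+ 2 + t ^+ 2))) /\
  cnorm ((gauss t)%:C * phi s 0) <= expR (- (k * (s ^+ 2 + t ^+ 2)))).

Let itv_pi (s : R) : - pi <= clip (- pi) pi s <= pi.
Proof. by have /andP[h1 h2] := clip_itv ltNpi s; rewrite (ltW h1). Qed.

Let q17 (s t : R) : - pi <= s <= pi -> `|t| <= eta -> s ^+ 2 + t ^+ 2 <= 17.
Proof.
move=> sp te.
have s16 : s ^+ 2 <= 16.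
  by have := @pihalf_lt2 R; have := @pi_gt0 R; move: sp; nra.
have : t ^+ 2 <= 1 by rewrite -(real_normK (num_real t)) exprn_ile1// (le_trans te).
lra.
Qed.

Let pi_gauss_le : unif_mean ltNpi (fun s => expR (- (k / 2 * N%:R * s ^+ 2))) <=
  2 / pi / Num.sqrt (k / 2) / Num.sqrt N%:R.
Proof.
have kN : 0 < k / 2 * N%:R by rewrite mulr_gt0 ?divr_gt0// ltr0n.
have := unif_mean_gauss_le ltNpi kN.
rewrite sqrtrM ?divr_ge0 ?(ltW k0)// => /le_trans; apply.
have p0 := @pi_gt0 R.
have s1 : 0 < Num.sqrt (k / 2) by rewrite sqrtr_gt0 divr_gt0.
have s2 : 0 < Num.sqrt N%:R :> R by rewrite sqrtr_gt0 ltr0n.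
rewrite opprK -mulr2n; move: p0 s1 s2; move: (pi : R) (Num.sqrt _) (Num.sqrt _) => p x y p0 x0 y0.
rewrite -mulr_natr; apply: eq_ler; field.
by rewrite !gt_eqF.
Qed.

Let gauss_pow_cint t : cintegrable (uniform_prob ltNpi)
  (fun s => (gauss t)%:C ^+ N * integrand 0 (clip (- pi) pi s)).
Proof. exact/cintegrableZ/cintegrable_integrand. Qed.

(** The Gaussian factor does not depend on [s], so it leaves the integral and [numerator 0] stays
    exact. The integrand of the difference keeps [exp(- k N s^2 / 2)], whose average supplies
    [1 / sqrt N]. *)
Lemma numerator_expansion t : `|t| <= eta ->
  cnorm (numerator t - (gauss t)%:C ^+ N * numerator 0) <=
  C1 * (expR (17 * k) * (2 / k)) * (2 / pi / Num.sqrt (k / 2)) * `|t| * expR (- (k / 2 * N%:R * t ^+ 2))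
   / Num.sqrt N%:R.
Proof.
move=> te; rewrite !numerator_inversion /Cpi_mean.
have i0 := cintegrable_integrand 0; have i1 := cintegrable_integrand t.
rewrite -CexpZ// -CexpB//.
pose M := C1 * `|t| * (expR (17 * k) * (2 / k)) * expR (- (k / 2 * N%:R * t ^+ 2)).
have M0 : 0 <= M.
  by rewrite /M !mulr_ge0 ?expR_ge0 ?invr_ge0 ?(ltW k0).
have kN : 0 < k / 2 * N%:R by rewrite mulr_gt0 ?divr_gt0// ltr0n.
have ig := unif_mean_gauss_int ltNpi kN.
apply: (@le_trans _ _ (mean (uniform_prob ltNpi)
    (fun s => M * expR (- (k / 2 * N%:R * clip (- pi) pi s ^+ 2))))).
  apply: cnorm_Cexp_le; [exact: cintegrableB|exact: rintegrableZ|].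
  move=> s0; move: (clip _ _ s0) (itv_pi s0) => s sp {s0}.
  have -> : integrand t s - (gauss t)%:C ^+ N * integrand 0 s =
     expi (- (s * m)) * (phi s t ^+ N - ((gauss t)%:C * phi s 0) ^+ N).
    by rewrite /integrand exprMn; ring.
  rewrite cnormM cnorm_expi mul1r.
  have [d1 d2] := phi_decay sp te.
  have := @cnorm_subX_decay R k (s ^+ 2 + t ^+ 2) (C1 * `|t|) N _ _ N0 k0 _ (q17 sp te) _ d1 d2.
  rewrite addr_ge0 ?sqr_ge0// mulr_ge0// => /(_ isT isT); rewrite -mulrA => /(_ (phi_expansion sp te)).
  have -> : expR (- (k * N%:R * (s ^+ 2 + t ^+ 2) / 2)) =
      expR (- (k / 2 * N%:R * t ^+ 2)) * expR (- (k / 2 * N%:R * s ^+ 2)).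
    by rewrite -expRD; congr expR; field.
  move=> /le_trans; apply; apply: eq_ler.
  by rewrite /M; ring.
rewrite meanZ//; apply: le_trans (ler_wpM2l M0 pi_gauss_le) _.
by apply: eq_ler; rewrite /M; ring.
Qed.

Lemma numerator_even_expansion t : `|t| <= eta ->
  cnorm ((numerator t + numerator (- t)) / 2 - (gauss t)%:C ^+ N * numerator 0) <=
  (C1 ^+ 2 * (expR (34 * k) * (8 / k ^+ 2)) +
   C1 * expR (17 * k) * (1 + 2 / k) * (2 / pi / Num.sqrt (k / 2))) * t ^+ 2
  + C1 * expR (17 * k) * N%:R * `|t| ^+ 3.
Proof.
move=> te; have te' : `|- t| <= eta by rewrite normrN.
rewrite !numerator_inversion /Cpi_mean.
have i0 := cintegrable_integrand 0; have i1 := cintegrable_integrand t.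
have i2 := cintegrable_integrand (- t).
have i12 := cintegrableD i1 i2.
rewrite -(CexpD i1 i2) [_ / 2]mulrC -(CexpZ 2^-1 i12).
rewrite -CexpZ// -CexpB//; last by apply: cintegrableZ; exact: cintegrableD.
(* [a] collects what is bounded uniformly in [s], including a cubic term that still carries [N]; [b]
   carries [sqrt N], which the Gaussian average cancels. *)
pose a := C1 ^+ 2 * t ^+ 2 * (expR (34 * k) * (8 / k ^+ 2)) + C1 * expR (17 * k) * N%:R * `|t| ^+ 3.
pose b := C1 * expR (17 * k) * t ^+ 2 * (Num.sqrt N%:R * (1 + 2 / k)).
have b0 : 0 <= b.
  have h : 0 <= 1 + 2 / k by rewrite addr_ge0// divr_ge0// ltW.
  apply: mulr_ge0; last by rewrite mulr_ge0 ?sqrtr_ge0.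
  by rewrite mulr_ge0 ?sqr_ge0// mulr_ge0 ?expR_ge0.
have kN : 0 < k / 2 * N%:R by rewrite mulr_gt0 ?divr_gt0// ltr0n.
have ig := unif_mean_gauss_int ltNpi kN.
have iag : rintegrable (uniform_prob ltNpi)
    (fun s => a + b * expR (- (k / 2 * N%:R * clip (- pi) pi s ^+ 2))).
  by apply: rintegrableD; [exact: rintegrable_cst|exact: rintegrableZ].
apply: (@le_trans _ _ (mean (uniform_prob ltNpi)
    (fun s => a + b * expR (- (k / 2 * N%:R * clip (- pi) pi s ^+ 2))))).
  apply: cnorm_Cexp_le => //.
    by apply: cintegrableB => //; apply: cintegrableZ; exact: cintegrableD.
  move=> s0; move: (clip _ _ s0) (itv_pi s0) => s sp {s0}.
  have -> : 2^-1 * (integrand t s + integrand (- t) s) - (gauss t)%:C ^+ N * integrand 0 s =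
     expi (- (s * m)) * ((phi s t ^+ N + phi s (- t) ^+ N) / 2 - ((gauss t)%:C * phi s 0) ^+ N).
    by rewrite /integrand exprMn; ring.
  rewrite cnormM cnorm_expi mul1r.
  have [d1 d2] := phi_decay sp te; have [d3 _] := phi_decay sp te'; rewrite sqrrN in d3.
  set q := s ^+ 2 + t ^+ 2 in d1 d2 d3.
  have q0 : 0 <= q by rewrite addr_ge0 ?sqr_ge0.
  have e1 : cnorm (phi s t - (gauss t)%:C * phi s 0) <= C1 * `|t| * q.
    by rewrite -mulrA; exact: phi_expansion.
  have e2 : cnorm (phi s (- t) - (gauss t)%:C * phi s 0) <= C1 * `|t| * q.
    by have := phi_expansion sp te'; rewrite /gauss normrN !sqrrN [C1 * (_ * _)]mulrA.
  have e3 := phi_even_expansion sp te.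
  have h := @cnorm_addX_decay R k q (C1 * `|t|) _ N _ _ _ N0 k0 q0 (q17 sp te) _ _ d1 d3 d2 e1 e2 e3.
  have g1 : 0 <= C1 * `|t| by rewrite mulr_ge0.
  have t2s : 0 <= t ^+ 2 * `|s| by rewrite mulr_ge0 ?sqr_ge0.
  have g2 : 0 <= C1 * (`|t| ^+ 3 + t ^+ 2 * `|s|) by rewrite mulr_ge0// addr_ge0// exprn_ge0.
  apply: le_trans (h g1 g2) _.
  rewrite exprMn (real_normK (num_real t)) /a -addrA lerD2l.
  have n0 : 0 <= N%:R :> R by [].
  have f1 : expR (- (k * N%:R * q)) <= 1.
    by rewrite -[leRHS]expR0 ler_expR oppr_le0 mulr_ge0 ?mulr_ge0 ?(ltW k0).
  have f2 : expR (- (k * N%:R * q)) <= expR (- (k * N%:R * s ^+ 2)).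
    rewrite ler_expR lerN2 ler_wpM2l ?mulr_ge0 ?(ltW k0)//.
    by rewrite /q lerDl sqr_ge0.
  have f3 := @natr_mul_expRN_le R k s N k0.
  have -> : C1 * (`|t| ^+ 3 + t ^+ 2 * `|s|) * (expR (17 * k) * (N%:R * expR (- (k * N%:R * q)))) =
     C1 * expR (17 * k) * N%:R * `|t| ^+ 3 * expR (- (k * N%:R * q)) +
     C1 * expR (17 * k) * t ^+ 2 * (N%:R * `|s| * expR (- (k * N%:R * q))) by ring.
  apply: lerD.
    by rewrite ler_piMr// mulr_ge0 ?exprn_ge0// mulr_ge0// mulr_ge0 ?expR_ge0.
  have -> : k / 2 * N%:R * s ^+ 2 = k * N%:R * s ^+ 2 / 2 by ring.
  rewrite /b -[leRHS]mulrA; apply: ler_wpM2l.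
    by rewrite mulr_ge0 ?sqr_ge0// mulr_ge0 ?expR_ge0.
  by apply: le_trans f3; apply: ler_wpM2l => //; rewrite mulr_ge0.
rewrite meanD//; [|exact: rintegrable_cst|exact: rintegrableZ].
rewrite mean_cst meanZ//; apply: le_trans (lerD (lexx _) (ler_wpM2l b0 pi_gauss_le)) _.
have s2 : 0 < Num.sqrt N%:R :> R by rewrite sqrtr_gt0 ltr0n.
apply: eq_ler; rewrite /a /b.
move: (2 / pi / Num.sqrt (k / 2)) (expR _) (expR _) (8 / _) (2 / k) => x1 x2 x3 x4 x5.
by field; rewrite gt_eqF.
Qed.

End numerators.

(** * From characteristic functions to moments and Kolmogorov distance *)

Section normal_approximation.
Context {R : realType}.

Lemma ler_add_small (x y c h0 : R) : 0 < h0 -> 0 <= c ->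
  (forall h, 0 < h -> h <= h0 -> x <= y + h * c) -> x <= y.
Proof.
move=> h00 c0 hx; apply/ler_addgt0Pr => e e0.
have c1 : 0 < c + 1 by rewrite ltr_wpDl.
pose h := Num.min h0 (e / (c + 1)).
have hh : 0 < h by rewrite lt_min h00 divr_gt0.
apply: le_trans (hx h hh _) _; first by rewrite ge_min lexx.
rewrite lerD2l; apply: (@le_trans _ _ (e / (c + 1) * (c + 1))); last by rewrite divfK// gt_eqF.
apply: ler_pM => //; rewrite ?(ltW hh)//; last by rewrite lerDl.
by rewrite ge_min lexx orbT.
Qed.

Context {d : measure_display} {T : measurableType d} (P : probability T R) (W : T -> R).
Context (mW : measurable_fun setT W) (W3 : rintegrable P (fun w => `|W w| ^+ 3)).
Context (n b2 eta k D D3 : R) (n1 : 1 <= n) (b20 : 0 < b2) (eta0 : 0 < eta) (eta1 : eta <= 1).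
Context (k0 : 0 < k) (D0 : 0 <= D) (D30 : 0 <= D3).
Let gauss (t : R) : R := expR (- (n * b2 * t ^+ 2 / 2)).
Context (charfun_approx : forall t, `|t| <= eta ->
  cnorm (charfun P W t - (gauss t)%:C) <= D * `|t| * expR (- (k * n * t ^+ 2))).
Context (charfun_even_approx : forall t, `|t| <= eta ->
  cnorm ((charfun P W t + charfun P W (- t)) / 2 - (gauss t)%:C) <=
  D * Num.sqrt n * t ^+ 2 + D3 * `|t| ^+ 3).

Let n0 : 0 < n. Proof. exact: lt_le_trans n1. Qed.

Let iW := rintegrable_of_cube mW W3.

Let iW2 := rintegrable_sqr_of_cube mW W3.

Let M2 := mean P (fun w => W w ^+ 2).
Let M3 := mean P (fun w => `|W w| ^+ 3).
Let M20 : 0 <= M2. Proof. by apply: mean_ge0 => w; exact: sqr_ge0. Qed.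
Let M30 : 0 <= M3. Proof. by apply: mean_ge0 => w; exact: exprn_ge0. Qed.

Let mt (t : R) : measurable_fun setT (fun w => t * W w).
Proof. exact: measurable_funM. Qed.

(** The Gaussian is real, so the imaginary part of the characteristic function, [t E[W] + O(t^2)],
    is at most [D t]; division by [t] and passage to the limit give the bound. *)
Lemma normr_mean_le_charfun : `|mean P W| <= D.
Proof.
apply: (ler_add_small eta0 (divr_ge0 M20 (ler0n _ 2))) => t t0 te.
have te' : `|t| <= eta by rewrite gtr0_norm.
have isin : rintegrable P (fun w => sin (t * W w)) by exact: (cintegrable_expi P (mt t)).2.
have e1 : `|mean P (fun w => sin (t * W w) - t * W w)| <= t ^+ 2 / 2 * M2.
  rewrite -meanZ//; apply: normr_mean_le; [|exact: rintegrableZ|].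
    by apply: rintegrableB => //; exact: rintegrableZ.
  by move=> w; apply: le_trans (normr_sin_sub_le _) _; rewrite exprMn mulrAC.
have e2 : `|mean P (fun w => sin (t * W w))| <= D * t.
  have := normr_Im_le (charfun P W t - (gauss t)%:C); rewrite /= subr0.
  move=> /le_trans; apply; apply: le_trans (charfun_approx te') _.
  rewrite gtr0_norm// ler_piMr ?mulr_ge0 ?(ltW t0)// -[leRHS]expR0 ler_expR oppr_le0.
  by rewrite mulr_ge0 ?sqr_ge0// mulr_ge0// ltW.
rewrite meanB ?meanZ// in e1; last exact: rintegrableZ.
rewrite -(ler_pM2l t0) -[X in X * `|_|](gtr0_norm t0) -normrM.
have -> : t * (D + t * (M2 / 2)) = D * t + t ^+ 2 / 2 * M2 by ring.
by move: e1 e2; rewrite !ler_norml; lra.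
Qed.

(** Real parts in the even bound, divided by [t^2 / 2] as [t] tends to 0. [D3], [M3] and [n^2 b2^2]
    occur only in the vanishing term, so they need no bound uniform in [n]. *)
Lemma normr_mean_sqr_le_charfun : `|M2 - n * b2| <= 2 * D * Num.sqrt n.
Proof.
pose c := 2 * D3 + M3 / 3 + n ^+ 2 * b2 ^+ 2 / 4.
have c0 : 0 <= c.
  have h1 : 0 <= n ^+ 2 * b2 ^+ 2 by rewrite mulr_ge0 ?sqr_ge0.
  by rewrite /c; have := M30; have := D30; lra.
apply: (ler_add_small eta0 c0) => t t0 te.
have te' : `|t| <= eta by rewrite gtr0_norm.
have icos : rintegrable P (fun w => cos (t * W w)) by exact: (cintegrable_expi P (mt t)).1.
have icos1 : rintegrable P (fun w => cos (t * W w) - 1).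
  by apply: rintegrableB => //; exact: rintegrable_cst.
have iq : rintegrable P (fun w => t ^+ 2 / 2 * W w ^+ 2) by exact: rintegrableZ.
have e1 : `|mean P (fun w => cos (t * W w) - 1 + t ^+ 2 / 2 * W w ^+ 2)| <= t ^+ 3 / 6 * M3.
  rewrite -meanZ//; apply: normr_mean_le; [exact: rintegrableD|exact: rintegrableZ|].
  move=> w; have := normr_cos_sub_le3 (t * W w).
  by rewrite normrM (gtr0_norm t0) !exprMn !(mulrAC _ _ ^-1).
rewrite meanD// meanB// ?mean_cst ?meanZ// in e1; last exact: rintegrable_cst.
have e2 : `|mean P (fun w => cos (t * W w)) - gauss t| <= D * Num.sqrt n * t ^+ 2 + D3 * t ^+ 3.
  have := charfun_even_approx te'; rewrite (gtr0_norm t0); apply: le_trans.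
  apply: le_trans (normr_Re_le _).
  have -> : (charfun P W t + charfun P W (- t)) / 2 = (mean P (fun w => cos (t * W w)))%:C.
    rewrite -Cexp_real /charfun -CexpD; [|exact: cintegrable_expi (mt t)|exact: cintegrable_expi (mt (- t))].
    rewrite [_ / 2]mulrC -CexpZ; last by apply: cintegrableD; exact: cintegrable_expi (mt _).
    apply: eq_Cexp => w; rewrite mulNr /expi cosN sinN.
    by apply/eqP; rewrite eq_complex/=; apply/andP; split; apply/eqP; field.
  by [].
pose y := n * b2 * t ^+ 2 / 2.
have e3 : `|gauss t - 1 + y| <= y ^+ 2 / 2.
  by apply: expRN_sub_le; rewrite divr_ge0// mulr_ge0 ?sqr_ge0// mulr_ge0 ?(ltW n0) ?(ltW b20).
have t20 : 0 < t ^+ 2 / 2 by rewrite divr_gt0 ?exprn_gt0.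
rewrite -(ler_pM2l t20) -[X in X * `|_|](gtr0_norm t20) -normrM.
have e4 : y ^+ 2 / 2 <= t ^+ 3 * (n ^+ 2 * b2 ^+ 2 / 8).
  have -> : y ^+ 2 / 2 = t ^+ 3 * (n ^+ 2 * b2 ^+ 2 / 8) * t by rewrite /y; field.
  rewrite ler_piMr ?(le_trans te)//; apply: mulr_ge0; first by rewrite exprn_ge0// ltW.
  by rewrite divr_ge0// mulr_ge0 ?sqr_ge0.
have -> : t ^+ 2 / 2 * (2 * D * Num.sqrt n + t * c) =
   D * Num.sqrt n * t ^+ 2 + D3 * t ^+ 3 + t ^+ 3 / 6 * M3 + t ^+ 3 * (n ^+ 2 * b2 ^+ 2 / 8).
  by rewrite /c; field.
have -> : t ^+ 2 / 2 * (M2 - n * b2) = t ^+ 2 / 2 * M2 - y by rewrite /y; field.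
move: e1 e2 e3 e4; rewrite !ler_norml -/M2; lra.
Qed.

(** A common form for both normalizations. Three errors add up: the approximation of [charfun], the
    shift by [mu], and the change of variance. In the last one [sqrt n * t] is absorbed by the
    exponential, for which [v] must stay comparable to [n * b2]. *)
Lemma charfun_shift_approx (mu v bl c8 : R) : `|mu| <= D -> 0 < bl -> bl <= b2 ->
  0 <= c8 -> `|v - n * b2| <= c8 * Num.sqrt n -> n * b2 / 2 <= v ->
  forall t, 0 < t -> t <= eta ->
  cnorm (expi (- (t * mu)) * charfun P W t - (expR (- (v * t ^+ 2 / 2)))%:C) <=
  (3 * D + c8 * (1 + 8 / bl)) * t * expR (- (n * Num.min k (bl / 8) * t ^+ 2)).
Proof.
move=> muD bl0 blb c80 hv vb t t0 te; set a := Num.min k _.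
have te' : `|t| <= eta by rewrite gtr0_norm.
have t2 : 0 <= t ^+ 2 by exact: sqr_ge0.
have nt : 0 <= n * t ^+ 2 by rewrite mulr_ge0// ltW.
have ak : a <= k by rewrite ge_min lexx.
have ab : a <= bl / 8 by rewrite ge_min lexx orbT.
have antb : n * a * t ^+ 2 <= bl / 8 * (n * t ^+ 2).
  by rewrite [n * a]mulrC -[leLHS]mulrA ler_wpM2r.
have blnt : bl * (n * t ^+ 2) <= b2 * (n * t ^+ 2) by rewrite ler_wpM2r.
have blnt0 : 0 <= bl * (n * t ^+ 2) by rewrite mulr_ge0// ltW.
set E := expR (- (n * a * t ^+ 2)).
have gE : gauss t <= E.
  by rewrite ler_expR lerN2; apply: le_trans antb _; lra.
have -> : expi (- (t * mu)) * charfun P W t - (expR (- (v * t ^+ 2 / 2)))%:C =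
   expi (- (t * mu)) * (charfun P W t - (gauss t)%:C) + (gauss t)%:C * (expi (- (t * mu)) - 1)
   + (gauss t - expR (- (v * t ^+ 2 / 2)))%:C by rewrite rmorphB/=; ring.
have h1 : cnorm (expi (- (t * mu)) * (charfun P W t - (gauss t)%:C)) <= D * t * E.
  rewrite cnormM cnorm_expi mul1r; apply: le_trans (charfun_approx te') _.
  rewrite (gtr0_norm t0) ler_wpM2l ?mulr_ge0 ?(ltW t0)// ler_expR lerN2 [n * a]mulrC.
  by rewrite -[leLHS]mulrA -[leRHS]mulrA ler_wpM2r.
have h2 : cnorm ((gauss t)%:C * (expi (- (t * mu)) - 1)) <= 2 * D * t * E.
  rewrite cnormM cnorm_real ger0_norm ?expR_ge0// mulrC; apply: ler_pM => //.
  - exact: cnorm_ge0.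
  - exact: expR_ge0.
  - apply: le_trans (cnorm_expi_sub1 _) _; rewrite normrN normrM (gtr0_norm t0) -mulrA ler_wpM2l//.
    by rewrite mulrC ler_wpM2r// ltW.
have h3 : `|gauss t - expR (- (v * t ^+ 2 / 2))| <= c8 * (1 + 8 / bl) * t * E.
  set m := bl / 4 * (n * t ^+ 2).
  have m0 : 0 <= m by rewrite mulr_ge0// divr_ge0// ltW.
  have dx : `|gauss t - expR (- (v * t ^+ 2 / 2))| <= `|v - n * b2| * t ^+ 2 / 2 * expR (- m).
    set x := n * b2 * t ^+ 2 / 2; set y := v * t ^+ 2 / 2.
    have mx : m <= x.
      by rewrite /x /m; lra.
    have my : m <= y.
      have : n * b2 / 2 * t ^+ 2 <= v * t ^+ 2 by rewrite ler_wpM2r.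
      by rewrite /y /m; lra.
    have -> : `|v - n * b2| * t ^+ 2 / 2 = `|x - y|.
      have -> : x - y = - ((v - n * b2) * (t ^+ 2 / 2)) by rewrite /x /y; field.
      have t22 : 0 <= t ^+ 2 / 2 by rewrite divr_ge0.
      by rewrite normrN normrM (ger0_norm t22) [RHS]mulrA.
    (* On [m, +oo[ the function [exp(- p)] is Lipschitz with constant [exp(- m)]. *)
    have lip (p q : R) : m <= p -> p <= q -> `|expR (- p) - expR (- q)| <= `|p - q| * expR (- m).
      move=> mp pq; rewrite ger0_norm ?subr_ge0 ?ler_expR ?lerN2//.
      have -> : expR (- q) = expR (- p) * expR (p - q) by rewrite -expRD; congr expR; ring.
      have := expR_ge1Dx (p - q); rewrite distrC ger0_norm ?subr_ge0//.
      have e1 : expR (- p) <= expR (- m) by rewrite ler_expR lerN2.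
      have e0 := expR_ge0 (- p).
      have : (q - p) * expR (- p) <= (q - p) * expR (- m) by rewrite ler_wpM2l// subr_ge0.
      move: (expR (p - q)) (expR (- p)) (expR (- m)) e0 e1 => f g h e0 e1 e2 e3.
      by nra.
    have [xy|/ltW yx] := leP x y; first exact: lip.
    by rewrite distrC (distrC x); exact: lip.
  apply: le_trans dx _.
  have sn := sqrtr_ge0 n.
  have s1 := sqrtN_mul_le t (ltW n0); rewrite (gtr0_norm t0) in s1.
  have b4 : 0 < bl / 4 by rewrite divr_gt0.
  have h := mul_expRN_le (n * t ^+ 2) b4; rewrite -/m in h.
  have em : expR (- m) <= expR (- (m / 2)) by rewrite ler_expR lerN2; lra.
  have mE : expR (- (m / 2)) <= E.
    by rewrite ler_expR lerN2; apply: le_trans antb _; rewrite /m; lra.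
  have f1 : (1 + n * t ^+ 2) * expR (- m) <= (1 + 8 / bl) * E.
    rewrite mulrDl mul1r [leRHS]mulrDl mul1r; apply: lerD; first exact: le_trans em mE.
    apply: le_trans h _; apply: ler_pM => //; rewrite ?expR_ge0// ?divr_ge0 ?(ltW bl0)//.
    by apply: eq_ler; field; rewrite gt_eqF.
  have f2 : Num.sqrt n * t * expR (- m) <= (1 + 8 / bl) * E.
    by apply: le_trans f1; rewrite ler_wpM2r ?expR_ge0.
  apply: (@le_trans _ _ (c8 * Num.sqrt n * t ^+ 2 / 2 * expR (- m))).
    by rewrite ler_wpM2r ?expR_ge0// ler_wpM2r// ler_wpM2r.
  have -> : c8 * Num.sqrt n * t ^+ 2 / 2 * expR (- m) = c8 * t * (Num.sqrt n * t * expR (- m)) / 2.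
    by field.
  have ct : 0 <= c8 * t by rewrite mulr_ge0// ltW.
  have := ler_wpM2l ct f2.
  have : 0 <= c8 * t * ((1 + 8 / bl) * E).
    by rewrite mulr_ge0// mulr_ge0 ?expR_ge0// addr_ge0// divr_ge0// ltW.
  lra.
apply: le_trans (cnormD _ _) _; rewrite cnorm_real.
have := cnormD (expi (- (t * mu)) * (charfun P W t - (gauss t)%:C))
   ((gauss t)%:C * (expi (- (t * mu)) - 1)).
move: h1 h2 h3; lra.
Qed.

End normal_approximation.

(** Multiplying [W - mu] by [eta] brings the frequencies up to [eta] onto ]0, 1], where
    [smoothing_inequality] compares with the normal law of variance [eta^2 v]. This turns [a] into
    [a * eta^2], whence [eta] in the denominator. *)
Lemma kolmogorov_distance_le {R : realType} : exists2 C : R, 0 < C & forall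
    d (T : measurableType d) (P : probability T R) (W : T -> R) (mu v eta K a : R),
  rintegrable P W -> 0 < v -> 0 < eta -> eta <= 1 -> 0 <= K -> 0 < a -> a <= v / 2 ->
  (forall t, 0 < t -> t <= eta ->
    cnorm (expi (- (t * mu)) * charfun P W t - (expR (- (v * t ^+ 2 / 2)))%:C) <=
    K * t * expR (- (a * t ^+ 2))) ->
  (dist_to_normal P (fun w => ((W w - mu) / Num.sqrt v)%R) <= (C * (K + 1) / (eta * Num.sqrt a))%:E)%E.
Proof.
have [C C0 hC] := @smoothing_inequality R.
exists C => // d T P W mu v eta K a Wi v0 eta0 eta1 K0 a0 av hW.
have s0 : 0 < Num.sqrt v by rewrite sqrtr_gt0.
have mW := rintegrable_measurable Wi.
have es : 0 < eta * Num.sqrt v by rewrite mulr_gt0.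
have i1 : rintegrable P (fun w => eta * (W w - mu)).
  by apply: rintegrableZ; apply: rintegrableB => //; exact: rintegrable_cst.
have i2 := @rintegrable_normal R (eta * Num.sqrt v).
have a'0 : 0 < a * eta ^+ 2 by rewrite mulr_gt0 ?exprn_gt0.
have cf t : charfun P (fun w => eta * (W w - mu)) t = expi (- (t * eta * mu)) * charfun P W (t * eta).
  rewrite /charfun -CexpZ; last by apply: cintegrable_expi; exact: measurable_funM.
  by apply: eq_Cexp => w; rewrite -expiD; congr expi; ring.
have cz t : 0 < t -> charfun (normal_prob 0 1) (fun z : R => eta * Num.sqrt v * z) t =
    (expR (- (v * (t * eta) ^+ 2 / 2)))%:C.
  move=> t0; rewrite charfun_normal ?(ltW es) ?(ltW t0)//; congr (expR (- _))%:C.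
  by rewrite exprMn sqr_sqrtr ?(ltW v0)//; ring.
have b1 t : 0 < t -> t <= 1 -> cnorm (charfun P (fun w => eta * (W w - mu)) t -
    charfun (normal_prob 0 1) (fun z : R => eta * Num.sqrt v * z) t) <=
    K * t * expR (- (a * eta ^+ 2 * t ^+ 2)).
  move=> t0 t1; rewrite cf cz//; apply: le_trans (hW (t * eta) _ _) _.
  - by rewrite mulr_gt0.
  - by rewrite ler_piMl// ltW.
  - have -> : a * (t * eta) ^+ 2 = a * eta ^+ 2 * t ^+ 2 by ring.
    rewrite ler_wpM2r ?expR_ge0// ler_wpM2l// ler_piMr// ltW//.
have b2 t : 0 < t -> t <= 1 ->
    cnorm (charfun (normal_prob 0 1) (fun z : R => eta * Num.sqrt v * z) t) <= expR (- (a * eta ^+ 2 * t ^+ 2)).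
  move=> t0 t1; rewrite cz// cnorm_real ger0_norm ?expR_ge0// ler_expR lerN2.
  have -> : a * eta ^+ 2 * t ^+ 2 = a * (t * eta) ^+ 2 by ring.
  by rewrite mulrAC ler_wpM2r ?sqr_ge0.
have h := hC _ _ _ _ P (normal_prob 0 1) _ _ K _ i1 i2 K0 a'0 b1 b2.
apply: ge_ereal_sup => _ [x _ <-].
have {h} := h (eta * Num.sqrt v * x).
have -> : [set w | eta * (W w - mu) <= eta * Num.sqrt v * x] = [set w | (W w - mu) / Num.sqrt v <= x].
  by apply/seteqP; split => w /=; rewrite ler_pdivrMr// -mulrA ler_pM2l// [x * _]mulrC.
have -> : [set z : R | eta * Num.sqrt v * z <= eta * Num.sqrt v * x] = `]-oo, x]%classic.
  by apply/seteqP; split => z /=; rewrite in_itv/= ler_pM2l.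
rewrite /std_normal_cdf.
have mE : measurable [set w | (W w - mu) / Num.sqrt v <= x].
  by apply: measurable_sublevel; apply: measurable_funM => //; exact: measurable_funB.
rewrite -[X in (`|X - _| <= _)%E]fineK ?fin_num_measure//.
rewrite -[X in (`|_ - X| <= _)%E]fineK ?fin_num_measure//.
rewrite lee_fin => /le_trans; apply.
rewrite sqrtrM ?(ltW a0)// sqrtr_sqr gtr0_norm//.
by rewrite [eta * _]mulrC.
Qed.

(** * Conditional laws *)

Section conditional_law.
Context {R : realType} {d1 d2 : measure_display}.
Context {T1 : measurableType d1} {T2 : measurableType d2}.
Context {d' : measure_display} {T' : measurableType d'}.
Context (P1 : probability T1 R) (P2 : probability T2 R) (U : T2 -> T') (V : T1 -> T') (E : set T1).
Context (mU : measurable_fun setT U) (mV : measurable_fun setT V) (mE : measurable E).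
Context (E0 : (0 < P1 E)%E).
Context (law : forall A, measurable A -> P2 (U @^-1` A) = cond_prob P1 (V @^-1` A) E).
Let p := fine (P1 E).

Let p0 : 0 < p.
Proof. by rewrite /p fine_gt0// E0/= ltey_eq fin_num_measure. Qed.

Let mean_cond_indic (B : set T') : measurable B ->
  mean P2 (fun w => \1_B (U w)) = p^-1 * mean P1 (fun w => \1_E w * \1_B (V w)).
Proof.
move=> mB.
have mUB : measurable (U @^-1` B) by rewrite -[X in measurable X]setTI; exact: mU.
have mVB : measurable (V @^-1` B) by rewrite -[X in measurable X]setTI; exact: mV.
have -> : (fun w => \1_B (U w)) = \1_(U @^-1` B) :> (T2 -> R).
  by apply/funext => w; rewrite !indicE; congr (nat_of_bool _)%:R; apply/idP/idP; rewrite !inE.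
have -> : (fun w => \1_E w * \1_B (V w)) = \1_(V @^-1` B `&` E) :> (T1 -> R).
  apply/funext => w; rewrite !indicE -natrM mulnb; congr (nat_of_bool _)%:R.
  by apply/andP/idP; rewrite !inE => -[].
rewrite !mean_indic//; last exact: measurableI.
rewrite law// /cond_prob -[X in (_ / X)%E]fineK ?fin_num_measure//.
rewrite -[X in (X / _)%E]fineK ?fin_num_measure//; last exact: measurableI.
by rewrite -/p inver gt_eqF//= mulrC.
Qed.

Lemma mean_cond_law1 (f : T' -> R) : measurable_fun setT f -> (forall z, `|f z| <= 1) ->
  mean P2 (fun w => f (U w)) = p^-1 * mean P1 (fun w => \1_E w * f (V w)).
Proof.
move=> mf f1.
have n11 (w : T2) : `|1 : R| <= 1 by rewrite normr1.
have i11 (w : T1) : `|\1_E w : R| <= 1 by rewrite indicE; case: (_ \in _); rewrite ?normr1 ?normr0.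
have [i1 e1] := mean_mul_layer P2 mU (@measurable_cst _ _ T2 R setT 1) n11 mf f1.
have [i2 e2] := mean_mul_layer P1 mV (measurable_indic mE) i11 mf f1.
have eL : mean P2 (fun w => f (U w)) = mean P2 (fun w => cst 1 w * f (U w)).
  by apply: eq_mean => w; rewrite mul1r.
rewrite eL e1 e2 mean_indic// -/p.
have -> : mean P2 (cst 1 : T2 -> R) = 1 by exact: mean_cst.
rewrite mulrBr mulVf ?gt_eqF//; congr (_ - _).
rewrite mulrCA; congr (_ * _); rewrite -meanZ//; apply: eq_mean => u.
rewrite -mean_cond_indic; first by apply: eq_mean => w; rewrite mul1r.
rewrite (_ : [set z | u < f z] = setT `&` f @^-1` `]u, +oo[%classic); first exact: mf.
by apply/seteqP; split => z /=; rewrite in_itv/= andbT//; move=> [].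
Qed.

Lemma mean_cond_law (M : R) (f : T' -> R) : measurable_fun setT f -> (forall z, `|f z| <= M) ->
  mean P2 (fun w => f (U w)) = p^-1 * mean P1 (fun w => \1_E w * f (V w)).
Proof.
move=> mf fM.
(* A point of [T'] shows that [M >= 0]; if there is none, [T1] is empty too, which contradicts
   [P1 E > 0]. *)
have [z0|T'0] := pselect (exists z : T', True); last first.
  have T10 (w : T1) : False by apply: T'0; exists (V w).
  by move: E0; rewrite (_ : E = set0) ?measure0 ?ltxx//; apply/seteqP; split=> w; case: (T10 w).
have M0' : 0 <= M by case: z0 => z _; exact: le_trans (fM z).
have M0 : 0 < M + 1 by rewrite ltr_pwDr.
have mf' : measurable_fun setT (fun z => (M + 1)^-1 * f z) by exact: measurable_funM.
have f1 z : `|(M + 1)^-1 * f z| <= 1.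
  rewrite normrM gtr0_norm ?invr_gt0// mulrC ler_pdivrMr// mul1r (le_trans (fM z))// lerDl//.
have h := mean_cond_law1 mf' f1.
have iU : rintegrable P2 (fun w => f (U w)).
  by apply: (@rintegrable_bounded _ _ _ _ M) => //; exact: measurableT_comp.
have iV : rintegrable P1 (fun w => \1_E w * f (V w)).
  apply: (@rintegrable_bounded _ _ _ _ M) => [|w].
    by apply: measurable_funM; [exact: measurable_indic|exact: measurableT_comp].
  rewrite normrM indicE; case: (_ \in _); rewrite ?normr1 ?normr0 ?mul1r ?mul0r//.
rewrite meanZ// in h.
have e : mean P1 (fun w => \1_E w * ((M + 1)^-1 * f (V w))) = (M + 1)^-1 * mean P1 (fun w => \1_E w * f (V w)).
  by rewrite -meanZ//; apply: eq_mean => w; rewrite mulrCA.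
move: h; rewrite e mulrCA => /(mulfI _); apply.
by rewrite invr_eq0 gt_eqF.
Qed.

(** The conditional law reaches bounded functions of [U] first, hence the truncation at [n], whose
    mean is bounded by that of [g] independently of [n]. *)
Lemma rintegrable_cond_law (f : T' -> R) (g : T1 -> R) :
  measurable_fun setT f -> (forall z, 0 <= f z) -> (forall w, 0 <= g w) ->
  (forall w, E w -> f (V w) <= g w) -> rintegrable P1 g -> rintegrable P2 (fun w => f (U w)).
Proof.
move=> mf f0 g0 fg ig.
apply: (@rintegrable_truncation _ _ _ _ (p^-1 * mean P1 g)).
- exact: (measurableT_comp mf mU).
- by move=> w.
move=> n.
have mm : measurable_fun setT (fun z : T' => Num.min (f z) n%:R).
  by apply: measurable_minr => //; exact: measurable_cst.
have bf (z : T') : `|Num.min (f z) n%:R| <= n%:R :> R.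
  by rewrite ger0_norm ?ge_min ?lexx ?orbT// le_min f0 ler0n.
rewrite (mean_cond_law mm bf) ler_pM2l ?invr_gt0//; apply: le_mean => //.
  apply: (@rintegrable_bounded _ _ _ _ n%:R) => [|w].
    by apply: measurable_funM; [exact: measurable_indic|exact: (measurableT_comp mm mV)].
  by rewrite normrM indicE; case: (_ \in _); rewrite ?normr1 ?normr0 ?mul1r ?mul0r.
move=> w; rewrite indicE; have [|_] := boolP (w \in E); last by rewrite mul0r.
by rewrite inE => /fg h; rewrite mul1r ge_min h.
Qed.

Lemma Cexp_cond_law (F : T' -> R[i]) : cmeasurable F -> (forall z, cnorm (F z) <= 1) ->
  Cexpectation P2 (fun w => F (U w)) =
  (p^-1)%:C * Cexpectation P1 (fun w => (\1_E w)%:C * F (V w)).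
Proof.
move=> [mc ms] F1.
have c1 z : `|complex.Re (F z)| <= 1 by exact: le_trans (normr_Re_le _) (F1 z).
have s1 z : `|complex.Im (F z)| <= 1 by exact: le_trans (normr_Im_le _) (F1 z).
apply/eqP; rewrite eq_complex/= !mul0r subr0 addr0; apply/andP; split; apply/eqP.
- rewrite (mean_cond_law mc c1); congr (_ * _); apply: eq_mean => w.
  by case: (F (V w)) => x y /=; rewrite mul0r subr0.
- rewrite (mean_cond_law ms s1); congr (_ * _); apply: eq_mean => w.
  by case: (F (V w)) => x y /=; rewrite mul0r addr0.
Qed.

End conditional_law.

Section copies.
Context {R : realType} {d1 d2 d' : measure_display}.
Context {T1 : measurableType d1} {T2 : measurableType d2} {T' : measurableType d'}.
Context (P1 : probability T1 R) (P2 : probability T2 R) (U : T2 -> T') (V : T1 -> T').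
Context (mU : measurable_fun setT U) (mV : measurable_fun setT V).
Context (law : same_law P2 P1 U V).

Let P1T : P1 setT = 1%E. Proof. exact: probability_setT. Qed.
Let P1T0 : (0 < P1 setT)%E. Proof. by rewrite P1T. Qed.

(** Equality of laws is conditioning on the whole space, so the lemmas on conditional laws apply to
    the copies. *)
Let law' (A : set T') : measurable A -> P2 (U @^-1` A) = cond_prob P1 (V @^-1` A) setT.
Proof. by move=> mA; rewrite /cond_prob setIT P1T inve1 mule1 law. Qed.

Lemma rintegrable_same_law (f : T' -> R) : measurable_fun setT f -> (forall z, 0 <= f z) ->
  rintegrable P1 (fun w => f (V w)) -> rintegrable P2 (fun w => f (U w)).
Proof.
move=> mf f0; apply: (rintegrable_cond_law mU mV measurableT P1T0 law' mf f0) => //.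
Qed.

Lemma Cexp_same_law (F : T' -> R[i]) : cmeasurable F -> (forall z, cnorm (F z) <= 1) ->
  Cexpectation P2 (fun w => F (U w)) = Cexpectation P1 (fun w => F (V w)).
Proof.
move=> mF F1; rewrite (Cexp_cond_law mU mV measurableT P1T0 law' mF F1).
rewrite P1T invr1 mul1r; apply: eq_Cexp => w.
by rewrite indicT mul1r.
Qed.

End copies.

(** * Lower bound for lattice probabilities *)

Section local_bound.
Context {R : realType}.

Local Notation ltNpi := (ltNM (@pi_gt0 R)).

(** A minorant of the Gaussian with an elementary antiderivative; where its numerator is negative
    there is nothing to prove. *)
Lemma rational_le_expRN (y : R) : 0 <= y -> (1 - y / 2) / (1 + y) ^+ 2 <= expR (- (y / 2)).
Proof.
move=> y0; have y1 : 1 <= (1 + y) ^+ 2 by rewrite exprn_ege1// lerDl.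
have [h|h] := leP (1 - y / 2) 0.
  apply: le_trans (expR_ge0 _); rewrite mulr_le0_ge0// invr_ge0; lra.
apply: (@le_trans _ _ (1 - y / 2)).
  by rewrite ler_pdivrMr ?(lt_le_trans ltr01)// ler_peMr// ltW.
exact: (expR_ge1Dx (- (y / 2))).
Qed.

(* [(1 - y / 2) / (1 + y) ^ 2] at [y = v s ^ 2] has antiderivative [atan (w s) / (4 w) + 3 s / (4 (1 + v s ^ 2))], [w = sqrt v] *)
Lemma gauss_cos0_ge (v : R) : 0 < v -> 1 <= v * pi ^+ 2 ->
  (16 * Num.sqrt v)^-1 <= gauss_cos v 0 (@pi_gt0 R) 0.
Proof.
move=> v0 v1; set w := Num.sqrt v; have w0 : 0 < w by rewrite sqrtr_gt0.
have wv : w ^+ 2 = v by rewrite sqr_sqrtr// ltW.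
pose f (s : R) := (1 - (w * s) ^+ 2 / 2) / (1 + (w * s) ^+ 2) ^+ 2.
pose F (s : R) := atan (w * s) / (4 * w) + 3 / 4 * (s / (1 + (w * s) ^+ 2)).
have n0 (s : R) : 1 + (w * s) ^+ 2 != 0 by rewrite gt_eqF// ltr_pwDl// sqr_ge0.
have dF (x : R) : is_derive x 1 F (f x).
  have d1 : is_derive x 1 (fun t => w * t) w by apply: is_derive_eq; rewrite /GRing.scale/= mulr1.
  have d2 := @is_derive1_comp _ (@atan R) (fun t => w * t) x _ _ (is_derive1_atan (w * x)) d1.
  have d3 := @is_deriveV _ (fun x => 1 + (w * x) ^+ 2) x 1 _ (n0 x).
  apply: is_derive_eq; rewrite /GRing.scale/= /f; field.
  by rewrite n0 gt_eqF.
have cf : continuous f.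
  apply: derivable_continuousT => x; have n2 : (1 + (w * x) ^+ 2) ^+ 2 != 0 by rewrite expf_neq0.
  have d3 := @is_deriveV _ (fun x => (1 + (w * x) ^+ 2) ^+ 2) x 1 _ n2; exact: ex_derive.
apply: (@le_trans _ _ (unif_mean ltNpi f)); last first.
  have cg := @continuous_cos_gauss R v 0 0.
  apply: (le_mean (unif_mean_int ltNpi cf) (unif_mean_int ltNpi cg)) => s.
  rewrite mul0r addr0 cos0 mul1r /f exprMn wv; apply: rational_le_expRN.
  by rewrite mulr_ge0 ?sqr_ge0// ltW.
rewrite (unif_mean_FTC ltNpi dF cf) /F.
have p0 := @pi_gt0 R.
(* This makes [atan (w * pi)] at least [atan 1 = pi / 4]. *)
have wp : 1 <= w * pi.
  rewrite -(@ler_pXn2r _ 2) ?nnegrE ?mulr_ge0 ?(ltW w0) ?(ltW p0)//.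
  by rewrite expr1n exprMn wv.
have at1 : pi / 4 <= atan (w * pi) by rewrite -atan1 le_atan.
rewrite mulrN atanN sqrrN.
have g0 : 0 <= 3 / 4 * (pi / (1 + (w * pi) ^+ 2)).
  by rewrite mulr_ge0// divr_ge0// ?(ltW p0)// addr_ge0// sqr_ge0.
have pp : 0 < pi - - pi :> R by rewrite opprK addr_gt0.
rewrite ler_pdivlMr// [- atan _ / _]mulNr [- pi / _]mulNr mulrN; apply: (@le_trans _ _ (2 * (pi / 4 / (4 * w)))).
  by apply: eq_ler; field; rewrite gt_eqF.
have : pi / 4 / (4 * w) <= atan (w * pi) / (4 * w).
  by rewrite ler_wpM2r// invr_ge0 mulr_ge0// ltW.
move: g0; set A := 3 / 4 * _; set B := atan _ / _; lra.
Qed.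

Context {d : measure_display} {T : measurableType d}.
Context (P : probability T R) (SA SB : T -> R) (m : R) (N : nat) (phi : R -> R -> R[i]).
Context (mSA : measurable_fun setT SA) (mSB : measurable_fun setT SB).
Context (lattice : {ae P, forall w, SA w - m \is a Num.int}) (N0 : (0 < N)%N).
Context (phi_sum : forall s t, Cexpectation P (fun w => expi (s * SA w + t * SB w)) = phi s t ^+ N).
Context (v C1 k K0 : R) (v0 : 0 < v) (C10 : 0 <= C1) (k0 : 0 < k) (kv : k <= v / 2) (K00 : 0 <= K0).
Context (phi_expansion : forall s, - pi <= s <= pi ->
  cnorm (phi s 0 - (expR (- (v * s ^+ 2 / 2)))%:C) <= C1 * `|s| ^+ 3).
Context (phi_decay : forall s, - pi <= s <= pi -> cnorm (phi s 0) <= expR (- (k * s ^+ 2))).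
Context (m_le : `|m| <= K0 * Num.sqrt (v * N%:R)) (N1 : 1 <= v * N%:R).

Let D := C1 * (expR (17 * k) * (2 / k)) * (1 + 4 / k) * (4 / (2 * pi) / Num.sqrt (k / 4)).

(** The main term is [gauss_cos] at frequency [m] with [V = v N], close to [exp(- m^2 / (2 V))]
    times its value at 0; the bounds on [m] and on that value give the first summand. Of the errors,
    [D / N] comes from replacing the characteristic function by a Gaussian and [K0 / (v N)] from
    cutting the Gaussian integral at [pi]. *)
Lemma local_lower_bound :
  expR (- (K0 ^+ 2 / 2)) / (16 * Num.sqrt (v * N%:R)) - (D + K0 / v) / N%:R <=
  fine (P [set w | SA w - m = 0]).
Proof.
have nN : 0 < N%:R :> R by rewrite ltr0n.
set V := v * N%:R; have V0 : 0 < V by rewrite mulr_gt0.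
have sV : 0 < Num.sqrt V by rewrite sqrtr_gt0.
have p0 := @pi_gt0 R.
have mE : measurable [set w | SA w - m = 0] by apply: measurable_level; exact: measurable_funB.
pose g (s : R) : R[i] := expi (- (s * m)) * (expR (- (V * s ^+ 2 / 2)))%:C.
have cg := @continuous_cos_gauss R V 0 m.
have cg2 : continuous ((fun s => sin (m * s + 0) * expR (- (V * s ^+ 2 / 2))) : R -> R).
  by apply: derivable_continuousT => x; exact: ex_derive.
have gRe (s : R) : complex.Re (g s) = cos (m * s + 0) * expR (- (V * s ^+ 2 / 2)).
  by rewrite /g/= addr0 (mulrC m) cosN mulr0 subr0.
have gIm (s : R) : complex.Im (g s) = - (sin (m * s + 0) * expR (- (V * s ^+ 2 / 2))).
  by rewrite /g/= addr0 (mulrC m) sinN mulr0 add0r mulNr.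
have ig : cintegrable (uniform_prob ltNpi) (fun s => g (clip (- pi) pi s)).
  split.
    rewrite (_ : (fun _ => _) = fun s => cos (m * clip (- pi) pi s + 0) *
       expR (- (V * clip (- pi) pi s ^+ 2 / 2))); last by apply/funext => s; exact: gRe.
    exact: (unif_mean_int ltNpi cg).
  rewrite (_ : (fun _ => _) = fun s => - (sin (m * clip (- pi) pi s + 0) *
     expR (- (V * clip (- pi) pi s ^+ 2 / 2)))); last by apply/funext => s; exact: gIm.
  apply: rintegrableN; exact: (unif_mean_int ltNpi cg2).
have ii := cintegrable_integrand m mSA mSB phi_sum 0.
have num : numerator P SA SB m 0 = (fine (P [set w | SA w - m = 0]))%:C.
  rewrite -mean_indic// -Cexp_real; apply: eq_Cexp => w.
  by rewrite mul0r expi0 mulr1.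
have kN : 0 < k / 4 * N%:R by rewrite mulr_gt0 ?divr_gt0.
have k20 : 0 < k / 2 by rewrite divr_gt0.
pose M := C1 * (expR (17 * k) * (2 / k)) * (1 + 4 / k) * (Num.sqrt N%:R / N%:R).
have M0 : 0 <= M.
  have h : 0 <= 1 + 4 / k by rewrite addr_ge0// divr_ge0// ltW.
  by rewrite /M mulr_ge0 ?mulr_ge0 ?expR_ge0 ?sqrtr_ge0 ?invr_ge0 ?(ltW k0) ?(ltW nN).
have close : `|fine (P [set w | SA w - m = 0]) - gauss_cos V 0 (@pi_gt0 R) m| <= D / N%:R.
  have := normr_Re_le ((fine (P [set w | SA w - m = 0]))%:C -
    Cexpectation (uniform_prob ltNpi) (fun s => g (clip (- pi) pi s))).
  rewrite [complex.Re _]/=.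
  have -> : mean (uniform_prob ltNpi) (fun s => complex.Re (g (clip (- pi) pi s))) = gauss_cos V 0 (@pi_gt0 R) m.
    by rewrite /gauss_cos /unif_mean; apply: eq_mean => s; exact: gRe.
  move=> /le_trans; apply; rewrite -num (numerator_inversion mSA mSB lattice phi_sum) /Cpi_mean -CexpB//.
  apply: (@le_trans _ _ (mean (uniform_prob ltNpi)
      (fun s => M * expR (- (k / 4 * N%:R * clip (- pi) pi s ^+ 2))))).
    apply: cnorm_Cexp_le; [exact: cintegrableB|exact/rintegrableZ/unif_mean_gauss_int|].
    move=> s0; have /andP[/ltW h1 h2] := clip_itv ltNpi s0.
    move: (clip _ _ s0) h1 h2 => s h1 h2 {s0}.
    have sp : - pi <= s <= pi by rewrite h1.
    have -> : expi (- (s * m)) * phi s 0 ^+ N - g s =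
       expi (- (s * m)) * (phi s 0 ^+ N - (expR (- (v * s ^+ 2 / 2)))%:C ^+ N).
      rewrite /g mulrBr -rmorphXn/= -expRM_natl; congr (_ - _ * (expR _)%:C).
      by rewrite /V; ring.
    rewrite cnormM cnorm_expi mul1r.
    have s17 : s ^+ 2 <= 17 by have := @pihalf_lt2 R; move: sp p0; nra.
    have dg : cnorm (expR (- (v * s ^+ 2 / 2)))%:C <= expR (- (k * s ^+ 2)).
      rewrite cnorm_real ger0_norm ?expR_ge0// ler_expR lerN2 mulrAC.
      by rewrite ler_wpM2r ?sqr_ge0.
    have de : cnorm (phi s 0 - (expR (- (v * s ^+ 2 / 2)))%:C) <= C1 * `|s| * s ^+ 2.
      have := phi_expansion sp; have -> // : C1 * `|s| ^+ 3 = C1 * `|s| * s ^+ 2.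
      by rewrite -[s ^+ 2](real_normK (num_real s)); ring.
    have c1s : 0 <= C1 * `|s| by rewrite mulr_ge0.
    have h := cnorm_subX_decay N0 k0 (sqr_ge0 s) s17 c1s (phi_decay sp) dg de.
    apply: le_trans h _.
    have h := @natr_mul_expRN_le R (k / 2) s N k20.
    have -> : k * N%:R * s ^+ 2 / 2 = k / 2 * N%:R * s ^+ 2 by ring.
    have -> : k / 4 * N%:R * s ^+ 2 = k / 2 * N%:R * s ^+ 2 / 2 by field.
    rewrite -(ler_pM2l nN).
    have -> : N%:R * (C1 * `|s| * (expR (17 * k) * (2 / k)) * expR (- (k / 2 * N%:R * s ^+ 2))) =
      C1 * (expR (17 * k) * (2 / k)) * (N%:R * `|s| * expR (- (k / 2 * N%:R * s ^+ 2))) by ring.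
    have -> : N%:R * (M * expR (- (k / 2 * N%:R * s ^+ 2 / 2))) =
      C1 * (expR (17 * k) * (2 / k)) * (Num.sqrt N%:R * (1 + 2 / (k / 2)) * expR (- (k / 2 * N%:R * s ^+ 2 / 2))).
      by rewrite /M; move: (expR _) (expR _) (Num.sqrt _) => x y z; field; rewrite !gt_eqF.
    by apply: ler_wpM2l h; rewrite !mulr_ge0 ?expR_ge0 ?invr_ge0 ?(ltW k0).
  rewrite meanZ; last exact: unif_mean_gauss_int.
  apply: le_trans (ler_wpM2l M0 (unif_mean_gauss_le ltNpi kN)) _.
  have k40 : 0 < k / 4 by rewrite divr_gt0.
  have s1 : 0 < Num.sqrt (k / 4) by rewrite sqrtr_gt0.
  have s2 : 0 < Num.sqrt N%:R :> R by rewrite sqrtr_gt0.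
  rewrite sqrtrM ?(ltW k40)// opprK /M /D; move: s1 s2 p0.
  move: (Num.sqrt (k / 4)) (Num.sqrt N%:R) (pi : R) (expR _) => x y z e x0 y0 z0.
  rewrite -mulr2n -mulr_natr; apply: eq_ler; field.
  by rewrite !gt_eqF.
have p2 := @pi_ge2 R.
have pp : 2 <= pi ^+ 2 :> R by rewrite expr2; nra.
have Vpi : 1 <= V * pi ^+ 2 by move: N1; rewrite -/V; nra.
have low := gauss_cos0_ge V0 Vpi.
(* [gauss_cos_approx] takes nonnegative frequencies; the cosine is even. *)
have even : gauss_cos V 0 (@pi_gt0 R) m = gauss_cos V 0 (@pi_gt0 R) `|m|.
  have [m0|m0] := leP 0 m; first by rewrite ger0_norm.
  rewrite ltr0_norm// /gauss_cos /unif_mean; apply: eq_mean => s; congr (_ * _).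
  by rewrite !addr0 mulNr cosN.
have approx := gauss_cos_approx 0 (@pi_gt0 R) V0 (normr_ge0 m).
rewrite -even in approx.
have e1 : expR (- (K0 ^+ 2 / 2)) <= expR (- (`|m| ^+ 2 / (2 * V))).
  rewrite ler_expR lerN2 ler_pdivrMr ?mulr_gt0//.
  have -> : K0 ^+ 2 / 2 * (2 * V) = (K0 * Num.sqrt V) ^+ 2.
    by rewrite exprMn sqr_sqrtr ?(ltW V0)//; field.
  by rewrite lerXn2r// nnegrE mulr_ge0// ltW.
have e2 : expR (- (K0 ^+ 2 / 2)) / (16 * Num.sqrt V) <=
    expR (- (`|m| ^+ 2 / (2 * V))) * gauss_cos V 0 (@pi_gt0 R) 0.
  by apply: ler_pM => //; rewrite ?expR_ge0// invr_ge0 mulr_ge0// ltW.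
have e3 : `|m| * (expR (- (V * pi ^+ 2 / 2)) / (pi * V)) <= K0 / v / N%:R.
  have sVV : Num.sqrt V <= V.
    rewrite -[leRHS](sqr_sqrtr (ltW V0)) expr2 ler_peMl ?(ltW sV)//.
    by rewrite -sqrtr1 ler_wsqrtr.
  have mV : `|m| <= K0 * V by apply: le_trans m_le _; rewrite ler_wpM2l.
  have eV : expR (- (V * pi ^+ 2 / 2)) <= V^-1.
    have y0 : 0 <= V * pi ^+ 2 / 2 by rewrite divr_ge0// mulr_ge0 ?sqr_ge0// ltW.
    apply: le_trans (expRN_le_inv y0) _; rewrite lef_pV2 ?posrE//; last by rewrite ltr_pwDl.
    by nra.
  have -> : K0 / v / N%:R = (K0 * V) * (V^-1 / V) by rewrite /V; field; rewrite !gt_eqF.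
  apply: ler_pM => //; first by rewrite divr_ge0 ?expR_ge0// mulr_ge0 ?ltW.
  have piV : 0 < pi * V by rewrite mulr_gt0.
  apply: ler_pM => //; rewrite ?expR_ge0 ?invr_ge0 ?(ltW piV)//.
  by rewrite lef_pV2 ?posrE ?mulr_gt0// ler_peMl ?(ltW V0)//; lra.
move: close approx e2 e3; rewrite mulrDl !ler_norml; lra.
Qed.

End local_bound.

Section dist_to_normal.
Context {R : realType} {d : measure_display} {T : measurableType d}.
Context (P : probability T R) (Z : T -> R).

Lemma dist_to_normal_le1 : measurable_fun setT Z -> (dist_to_normal P Z <= 1)%E.
Proof.
move=> mZ; apply: ge_ereal_sup => _ [x _ <-]; rewrite /std_normal_cdf.
have mE := measurable_sublevel x mZ.
have mI : measurable (`]-oo, x]%classic : set R) by [].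
have e1 : P [set w | Z w <= x] = (fine (P [set w | Z w <= x]))%:E.
  by rewrite fineK// fin_num_measure.
have e2 : normal_prob (0 : R) 1 `]-oo, x] = (fine (normal_prob (0 : R) 1 `]-oo, x]))%:E.
  by rewrite fineK// fin_num_measure.
have h1 : fine (P [set w | Z w <= x]) <= 1.
  by rewrite -lee_fin -e1; exact: probability_le1.
have h2 : 0 <= fine (P [set w | Z w <= x]) by exact: fine_ge0.
have h3 : fine (normal_prob (0 : R) 1 `]-oo, x]) <= 1.
  by rewrite -lee_fin -e2; exact: probability_le1.
have h4 : 0 <= fine (normal_prob (0 : R) 1 `]-oo, x]) by exact: fine_ge0.
rewrite e1 e2 -EFinB lee_fin ler_norml; lra.
Qed.

End dist_to_normal.

(** * Normal approximation of the conditioned sum with uniform constants *)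

Section conditional_normal.
Context {R : realType}.

Definition uncorrelated_pair {d : measure_display} {T : measurableType d} (P : probability T R)
    (A B : T -> R) (K b2 : R) : Prop :=
  [/\ measurable_fun setT A /\ measurable_fun setT B,
      rintegrable P (fun w => `|A w| ^+ 3) /\ mean P (fun w => `|A w| ^+ 3) <= K,
      rintegrable P (fun w => `|B w| ^+ 3) /\ mean P (fun w => `|B w| ^+ 3) <= K,
      mean P B = 0
    & mean P (fun w => A w * B w) = 0 /\ mean P (fun w => B w ^+ 2) = b2].

(** The components of [c] bound, in this order, the mean, the variance, and the distance under the
    first and the second normalization. They are fixed before all spaces and laws, which expresses
    that they depend on the five parameters only. *)
Definition approximation_constants (bl bu K kappa q : R) (c : R * R * R * R) : Prop :=
  [/\ 0 < c.1.1.1, 0 < c.1.1.2, 0 < c.1.2 & 0 < c.2] /\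
  forall d d1 d2 (T : measurableType d) (T1 : measurableType d1) (T2 : measurableType d2)
    (P : probability T R) (P1 : probability T1 R) (P2 : probability T2 R)
    (A B : T -> R) (b2 : R) (SA SB : T1 -> R) (m : R) (N : nat) (W : T2 -> R),
  uncorrelated_pair P A B K b2 -> bl <= b2 -> b2 <= bu ->
  (forall s, - pi <= s <= pi -> cnorm (joint_cf P A B s 0) <= 1 - kappa * s ^+ 2) ->
  measurable_fun setT SA -> measurable_fun setT SB ->
  {ae P1, forall w, SA w - m \is a Num.int} -> (0 < N)%N ->
  (forall s t, Cexpectation P1 (fun w => expi (s * SA w + t * SB w)) = joint_cf P A B s t ^+ N) ->
  q / Num.sqrt N%:R <= fine (P1 [set w | SA w - m = 0]) ->
  measurable_fun setT W -> rintegrable P2 (fun w => `|W w| ^+ 3) ->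
  (forall t, charfun P2 W t =
    ((fine (P1 [set w | SA w - m = 0]))^-1)%:C * numerator P1 SA SB m t) ->
  let v := mean P2 (fun w => W w ^+ 2) - mean P2 W ^+ 2 in
  [/\ `|mean P2 W| <= c.1.1.1, `|v - N%:R * b2| <= c.1.1.2 * Num.sqrt N%:R,
      (dist_to_normal P2 (fun w => ((W w - 0) / Num.sqrt (N%:R * b2))%R) <= (c.1.2 / Num.sqrt N%:R)%:E)%E
    & (dist_to_normal P2 (fun w => ((W w - mean P2 W) / Num.sqrt v)%R) <= (c.2 / Num.sqrt N%:R)%:E)%E].

Lemma conditional_normal_approximation (bl bu K kappa q : R) :
  0 < bl -> 0 < bu -> 0 <= K -> 0 < kappa -> 0 < q ->
  exists c, approximation_constants bl bu K kappa q c.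
Proof.
move=> bl0 bu0 K0 kap0 q0.
have [C0 C00 hC0] := @kolmogorov_distance_le R.
have p0 := @pi_gt0 R.
set C1 := (3 + bu + bu ^+ 2) * (1 + 2 * K).
have K10 : 0 < 1 + 2 * K by lra.
have C10 : 0 < C1 by rewrite mulr_gt0// ?addr_gt0// exprn_gt0.
set delta := Num.min (bl / 2) kappa / (1 + (bu / 2 + 16 * kappa)).
have delta0 : 0 < delta.
  by rewrite divr_gt0// ?lt_min ?divr_gt0// !addr_gt0// ?divr_gt0// mulr_gt0.
set eta := Num.min 1 (delta / (2 * C1)).
have eta0 : 0 < eta by rewrite lt_min ltr01 divr_gt0// mulr_gt0.
have eta1 : eta <= 1 by rewrite ge_min lexx.
set k := delta / 2; have k0 : 0 < k by rewrite divr_gt0.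
have k20 : 0 < k / 2 by rewrite divr_gt0.
set G := 2 / pi / Num.sqrt (k / 2).
have G0 : 0 < G by rewrite !divr_gt0// sqrtr_gt0.
set Da := C1 * (expR (17 * k) * (2 / k)) * G.
have Da0 : 0 < Da.
  by rewrite mulr_gt0// mulr_gt0// mulr_gt0 ?expR_gt0// divr_gt0.
set Db := C1 ^+ 2 * (expR (34 * k) * (8 / k ^+ 2)) + C1 * expR (17 * k) * (1 + 2 / k) * G.
have Db0 : 0 < Db.
  have h1 : 0 < 1 + 2 / k by rewrite addr_gt0// divr_gt0.
  have h2 : 0 < 8 / k ^+ 2 by rewrite divr_gt0// exprn_gt0.
  have h3 : 0 < C1 ^+ 2 by rewrite exprn_gt0.
  apply: addr_gt0; first by rewrite mulr_gt0// mulr_gt0 ?expR_gt0.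
  by rewrite mulr_gt0// mulr_gt0// mulr_gt0 ?expR_gt0.
(* Division by a probability of at least [q / sqrt N] multiplies by at most [sqrt N / q]: this
   cancels the [1 / sqrt N] that accompanies [Da] and leaves a [sqrt N] with [Db]. *)
set D := (Da + Db) / q; have D0 : 0 < D by rewrite divr_gt0// addr_gt0.
(* [2 * D] comes from the second moment and [D ^+ 2] from the squared mean. *)
set c8 := 2 * D + D ^+ 2; have c80 : 0 < c8 by rewrite addr_gt0 ?exprn_gt0// mulr_gt0.
set a := Num.min (k / 2) (bl / 8).
have a0 : 0 < a by rewrite lt_min k20 divr_gt0.
have ea0 : 0 < eta * Num.sqrt a by rewrite mulr_gt0// sqrtr_gt0.
set K2 := 3 * D + c8 * (1 + 8 / bl).
have K20 : 0 < K2.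
  have h1 : 0 < 1 + 8 / bl by rewrite addr_gt0// divr_gt0.
  by rewrite addr_gt0// mulr_gt0.
set Cb := C0 * (K2 + 1) / (eta * Num.sqrt a).
have Cb0 : 0 < Cb by rewrite divr_gt0// mulr_gt0// addr_gt0.
exists (D, c8, Cb, Cb + 2 * c8 / bl); split => /=.
  by split => //; rewrite addr_gt0// divr_gt0// mulr_gt0.
move=> d d1 d2 T T1 T2 P P1 P2 A B b2 SA SB m N W.
move=> [[mA mB] [A3 A3K] [B3 B3K] EB [EAB EBB]] blb bbu kap mSA mSB lat N0 phi_sum qp mW W3 cf.
set p := fine _ in qp cf.
have nN : 0 < N%:R :> R by rewrite ltr0n.
have n1 : 1 <= N%:R :> R by rewrite ler1n.
have sN : 0 < Num.sqrt N%:R :> R by rewrite sqrtr_gt0.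
have sN1 : 1 <= Num.sqrt N%:R :> R by have := ler_wsqrtr n1; rewrite sqrtr1.
have ssN : Num.sqrt N%:R * Num.sqrt N%:R = N%:R :> R by rewrite -expr2 sqr_sqrtr ?ltW.
have pp : 0 < p by apply: lt_le_trans qp; rewrite divr_gt0.
have pV : p^-1 <= Num.sqrt N%:R / q.
  rewrite -[leRHS]invrK lef_pV2 ?posrE ?invr_gt0 ?divr_gt0//.
  by rewrite invf_div.
have b20 : 0 < b2 by exact: lt_le_trans bl0 blb.
have C1le : (3 + b2 + b2 ^+ 2) * (1 + 2 * K) <= C1.
  rewrite ler_wpM2r ?addr_ge0 ?mulr_ge0//.
  by rewrite lerD ?lerD// lerXn2r// nnegrE ltW.
have te1 (t : R) : `|t| <= eta -> `|t| <= 1 by move=> /le_trans; apply.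
have h1 s t : - pi <= s <= pi -> `|t| <= eta ->
  cnorm (joint_cf P A B s t - (expR (- (b2 * t ^+ 2 / 2)))%:C * joint_cf P A B s 0) <=
  C1 * (`|t| * (s ^+ 2 + t ^+ 2)).
  move=> _ /te1 t1; apply: le_trans (joint_cf_expansion mA mB A3 B3 A3K B3K EB EAB EBB s t1) _.
  by rewrite ler_wpM2r// mulr_ge0// addr_ge0 ?sqr_ge0.
have h2 s t : - pi <= s <= pi -> `|t| <= eta ->
  cnorm ((joint_cf P A B s t + joint_cf P A B s (- t)) / 2 -
    (expR (- (b2 * t ^+ 2 / 2)))%:C * joint_cf P A B s 0) <= C1 * (`|t| ^+ 3 + t ^+ 2 * `|s|).
  move=> _ /te1 t1; apply: le_trans (joint_cf_even_expansion mA mB A3 B3 A3K B3K EBB s t1) _.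
  by rewrite ler_wpM2r// addr_ge0 ?exprn_ge0// mulr_ge0 ?sqr_ge0.
have h3 s t (sp : - pi <= s <= pi) (te : `|t| <= eta) :=
  joint_cf_decay mA mB A3 B3 A3K B3K EB EAB EBB bl0 blb bbu kap0 kap sp te.
have num0 : numerator P1 SA SB m 0 = p%:C.
  have mE : measurable [set w | SA w - m = 0] by apply: measurable_level; exact: measurable_funB.
  rewrite /p -mean_indic// -Cexp_real; apply: eq_Cexp => w.
  by rewrite mul0r expi0 mulr1.
have gN t : (expR (- (b2 * t ^+ 2 / 2)))%:C ^+ N = (expR (- (N%:R * b2 * t ^+ 2 / 2)))%:C.
  by rewrite -rmorphXn/= -expRM_natl; congr (expR _)%:C; ring.
have cpV (z : R[i]) : cnorm ((p^-1)%:C * z) <= Num.sqrt N%:R / q * cnorm z.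
  by rewrite cnormM cnorm_real gtr0_norm ?invr_gt0// ler_wpM2r ?cnorm_ge0.
have pVp : (p^-1)%:C * p%:C = 1 by rewrite -rmorphM/= mulVf// gt_eqF.
have e1 t : `|t| <= eta -> cnorm (charfun P2 W t - (expR (- (N%:R * b2 * t ^+ 2 / 2)))%:C) <=
    D * `|t| * expR (- (k / 2 * N%:R * t ^+ 2)).
  move=> te; have := numerator_expansion mSA mSB lat N0 phi_sum (ltW C10) k0 eta1 h1 h3 te.
  rewrite num0 gN cf -/Da -/G => hn.
  have -> : (p^-1)%:C * numerator P1 SA SB m t - (expR (- (N%:R * b2 * t ^+ 2 / 2)))%:C =
    (p^-1)%:C * (numerator P1 SA SB m t - (expR (- (N%:R * b2 * t ^+ 2 / 2)))%:C * p%:C).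
    by rewrite mulrBr [X in _ = _ - X]mulrCA pVp mulr1.
  apply: le_trans (cpV _) _; apply: le_trans (ler_wpM2l _ hn) _.
    by rewrite divr_ge0// ltW.
  rewrite -/G -/Da; have := expR_ge0 (- (k / 2 * N%:R * t ^+ 2)); move: (expR _) => E E0.
  have -> : Num.sqrt N%:R / q * (Da * `|t| * E / Num.sqrt N%:R) = Da / q * (`|t| * E).
    by field; rewrite !gt_eqF.
  rewrite -[D * _ * _]mulrA ler_wpM2r ?mulr_ge0// /D ler_pM2r ?invr_gt0//.
  by rewrite lerDl ltW.
(* [D3] grows with [N], but it multiplies [|t|^3] only and disappears in the limit that gives the
   variance. *)
pose D3 := Num.sqrt N%:R / q * (C1 * expR (17 * k) * N%:R).
have D30 : 0 <= D3.
  rewrite /D3; apply: mulr_ge0; first by rewrite divr_ge0 ?sqrtr_ge0// ltW.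
  by apply: mulr_ge0 => //; apply: mulr_ge0; [exact: ltW|exact: expR_ge0].
have e2 t : `|t| <= eta -> cnorm ((charfun P2 W t + charfun P2 W (- t)) / 2 -
    (expR (- (N%:R * b2 * t ^+ 2 / 2)))%:C) <= D * Num.sqrt N%:R * t ^+ 2 + D3 * `|t| ^+ 3.
  move=> te; have := numerator_even_expansion mSA mSB lat N0 phi_sum (ltW C10) k0 eta1 h1 h2 h3 te.
  rewrite num0 gN !cf => hn.
  have -> : ((p^-1)%:C * numerator P1 SA SB m t + (p^-1)%:C * numerator P1 SA SB m (- t)) / 2
      - (expR (- (N%:R * b2 * t ^+ 2 / 2)))%:C =
    (p^-1)%:C * ((numerator P1 SA SB m t + numerator P1 SA SB m (- t)) / 2
      - (expR (- (N%:R * b2 * t ^+ 2 / 2)))%:C * p%:C).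
    by rewrite mulrBr [X in _ = _ - X]mulrCA pVp mulr1 [X in _ = X - _]mulrA mulrDr.
  apply: le_trans (cpV _) _; apply: le_trans (ler_wpM2l _ hn) _.
    by rewrite divr_ge0// ltW.
  rewrite -/G -/Db mulrDr; apply: lerD; last by rewrite /D3 mulrA.
  rewrite mulrA ler_wpM2r ?sqr_ge0// /D.
  have -> : Num.sqrt N%:R / q * Db = Db / q * Num.sqrt N%:R by ring.
  rewrite ler_wpM2r ?(ltW sN)// ler_pM2r ?invr_gt0// lerDr ltW//.
have iW := rintegrable_of_cube mW W3.
have mu_le : `|mean P2 W| <= D.
  exact: (normr_mean_le_charfun mW W3 n1 eta0 k20 (ltW D0) e1).
have sq_le : `|mean P2 (fun w => W w ^+ 2) - N%:R * b2| <= 2 * D * Num.sqrt N%:R.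
  exact: (normr_mean_sqr_le_charfun mW W3 n1 b20 eta0 eta1 D30 e2).
set v := mean P2 _ - mean P2 W ^+ 2.
have v_le : `|v - N%:R * b2| <= c8 * Num.sqrt N%:R.
  have : mean P2 W ^+ 2 <= D ^+ 2 * Num.sqrt N%:R.
    apply: (@le_trans _ _ (D ^+ 2)); last by rewrite ler_peMr ?sqr_ge0.
    by rewrite -(real_normK (num_real (mean P2 W))) lerXn2r// nnegrE ltW.
  have := sqr_ge0 (mean P2 W); move: sq_le; rewrite /v /c8 mulrDl !ler_norml; lra.
have Na0 : 0 < N%:R * a by rewrite mulr_gt0.
have ab : a <= bl / 8 by rewrite ge_min lexx orbT.
have Nab : N%:R * a <= N%:R * b2 / 4.
  by rewrite -mulrA ler_wpM2l ?(ltW nN)//; lra.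
have Nb0 : 0 < N%:R * b2 by rewrite mulr_gt0.
have rate : C0 * (K2 + 1) / (eta * Num.sqrt (N%:R * a)) = Cb / Num.sqrt N%:R.
  rewrite /Cb sqrtrM ?(ltW nN)//; have sa : 0 < Num.sqrt a by rewrite sqrtr_gt0.
  move: sa eta0 sN => x y z; move: (eta) (Num.sqrt a) (Num.sqrt N%:R) x y z => x y z x0 y0 z0.
  by field; rewrite !gt_eqF.
(* One estimate for every centre within [D] of 0 and every variance within [c8 * sqrt N] of
   [N * b2]; both normalizations are instances. *)
have dist mu w (muD : `|mu| <= D) (hw : `|w - N%:R * b2| <= c8 * Num.sqrt N%:R)
    (wb : N%:R * b2 / 2 <= w) :
  (dist_to_normal P2 (fun x => ((W x - mu) / Num.sqrt w)%R) <= (Cb / Num.sqrt N%:R)%:E)%E.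
  have ca := charfun_shift_approx n1 (ltW D0) e1 muD bl0 blb (ltW c80) hw wb.
  rewrite -rate; apply: hC0 => //; first by lra.
  - exact: ltW.
  - by lra.
split => //.
- apply: dist; rewrite ?normr0 ?(ltW D0)// ?subrr ?normr0 ?mulr_ge0 ?(ltW c80) ?(ltW sN)//.
  lra.
have [vb|vb] := leP (N%:R * b2 / 2) v.
  apply: le_trans (dist _ _ mu_le v_le vb) _; rewrite lee_fin ler_wpM2r ?invr_ge0 ?(ltW sN)//.
  by rewrite lerDl divr_ge0// ?mulr_ge0 ?ltW.
(* If [v] is below half of [N * b2], then [N * b2 / 2 < c8 * sqrt N], so [sqrt N < 2 * c8 / bl] and
   the trivial bound 1 suffices. This is the origin of the summand [2 * c8 / bl]. *)
apply: le_trans (dist_to_normal_le1 _ _) _.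
  by apply: measurable_funM => //; exact: measurable_funB.
rewrite lee_fin ler_pdivlMr// mul1r; apply: (@le_trans _ _ (2 * c8 / bl)); last first.
  by rewrite lerDr ltW.
rewrite ler_pdivlMr// -(ler_pM2r sN) -[_ * bl * _]mulrAC ssN.
have : N%:R * bl <= N%:R * b2 by rewrite ler_wpM2l// ltW.
move: v_le vb; rewrite ler_norml; lra.
Qed.

End conditional_normal.

(** * Residuals and sums of independent copies *)

Lemma cube_add_le {R : realDomainType} (x y : R) : 0 <= x -> 0 <= y ->
  (x + y) ^+ 3 <= 4 * (x ^+ 3 + y ^+ 3).
Proof.
move=> x0 y0; rewrite -subr_ge0.
have -> : 4 * (x ^+ 3 + y ^+ 3) - (x + y) ^+ 3 = 3 * ((x + y) * (x - y) ^+ 2) by ring.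
by rewrite mulr_ge0// mulr_ge0 ?sqr_ge0// addr_ge0.
Qed.

Section third_moments.
Context {R : realType} {d : measure_display} {T : measurableType d} (P : probability T R).

Lemma rintegrable_cubeD (f g : T -> R) : measurable_fun setT f -> measurable_fun setT g ->
  rintegrable P (fun w => `|f w| ^+ 3) -> rintegrable P (fun w => `|g w| ^+ 3) ->
  rintegrable P (fun w => `|f w + g w| ^+ 3).
Proof.
move=> mf mg f3 g3.
apply: rintegrable_le (rintegrableZ 4 (rintegrableD f3 g3)) _ => [|w].
  by apply: measurable_funX; apply: measurableT_comp => //; exact: measurable_funD.
rewrite ger0_norm ?exprn_ge0//; apply: le_trans (cube_add_le _ _) => //.
by rewrite lerXn2r// ?nnegrE// ?addr_ge0// ler_normD.
Qed.

Lemma rintegrable_cube_sum I (r : seq I) (F : I -> T -> R) :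
  (forall i, measurable_fun setT (F i)) -> (forall i, rintegrable P (fun w => `|F i w| ^+ 3)) ->
  rintegrable P (fun w => `|\sum_(i <- r) F i w| ^+ 3).
Proof.
move=> mF F3; elim: r => [|i r IH].
  rewrite (_ : (fun _ => _) = fun=> 0); first exact: rintegrable_cst.
  by apply/funext => w; rewrite big_nil normr0 expr0n.
rewrite (_ : (fun _ => _) = fun w => `|F i w + \sum_(i <- r) F i w| ^+ 3).
  by apply: rintegrable_cubeD => //; exact: measurable_sum.
by apply/funext => w; rewrite big_cons.
Qed.

Lemma rho_le_cube (X : T -> R) (r : R) : measurable_fun setT X -> (rho P X <= r%:E)%E ->
  rintegrable P (fun w => `|X w - mean P X| ^+ 3) /\
  mean P (fun w => `|X w - mean P X| ^+ 3) <= r.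
Proof.
move=> mX hr.
have i3 : rintegrable P (fun w => `|X w - mean P X| ^+ 3).
  apply/integrableP; split.
    apply/measurable_EFinP; apply: measurable_funX; apply: measurableT_comp => //.
    exact: measurable_funB.
  apply: le_lt_trans (ltry r); apply: le_trans hr.
  rewrite /rho unlock; apply: eq_ler; apply: eq_integral => w _ /=.
  by rewrite ger0_norm// exprn_ge0.
by split => //; rewrite -lee_fin -EmeanE.
Qed.

Lemma covE (X Y : T -> R) : cov P X Y = mean P (fun w => (X w - mean P X) * (Y w - mean P Y)).
Proof. by rewrite /cov unlock. Qed.

Lemma sqr_sigmaE (X : T -> R) : sigma P X ^+ 2 = mean P (fun w => (X w - mean P X) ^+ 2).
Proof.
have e : fine 'V_P[X] = mean P (fun w => (X w - mean P X) ^+ 2).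
  by rewrite /variance -/(cov P X X) covE; apply: eq_mean => w; rewrite expr2.
by rewrite /sigma e sqr_sqrtr//; apply: mean_ge0 => w; exact: sqr_ge0.
Qed.

Lemma mean_center (V : T -> R) : rintegrable P (fun w => V w - mean P V) ->
  mean P (fun w => V w - mean P V) = 0.
Proof.
move=> iV; have iV' : rintegrable P V.
  have h := rintegrableD iV (rintegrable_cst P (mean P V)).
  suff -> : V = (fun w => V w - mean P V + mean P V) by [].
  by apply/funext => w; rewrite subrK.
by rewrite meanB//; [rewrite mean_cst subrr|exact: rintegrable_cst].
Qed.

Lemma mean_shift (X : T -> R) (c : R) : rintegrable P (fun w => X w - c) ->
  rintegrable P X /\ mean P X = mean P (fun w => X w - c) + c.
Proof.
move=> iX; have h := rintegrableD iX (rintegrable_cst P c).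
have e : (fun w => X w - c + c) = X by apply/funext => w; rewrite subrK.
rewrite e in h; split => //; rewrite -[in LHS]e meanD ?mean_cst//.
exact: rintegrable_cst.
Qed.

(** The moments under control are those of the recentred variable; its finite third moment makes the
    extended-real variance a real number. *)
Lemma variance_shift (X : T -> R) (c : R) : measurable_fun setT X ->
  rintegrable P (fun w => `|X w - c| ^+ 3) ->
  'V_P[X] = (mean P (fun w => (X w - c) ^+ 2) - mean P (fun w => X w - c) ^+ 2)%:E.
Proof.
move=> mX X3; have mW : measurable_fun setT (fun w => X w - c) by exact: measurable_funB.
have i1 := rintegrable_of_cube mW X3; have i2 := rintegrable_sqr_of_cube mW X3.
have [_ eX] := mean_shift i1; set mu := mean P (fun w => X w - c) in eX *.
have -> : 'V_P[X] = expectation P (fun w => (X w - c) ^+ 2 - (2 * mu * (X w - c) - mu ^+ 2)).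
  rewrite /variance unlock; congr (expectation P _); apply/funext => w /=.
  by rewrite -[LHS]/((X w - mean P X) * (X w - mean P X)) eX; ring.
have i3 : rintegrable P (fun w => 2 * mu * (X w - c)) by exact: rintegrableZ.
have i4 : rintegrable P (fun w => 2 * mu * (X w - c) - mu ^+ 2).
  by apply: rintegrableB => //; exact: rintegrable_cst.
rewrite EmeanE; last exact: rintegrableB.
congr (_%:E); rewrite meanB// (meanB i3); last exact: rintegrable_cst.
by rewrite meanZ// mean_cst -/mu; ring.
Qed.

End third_moments.

Section residual.
Context {R : realType} {d : measure_display} {T : measurableType d} (P : probability T R).
Context (X Y : T -> R) (c1t c1 c2 c3t c3 c4 c6 : R).
Context (mX : measurable_fun setT X) (mY : measurable_fun setT Y).
Context (c1t_gt0 : 0 < c1t) (c2_gt0 : 0 < c2) (c3t_gt0 : 0 < c3t) (c4_gt0 : 0 < c4).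
Context (c6_lt1 : c6 < 1).
Context (sX : c1t <= sigma P X <= c1) (sY : c3t <= sigma P Y <= c3).
Context (rX : (rho P X <= (c2 ^+ 3 * sigma P X ^+ 3)%:E)%E).
Context (rY : (rho P Y <= (c4 ^+ 3 * sigma P Y ^+ 3)%:E)%E).
Context (corr_le : `|corr P X Y| <= c6).

Definition slope := cov P X Y / sigma P X ^+ 2.
Let A w := X w - mean P X.
Let Z w := Y w - mean P Y.
(** [residual] centered, [slope] being the regression coefficient of [Y] on [X]. *)
Definition centered_residual w := Y w - mean P Y - slope * (X w - mean P X).
Let B := centered_residual.

Let sX0 : 0 < sigma P X. Proof. by case/andP: sX => h _; exact: lt_le_trans h. Qed.
Let sY0 : 0 < sigma P Y. Proof. by case/andP: sY => h _; exact: lt_le_trans h. Qed.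

Lemma slopeE : slope = corr P X Y * sigma P Y / sigma P X.
Proof. by rewrite /slope /corr; field; rewrite !gt_eqF. Qed.

Let mA : measurable_fun setT A. Proof. exact: measurable_funB. Qed.
Let mZ : measurable_fun setT Z. Proof. exact: measurable_funB. Qed.
Let mB : measurable_fun setT B.
Proof. by apply: measurable_funB => //; exact: measurable_funM. Qed.

Let A3 := (rho_le_cube mX rX).1.
Let Z3 := (rho_le_cube mY rY).1.

Let iA : rintegrable P A. Proof. exact: rintegrable_of_cube mA A3. Qed.
Let iZ : rintegrable P Z. Proof. exact: rintegrable_of_cube mZ Z3. Qed.
Let iA2 : rintegrable P (fun w => A w ^+ 2). Proof. exact: rintegrable_sqr_of_cube mA A3. Qed.
Let iZ2 : rintegrable P (fun w => Z w ^+ 2). Proof. exact: rintegrable_sqr_of_cube mZ Z3. Qed.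

Let iAZ := rintegrable_mul_of_sqr mA mZ iA2 iZ2.

Let EB : mean P B = 0.
Proof. by rewrite meanB ?meanZ//; [rewrite !mean_center// mulr0 subr0|exact: rintegrableZ]. Qed.

Let EAB : mean P (fun w => A w * B w) = 0.
Proof.
have -> : (fun w => A w * B w) = (fun w => A w * Z w - slope * A w ^+ 2).
  by apply/funext => w; rewrite /B /centered_residual -/(A w) -/(Z w); ring.
rewrite meanB ?meanZ//; last exact: rintegrableZ.
by rewrite -covE -sqr_sigmaE /slope divfK ?subrr// sqrf_eq0 gt_eqF.
Qed.

Let EBB : mean P (fun w => B w ^+ 2) = sigma P Y ^+ 2 * (1 - corr P X Y ^+ 2).
Proof.
have -> : (fun w => B w ^+ 2) = (fun w => Z w ^+ 2 - (2 * slope * (A w * Z w) - slope ^+ 2 * A w ^+ 2)).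
  by apply/funext => w; rewrite /B /centered_residual -/(A w) -/(Z w); ring.
have i1 : rintegrable P (fun w => 2 * slope * (A w * Z w)) by exact: rintegrableZ.
have i2 : rintegrable P (fun w => slope ^+ 2 * A w ^+ 2) by exact: rintegrableZ.
rewrite meanB//; last exact: rintegrableB.
have eA : mean P (fun w => A w ^+ 2) = sigma P X ^+ 2 by rewrite sqr_sigmaE.
have eZ : mean P (fun w => Z w ^+ 2) = sigma P Y ^+ 2 by rewrite sqr_sigmaE.
have eC : mean P (fun w => A w * Z w) = cov P X Y by rewrite covE.
rewrite (meanB i1 i2) !meanZ// eA eZ eC /slope /corr.
move: (sigma P X) (sigma P Y) (cov P X Y) sX0 sY0 => x y c x0 y0.
by field; rewrite !gt_eqF.
Qed.

Lemma sqr_tauE : tau P X Y ^+ 2 = sigma P Y ^+ 2 * (1 - corr P X Y ^+ 2).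
Proof.
by rewrite sqr_sqrtr// -EBB; apply: mean_ge0 => w; exact: sqr_ge0.
Qed.

Let corr2_le : corr P X Y ^+ 2 <= c6 ^+ 2.
Proof.
rewrite -(real_normK (num_real (corr P X Y))) lerXn2r// nnegrE//.
exact: le_trans corr_le.
Qed.

Let c62_lt1 : c6 ^+ 2 < 1.
Proof.
have c60 : 0 <= c6 by exact: le_trans corr_le.
by rewrite expr2 mulr_ilt1.
Qed.

Lemma sqr_tau_ge : c3t ^+ 2 * (1 - c6 ^+ 2) <= tau P X Y ^+ 2.
Proof.
rewrite sqr_tauE; have /andP[h _] := sY; apply: ler_pM; rewrite ?sqr_ge0//.
- by rewrite subr_ge0 ltW.
- by rewrite lerXn2r// nnegrE ltW.
- by rewrite lerD2l lerN2.
Qed.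

Lemma sqr_tau_le : tau P X Y ^+ 2 <= c3 ^+ 2.
Proof.
rewrite sqr_tauE; have /andP[_ h] := sY; apply: (@le_trans _ _ (sigma P Y ^+ 2)).
  by rewrite ler_piMr ?sqr_ge0// lerBlDr lerDl sqr_ge0.
by rewrite lerXn2r// nnegrE ltW// (lt_le_trans sY0).
Qed.

(** The first summand bounds the third moment of [X - E[X]]; the second bounds that of the residual,
    by [(x + y)^3 <= 4 (x^3 + y^3)] and [|slope| <= c3 / c1t]. The sum serves for both. *)
Definition cube_bound := c2 ^+ 3 * c1 ^+ 3 + 4 * (c4 ^+ 3 * c3 ^+ 3 + (c3 / c1t) ^+ 3 * (c2 ^+ 3 * c1 ^+ 3)).

Let c10 : 0 < c1. Proof. by case/andP: sX => _; exact: lt_le_trans. Qed.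
Let c30 : 0 < c3. Proof. by case/andP: sY => _; exact: lt_le_trans. Qed.

Let A3K : mean P (fun w => `|A w| ^+ 3) <= c2 ^+ 3 * c1 ^+ 3.
Proof.
apply: le_trans (rho_le_cube mX rX).2 _; have /andP[_ h] := sX.
by rewrite ler_wpM2l ?exprn_ge0 ?(ltW c2_gt0)// lerXn2r// nnegrE ltW.
Qed.

Let Z3K : mean P (fun w => `|Z w| ^+ 3) <= c4 ^+ 3 * c3 ^+ 3.
Proof.
apply: le_trans (rho_le_cube mY rY).2 _; have /andP[_ h] := sY.
by rewrite ler_wpM2l ?exprn_ge0 ?(ltW c4_gt0)// lerXn2r// nnegrE ltW.
Qed.

Let slope_le : `|slope| <= c3 / c1t.
Proof.
rewrite slopeE 2!normrM normfV (gtr0_norm sX0) (gtr0_norm sY0).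
have /andP[h1 _] := sX; have /andP[_ h3] := sY.
apply: ler_pM => //; rewrite ?invr_ge0 ?mulr_ge0 ?(ltW sX0) ?(ltW sY0)//.
  rewrite -[leRHS]mul1r; apply: ler_pM => //; first exact: ltW.
  by apply: le_trans corr_le _; exact: ltW.
by rewrite lef_pV2 ?posrE.
Qed.

Let B_le w : `|B w| ^+ 3 <= 4 * (`|Z w| ^+ 3 + (c3 / c1t) ^+ 3 * `|A w| ^+ 3).
Proof.
rewrite -exprMn.
have c31 : 0 <= c3 / c1t by rewrite divr_ge0// ltW.
have cA : 0 <= c3 / c1t * `|A w| by exact: mulr_ge0.
apply: le_trans (cube_add_le _ cA) => //.
rewrite lerXn2r ?nnegrE// ?addr_ge0//.
apply: (@le_trans _ _ (`|Z w| + `|slope * A w|)); first exact: ler_normB.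
by rewrite lerD2l normrM ler_wpM2r.
Qed.

Lemma uncorrelated_residual :
  uncorrelated_pair P (fun w => X w - mean P X) centered_residual cube_bound (tau P X Y ^+ 2).
Proof.
have i1 : rintegrable P (fun w => (c3 / c1t) ^+ 3 * `|A w| ^+ 3) by exact: rintegrableZ.
have i2 : rintegrable P (fun w => `|Z w| ^+ 3 + (c3 / c1t) ^+ 3 * `|A w| ^+ 3).
  by exact: rintegrableD.
have i3 : rintegrable P (fun w => `|B w| ^+ 3).
  apply: rintegrable_le (rintegrableZ 4 i2) _ => [|w].
    by apply: measurable_funX; exact: measurableT_comp.
  by rewrite ger0_norm ?exprn_ge0//; exact: B_le.
have c31 : 0 <= (c3 / c1t) ^+ 3 by rewrite exprn_ge0// divr_ge0// ltW.
have k1 : 0 <= c2 ^+ 3 * c1 ^+ 3 by rewrite mulr_ge0// exprn_ge0// ltW.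
have k2 : 0 <= c4 ^+ 3 * c3 ^+ 3 by rewrite mulr_ge0// exprn_ge0// ltW.
split; [exact: (conj mA mB)| | |exact: EB|exact: (conj EAB (etrans EBB (esym sqr_tauE)))].
- split => //; apply: le_trans A3K _; rewrite /cube_bound lerDl mulr_ge0// addr_ge0//.
  by rewrite mulr_ge0.
- split => //; apply: (@le_trans _ _ (mean P (fun w => 4 * (`|Z w| ^+ 3 + (c3 / c1t) ^+ 3 * `|A w| ^+ 3)))).
    by apply: (le_mean i3 (rintegrableZ 4 i2)); exact: B_le.
  rewrite meanZ// meanD// meanZ// /cube_bound; apply: (@le_trans _ _ (4 * (c4 ^+ 3 * c3 ^+ 3 + (c3 / c1t) ^+ 3 * (c2 ^+ 3 * c1 ^+ 3)))).
    by rewrite ler_wpM2l// lerD// ler_wpM2l.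
  by rewrite lerDr.
Qed.

(** At [t = 0] both sides are characteristic functions of [X] up to the phase due to centering, and
    [sigma P X >= c1t] makes the decay uniform. *)
Lemma joint_cf_residual_le (c5 s : R) : 0 <= c5 ->
  `|joint_char_fun P X (residual P X Y) s 0| <=
   (1 - c5 * (sigma P X ^+ 2 * s ^+ 2 + sigma P (residual P X Y) ^+ 2 * 0 ^+ 2))%:C ->
  cnorm (joint_cf P (fun w => X w - mean P X) centered_residual s 0) <= 1 - c5 * c1t ^+ 2 * s ^+ 2.
Proof.
move=> c50; rewrite normrC_cnorm lecR expr0n mulr0 addr0 => h.
have -> : joint_cf P (fun w => X w - mean P X) centered_residual s 0 =
    expi (- (s * mean P X)) * joint_char_fun P X (residual P X Y) s 0.
  rewrite /joint_char_fun -CexpZ; last first.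
    apply: cintegrable_expi; apply: measurable_funD; first exact: measurable_funM.
    by apply: measurable_funM => //; apply: measurable_funB => //; exact: measurable_funM.
  by apply: eq_Cexp => w; rewrite -expiD; congr expi; ring.
rewrite cnormM cnorm_expi mul1r; apply: le_trans h _.
rewrite lerD2l lerN2 -mulrA; apply: ler_wpM2l => //; apply: ler_wpM2r; first exact: sqr_ge0.
by have /andP[h _] := sX; rewrite lerXn2r// nnegrE ltW.
Qed.

End residual.

Section iid_sums.
Context {R : realType} {d d' : measure_display}.
Context {T : measurableType d} {T' : measurableType d'}.
Context (P : probability T R) (P' : probability T' R) (X Y : T -> R) (N : nat).
Context (Xs Ys : 'I_N -> T' -> R).
Context (mX : measurable_fun setT X) (mY : measurable_fun setT Y).
Context (mXs : forall i, measurable_fun setT (Xs i)) (mYs : forall i, measurable_fun setT (Ys i)).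
Context (copies : iid_copies P' P Xs Ys X Y).

Definition centered_sum (w : T') := rsum Xs w - N%:R * mean P X.
Definition residual_sum (w : T') :=
  rsum Ys w - N%:R * mean P Y - slope P X Y * (rsum Xs w - N%:R * mean P X).

Let mXY : measurable_fun setT (fun w => (X w, Y w)).
Proof. exact: measurable_fun_pair. Qed.
Let mXYs i : measurable_fun setT (fun w => (Xs i w, Ys i w)).
Proof. exact: measurable_fun_pair. Qed.

Lemma measurable_rsum (Vs : 'I_N -> T' -> R) : (forall i, measurable_fun setT (Vs i)) ->
  measurable_fun setT (rsum Vs).
Proof. by move=> mVs; exact: measurable_sum. Qed.

Lemma measurable_centered_sum : measurable_fun setT centered_sum.
Proof. by apply: measurable_funB => //; exact: measurable_rsum. Qed.

Lemma measurable_residual_sum : measurable_fun setT residual_sum.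
Proof.
apply: measurable_funB; first by apply: measurable_funB => //; exact: measurable_rsum.
by apply: measurable_funM => //; exact: measurable_centered_sum.
Qed.

Let pair_residual (z : R * R) := z.2 - mean P Y - slope P X Y * (z.1 - mean P X).

Let measurable_pair_residual : measurable_fun setT pair_residual.
Proof.
apply: measurable_funB; first by apply: measurable_funB => //; exact: measurable_snd.
by apply: measurable_funM => //; apply: measurable_funB => //; exact: measurable_fst.
Qed.

Let centered_sumE w : centered_sum w = \sum_(i < N) (Xs i w - mean P X).
Proof. by rewrite sumrB sumr_const card_ord /centered_sum /rsum mulr_natl. Qed.

Let residual_sumE w : residual_sum w = \sum_(i < N) pair_residual (Xs i w, Ys i w).
Proof.
rewrite /residual_sum /pair_residual sumrB -mulr_sumr !sumrB !sumr_const card_ord.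
by rewrite /rsum !mulr_natl.
Qed.

(** Both sums are sums over [i] of functions of the single pair [(Xs i, Ys i)], so the exponential
    is a product of independent factors with a common law. *)
Lemma charfun_sums (s t : R) :
  Cexpectation P' (fun w => expi (s * centered_sum w + t * residual_sum w)) =
  joint_cf P (fun w => X w - mean P X) (centered_residual P X Y) s t ^+ N.
Proof.
pose F (z : R * R) := expi (s * (z.1 - mean P X) + t * pair_residual z).
have mF : cmeasurable F.
  apply: cmeasurable_expi; apply: measurable_funD; last exact: measurable_funM.
  by apply: measurable_funM => //; apply: measurable_funB => //; exact: measurable_fst.
have F1 z : cnorm (F z) <= 1 by rewrite cnorm_expi.
have [indep law] := copies.
transitivity (Cexpectation P' (fun w => \prod_(i < N) F (Xs i w, Ys i w))).
  apply: eq_Cexp => w; rewrite centered_sumE residual_sumE !mulr_sumr -big_split/=.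
  by rewrite expi_sum.
rewrite (Cexp_prod_indep mXYs indep (F := fun=> F))//.
rewrite (eq_bigr (fun=> joint_cf P (fun w => X w - mean P X) (centered_residual P X Y) s t)).
  by rewrite prodr_const card_ord.
by move=> i _; exact: (Cexp_same_law (mXYs i) mXY (law i) mF F1).
Qed.

Lemma residual_sum_cube : rintegrable P (fun w => `|centered_residual P X Y w| ^+ 3) ->
  rintegrable P' (fun w => `|residual_sum w| ^+ 3).
Proof.
move=> i3.
rewrite (_ : (fun _ => _) = fun w => `|\sum_(i < N) pair_residual (Xs i w, Ys i w)| ^+ 3); last first.
  by apply/funext => w; rewrite residual_sumE.
apply: rintegrable_cube_sum => i; first exact: (measurableT_comp measurable_pair_residual (mXYs i)).
have mf : measurable_fun setT (fun z => `|pair_residual z| ^+ 3).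
  by apply: measurable_funX; apply: measurableT_comp => //.
have [_ law] := copies.
apply: (rintegrable_same_law (mXYs i) mXY (law i) mf) => // z.
Qed.

(** The integers are a countable, hence Borel, set of reals; integrality of [X] therefore passes
    through the law to the copies, almost surely. *)
Lemma rsum_int_ae (k : int) : (forall w, X w \is a Num.int) ->
  {ae P', forall w, centered_sum w - (k%:~R - N%:R * mean P X) \is a Num.int}.
Proof.
move=> Xint; have [_ law] := copies.
pose I := \bigcup_(z : int) [set (z%:~R : R)].
have mI : measurable I by apply: countable_bigcupT_measurable => //; exact: countableP.
have IP (x : R) : I x -> x \is a Num.int by move=> [z _ ->]; exact: intr_int.
have ae i : {ae P', forall w, Xs i w \is a Num.int}.
  exists (Xs i @^-1` (~` I)); split.
  - rewrite -[X in measurable X]setTI; apply: mXs => //; exact: measurableC.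
  - have mB : measurable ((~` I) `*` [set: R]) by apply: measurableX => //; exact: measurableC.
    have := law i _ mB; rewrite (_ : _ @^-1` _ = Xs i @^-1` (~` I)); last first.
      by apply/seteqP; split => w //= -[].
    move=> ->; rewrite (_ : _ @^-1` _ = set0) ?measure0//.
    apply/seteqP; split => w //= -[h _]; apply: h.
    by have /intrP[z Xz] := Xint w; exists z.
  - by move=> w /= h Iw; apply: h; exact: IP.
have h := @filter_forall T' _ (fun i w => Xs i w \is a Num.int) (almost_everywhere P') _ ae.
have {}h := h (ae_filter_ringOfSetsType P').
apply: filterS h => w aw.
rewrite /centered_sum (_ : _ - _ = rsum Xs w - k%:~R); last by ring.
by rewrite rpredB ?intr_int// /rsum rpred_sum.
Qed.

End iid_sums.

(** * Uniform lower bound for the lattice probability, and assembly of the theorem *)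

Lemma inf_of_eventual {R : realType} (a : nat -> R) (c : R) : 0 < c -> (forall n, 0 < a n) ->
  (\forall n \near \oo, c <= a n) -> exists2 c', 0 < c' & forall n, c' <= a n.
Proof.
move=> c0 a0 [M _ hM].
have [c1 c10 h1] : exists2 c1, 0 < c1 & forall n, (n < M)%N -> c1 <= a n.
  elim: M {hM} => [|M [c1 c10 h1]]; first by exists 1.
  exists (Num.min c1 (a M)); first by rewrite lt_min c10 a0.
  move=> n; rewrite ltnS leq_eqVlt => /orP[/eqP->|nM]; first by rewrite ge_min lexx orbT.
  by rewrite ge_min h1.
exists (Num.min c c1); first by rewrite lt_min c0.
move=> n; have [nM|Mn] := ltnP n M; first by rewrite ge_min (h1 _ nM) orbT.
by rewrite ge_min (hM n Mn).
Qed.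

(** [joint_cf_expansion] is applied to the pair [(0, A)], with [A] in the place of the centered
    variable and first frequency 0, where its error is of order [|s|^3]. For [|s| > 1] the
    difference is at most 2, whence the [+ 2]. *)
Lemma centered_cf_expansion {R : realType} d (T : measurableType d) (P : probability T R)
    (A B : T -> R) (K b2 v s : R) : uncorrelated_pair P A B K b2 -> mean P A = 0 ->
  mean P (fun w => A w ^+ 2) = v ->
  cnorm (joint_cf P A B s 0 - (expR (- (v * s ^+ 2 / 2)))%:C) <=
  ((3 + v + v ^+ 2) * (1 + 2 * K) + 2) * `|s| ^+ 3.
Proof.
move=> [[mA mB] [A3 A3K] _ _ _] EA EAA.
have K0 : 0 <= K by apply: le_trans A3K; apply: mean_ge0 => w; exact: exprn_ge0.
have v0 : 0 <= v by rewrite -EAA; apply: mean_ge0 => w; exact: sqr_ge0.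
have c0 : 0 <= (3 + v + v ^+ 2) * (1 + 2 * K).
  by rewrite mulr_ge0// ?addr_ge0 ?sqr_ge0// mulr_ge0.
have m0 : measurable_fun setT (fun _ : T => 0 : R) by exact: measurable_cst.
have Z3 : rintegrable P (fun _ : T => `|0 : R| ^+ 3).
  by rewrite normr0 expr0n; exact: rintegrable_cst.
have Z3K : mean P (fun _ : T => `|0 : R| ^+ 3) <= K by rewrite normr0 expr0n mean_cst.
have E0A : mean P (fun w => 0 * A w) = 0.
  by rewrite -[RHS](mean_cst P 0); apply: eq_mean => w; rewrite mul0r.
have [s1|s1] := leP `|s| 1.
  have := joint_cf_expansion m0 mA Z3 A3 Z3K A3K EA E0A EAA 0 s1.
  have -> : joint_cf P (fun=> 0) A 0 s = joint_cf P A B s 0.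
    by apply: eq_Cexp => w; congr expi; ring.
  have -> : joint_cf P (fun=> 0) A 0 0 = 1.
    by rewrite -[RHS](Cexp_cst P 1); apply: eq_Cexp => w; rewrite !mul0r addr0 expi0.
  rewrite mulr1 expr0n add0r -(real_normK (num_real s)) -exprS => /le_trans; apply.
  by rewrite ler_wpM2r ?exprn_ge0// lerDl.
apply: le_trans (cnormB _ _) _.
have h1 : cnorm (joint_cf P A B s 0) <= 1.
  rewrite -[leRHS](mean_cst P); apply: cnorm_Cexp_le; [|exact: rintegrable_cst|].
    by apply: cintegrable_expi; apply: measurable_funD; exact: measurable_funM.
  by move=> w; rewrite cnorm_expi.
have h2 : cnorm (expR (- (v * s ^+ 2 / 2)))%:C <= 1.
  rewrite cnorm_real ger0_norm ?expR_ge0// -[leRHS]expR0 ler_expR oppr_le0.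
  by rewrite divr_ge0// mulr_ge0 ?sqr_ge0.
have h3 : 1 <= `|s| ^+ 3 by rewrite exprn_ege1// ltW.
rewrite mulrDl; have := mulr_ge0 c0 (exprn_ge0 3 (normr_ge0 s)); lra.
Qed.

(** [Nmin] ensures [sig^2 N >= 1] and makes the O(1 / N) error at most half of the main term
    [e0 / (16 sig sqrt N)]; hence [e = e0 / 32]. *)
Lemma local_lower_bound_uniform {R : realType} (c1t c1 K kappa K0 : R) :
  0 < c1t -> 0 < c1 -> 0 <= K -> 0 < kappa -> 0 <= K0 ->
  exists e Nmin : R, 0 < e /\ forall d d1 (T : measurableType d) (T1 : measurableType d1)
    (P : probability T R) (P1 : probability T1 R) (A B : T -> R) (b2 sig : R)
    (SA SB : T1 -> R) (m : R) (N : nat),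
  uncorrelated_pair P A B K b2 -> mean P A = 0 -> mean P (fun w => A w ^+ 2) = sig ^+ 2 ->
  c1t <= sig <= c1 ->
  (forall s, - pi <= s <= pi -> cnorm (joint_cf P A B s 0) <= 1 - kappa * s ^+ 2) ->
  measurable_fun setT SA -> measurable_fun setT SB ->
  {ae P1, forall w, SA w - m \is a Num.int} -> (0 < N)%N ->
  (forall s t, Cexpectation P1 (fun w => expi (s * SA w + t * SB w)) = joint_cf P A B s t ^+ N) ->
  `|m| <= K0 * (sig * Num.sqrt N%:R) -> Nmin <= N%:R ->
  e / (sig * Num.sqrt N%:R) <= fine (P1 [set w | SA w - m = 0]).
Proof.
move=> c1t0 c10 K00 kap0 K0_ge0.
set C1 := (3 + c1 ^+ 2 + (c1 ^+ 2) ^+ 2) * (1 + 2 * K) + 2.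
have C10 : 0 <= C1 by rewrite addr_ge0// mulr_ge0// ?addr_ge0 ?sqr_ge0// mulr_ge0.
set k := Num.min kappa (c1t ^+ 2 / 2).
have k0 : 0 < k by rewrite lt_min kap0 divr_gt0// exprn_gt0.
pose D := C1 * (expR (17 * k) * (2 / k)) * (1 + 4 / k) * (4 / (2 * pi) / Num.sqrt (k / 4)).
pose D' := D + K0 / c1t ^+ 2.
pose e0 := expR (- (K0 ^+ 2 / 2)); have e00 : 0 < e0 by exact: expR_gt0.
exists (e0 / 32), (Num.max (c1t ^+ 2)^-1 ((32 * c1 * `|D'| / e0) ^+ 2)).
split; first by rewrite divr_gt0.
move=> d d1 T T1 P P1 A B b2 sig SA SB m N up EA EAA /andP[sc1t sc1] kap mSA mSB lat N0 phi_sum mK.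
rewrite ge_max => /andP[N1 N2].
have sig0 : 0 < sig by exact: lt_le_trans c1t0 sc1t.
have sig2t : c1t ^+ 2 <= sig ^+ 2 by rewrite lerXn2r// nnegrE ltW.
have sig2 : sig ^+ 2 <= c1 ^+ 2 by rewrite lerXn2r// nnegrE ltW.
have nN : 0 < N%:R :> R by rewrite ltr0n.
have sN : 0 < Num.sqrt N%:R :> R by rewrite sqrtr_gt0.
have sV : Num.sqrt (sig ^+ 2 * N%:R) = sig * Num.sqrt N%:R.
  by rewrite sqrtrM ?sqr_ge0// sqrtr_sqr gtr0_norm.
have ex s (sp : - pi <= s <= pi) :
    cnorm (joint_cf P A B s 0 - (expR (- (sig ^+ 2 * s ^+ 2 / 2)))%:C) <= C1 * `|s| ^+ 3.
  apply: le_trans (centered_cf_expansion s up EA EAA) _.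
  rewrite ler_wpM2r ?exprn_ge0// lerD2r ler_wpM2r ?addr_ge0 ?mulr_ge0//.
  by rewrite lerD ?lerD// lerXn2r// nnegrE sqr_ge0.
have dec s (sp : - pi <= s <= pi) : cnorm (joint_cf P A B s 0) <= expR (- (k * s ^+ 2)).
  apply: le_trans (kap _ sp) _; apply: le_trans (expR_ge1Dx _) _.
  by rewrite ler_expR lerN2 ler_wpM2r ?sqr_ge0// ge_min lexx.
have kv : k <= sig ^+ 2 / 2.
  by apply: (@le_trans _ _ (c1t ^+ 2 / 2)); [rewrite ge_min lexx orbT|rewrite ler_wpM2r].
have mK' : `|m| <= K0 * Num.sqrt (sig ^+ 2 * N%:R) by rewrite sV.
have N1' : 1 <= sig ^+ 2 * N%:R.
  have : c1t ^+ 2 * (c1t ^+ 2)^-1 <= sig ^+ 2 * N%:R.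
    by apply: ler_pM; rewrite ?sqr_ge0 ?invr_ge0 ?sqr_ge0.
  by rewrite mulfV// expf_neq0// gt_eqF.
have v0 : 0 < sig ^+ 2 by rewrite exprn_gt0.
have := local_lower_bound mSA mSB lat N0 phi_sum v0 C10 k0 kv K0_ge0 ex dec mK' N1'.
apply: le_trans; rewrite sV -/D -/e0.
have DD : (D + K0 / sig ^+ 2) / N%:R <= `|D'| / N%:R.
  rewrite ler_pM2r ?invr_gt0//; apply: le_trans (ler_norm D'); rewrite lerD2l ler_wpM2l//.
  by rewrite lef_pV2 ?posrE ?exprn_gt0.
have sN2 : 32 * c1 * `|D'| / e0 <= Num.sqrt N%:R.
  have y0 : 0 <= 32 * c1 * `|D'| / e0 by rewrite divr_ge0 ?(ltW e00)// mulr_ge0// mulr_ge0// ltW.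
  by rewrite -[leLHS](ger0_norm y0) -sqrtr_sqr ler_wsqrtr.
have fin : `|D'| / N%:R <= e0 / (32 * (sig * Num.sqrt N%:R)).
  have -> : `|D'| / N%:R = `|D'| / Num.sqrt N%:R / Num.sqrt N%:R.
    by rewrite -mulrA -invfM -expr2 sqr_sqrtr ?(ltW nN).
  have -> : e0 / (32 * (sig * Num.sqrt N%:R)) = e0 / (32 * sig) / Num.sqrt N%:R.
    by field; rewrite !gt_eqF.
  rewrite ler_pM2r ?invr_gt0// ler_pdivrMr// mulrAC ler_pdivlMr ?mulr_gt0//.
  rewrite ler_pdivrMr// in sN2.
  apply: (@le_trans _ _ (32 * c1 * `|D'|)); last by rewrite [leRHS]mulrC.
  by rewrite mulrC ler_wpM2r// ler_wpM2l.
have -> : e0 / 32 / (sig * Num.sqrt N%:R) = e0 / (16 * (sig * Num.sqrt N%:R)) - e0 / (32 * (sig * Num.sqrt N%:R)).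
  by field; rewrite !gt_eqF.
by rewrite lerD2l lerN2 (le_trans DD).
Qed.

Theorem theorem2p1 (R : realType) (c1t c1 c2 c3t c3 c4 c5 c6 : R)
  (c1t_gt0 : 0 < c1t) (c1_gt0 : 0 < c1) (c2_gt0 : 0 < c2)
  (c3t_gt0 : 0 < c3t) (c3_gt0 : 0 < c3) (c4_gt0 : 0 < c4)
  (c5_gt0 : 0 < c5) (c6_gt0 : 0 < c6) (c6_lt1 : c6 < 1) :
  exists C c7 c8 Ct : R -> R,
    (forall c5t : R, 0 < c5t -> [/\ 0 < C c5t, 0 < c7 c5t & 0 < c8 c5t]) /\
  forall
    (d : nat -> measure_display) (Omega : forall n, measurableType (d n))
    (P : forall n, probability (Omega n) R)
    (X Y : forall n, {RV P n >-> R})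
    (N : nat -> nat)
    (d' : nat -> measure_display) (Omega' : forall n, measurableType (d' n))
    (P' : forall n, probability (Omega' n) R)
    (Xs Ys : forall n, 'I_(N n) -> {RV P' n >-> R})
    (k : nat -> int)
    (d'' : nat -> measure_display) (Omega'' : forall n, measurableType (d'' n))
    (P'' : forall n, probability (Omega'' n) R)
    (U : forall n, {RV P'' n >-> R}),
  let S n := rsum (Xs n) in
  let T n := rsum (Ys n) in
  let event_k n := [set w | S n w = (k n)%:~R] in
  let EX n := mean (P n) (X n) in
  let EY n := mean (P n) (Y n) in
  let sigmaX n := sigma (P n) (X n) in
  let sigmaY n := sigma (P n) (Y n) in
  let Y' n := residual (P n) (X n) (Y n) in
  let sigmaY' n := sigma (P n) (Y' n) in
  let r n := corr (P n) (X n) (Y n) in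
  let tau n := tau (P n) (X n) (Y n) in
  let sqrtN n : R := Num.sqrt (N n)%:R in
  let center n : R := (N n)%:R * EY n
    + r n * sigmaY n / sigmaX n * ((k n)%:~R - (N n)%:R * EX n) in
  (forall n w, X n w \is a Num.int) ->
  (forall n, (0 < N n)%N) ->
  N @ \oo --> \oo ->
  (forall n, iid_copies (P' n) (P n) (Xs n) (Ys n) (X n) (Y n)) ->
  (forall n, (0 < P' n (event_k n))%E) ->
  (forall n, has_cond_law (P' n) (P'' n) (U n) (T n) (event_k n)) ->
  (forall n, c1t <= sigmaX n <= c1) ->
  (forall n, (rho (P n) (X n) <= (c2 ^+ 3 * sigmaX n ^+ 3)%:E)%E) ->
  (exists2 eta0 : R, 0 < eta0 &
    forall n (s t : R), - pi <= s <= pi -> 0 <= t <= eta0 ->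
      `|joint_char_fun (P n) (X n) (Y' n) s t| <=
      (1 - c5 * (sigmaX n ^+ 2 * s ^+ 2 + sigmaY' n ^+ 2 * t ^+ 2))%:C) ->
  (fun n => (k n)%:~R - (N n)%:R * EX n : R) =O_\oo
    (fun n => sigmaX n * sqrtN n) ->
  (forall n, c3t <= sigmaY n <= c3) ->
  (forall n, (rho (P n) (Y n) <= (c4 ^+ 3 * sigmaY n ^+ 3)%:E)%E) ->
  (forall n, `|r n| <= c6) ->
  let local_lower_bound c5t := forall n,
    ((c5t / (2 * pi * sigmaX n * sqrtN n))%:E <= P' n (event_k n))%E in
  (exists2 c5t : R, 0 < c5t & local_lower_bound c5t) /\
  forall c5t : R, 0 < c5t -> local_lower_bound c5t ->
  [/\ forall n, threshold c2 c4 <= (N n)%:R ->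
        (dist_to_normal (P'' n) (fun w => (U n w - center n) / (sqrtN n * tau n))%R
         <= (C c5t / sqrtN n)%:E)%E,
      forall n, (`|'E_(P'' n)[U n] - (center n)%:E| <= (c7 c5t)%:E)%E,
      forall n, (`|'V_(P'' n)[U n] - ((N n)%:R * tau n ^+ 2)%:E|
                 <= (c8 c5t * sqrtN n)%:E)%E
    & forall n,
        Num.max (threshold c2 c4) (4 * c8 c5t ^+ 2 / c3t ^+ 2) <= (N n)%:R ->
        (dist_to_normal (P'' n)
           (fun w => (U n w - mean (P'' n) (U n)) / sigma (P'' n) (U n))%R
         <= (Ct c5t / sqrtN n)%:E)%E].
Proof.
pose K := @cube_bound R c1t c1 c2 c3 c4.
have ge0 (x : R) : 0 < x -> 0 <= x by exact: ltW.
have K_ge0 : 0 <= K.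
  rewrite /K /cube_bound.
  have h1 : 0 <= c2 ^+ 3 * c1 ^+ 3 by rewrite mulr_ge0// exprn_ge0// ge0.
  have h2 : 0 <= c4 ^+ 3 * c3 ^+ 3 by rewrite mulr_ge0// exprn_ge0// ge0.
  have h3 : 0 <= (c3 / c1t) ^+ 3 by rewrite exprn_ge0// divr_ge0// ge0.
  by rewrite addr_ge0// mulr_ge0// addr_ge0// mulr_ge0.
pose bl := c3t ^+ 2 * (1 - c6 ^+ 2).
have bl_gt0 : 0 < bl.
  rewrite mulr_gt0 ?exprn_gt0// subr_gt0 expr2.
  by rewrite mulr_ilt1// ge0.
pose bu := c3 ^+ 2; have bu_gt0 : 0 < bu by rewrite exprn_gt0.
pose kappa := c5 * c1t ^+ 2; have kappa_gt0 : 0 < kappa by rewrite mulr_gt0 ?exprn_gt0.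
have p0 := @pi_gt0 R.
(* With [sigmaX <= c1], the lower bound of part (a) is at least [q c5t / sqrt N], free of
   [sigmaX]. *)
pose q (c5t : R) := c5t / (2 * pi * c1).
have q_gt0 (c5t : R) : 0 < c5t -> 0 < q c5t by move=> h; rewrite divr_gt0// !mulr_gt0.
(* The constants are functions of [c5t] chosen before any random variable; for [c5t <= 0] the
   quadruple is a dummy. *)
have /choice[c hc] : forall c5t : R, exists c : R * R * R * R,
    0 < c5t -> approximation_constants bl bu K kappa (q c5t) c.
  move=> c5t; have [h|h] := ltP 0 c5t; last by exists (0, 0, 0, 0).
  have [c hc] := conditional_normal_approximation bl_gt0 bu_gt0 K_ge0 kappa_gt0 (q_gt0 _ h).
  by exists c.
exists (fun x => (c x).1.2), (fun x => (c x).1.1.1), (fun x => (c x).1.1.2), (fun x => (c x).2).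
split; first by move=> c5t /hc[[]].
move=> d Omega P X Y N d' Omega' P' Xs Ys k d'' Omega'' P'' U S T event_k EX EY sigmaX sigmaY Y'
  sigmaY' r tau sqrtN center Xint N_gt0 N_oo copies event_gt0 claw sX rX [eta0 eta0_gt0 cfX] kO sY rY corr_le
  local_lower_bound.
have mX n : measurable_fun setT (X n) by exact: measurable_funP.
have mY n : measurable_fun setT (Y n) by exact: measurable_funP.
have mXs n i : measurable_fun setT (Xs n i) by exact: measurable_funP.
have mYs n i : measurable_fun setT (Ys n i) by exact: measurable_funP.
have mU n : measurable_fun setT (U n) by exact: measurable_funP.
have up n : uncorrelated_pair (P n) (fun w => X n w - EX n) (centered_residual (P n) (X n) (Y n)) K (tau n ^+ 2).
  exact: (uncorrelated_residual (mX n) (mY n) c1t_gt0 c2_gt0 c3t_gt0 c4_gt0 c6_lt1 (sX n) (sY n) (rX n) (rY n) (corr_le n)).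
have kap n s : - pi <= s <= pi ->
    cnorm (joint_cf (P n) (fun w => X n w - EX n) (centered_residual (P n) (X n) (Y n)) s 0) <= 1 - kappa * s ^+ 2.
  move=> sp; apply: (joint_cf_residual_le (mX n) (mY n) c1t_gt0 (sX n) (ge0 _ c5_gt0)).
  by apply: (cfX n s 0 sp); rewrite lexx ge0.
pose SA n := centered_sum (P n) (X n) (Xs n).
pose SB n := residual_sum (P n) (X n) (Y n) (Xs n) (Ys n).
pose m n : R := (k n)%:~R - (N n)%:R * EX n.
have mSA n : measurable_fun setT (SA n) by exact: measurable_centered_sum.
have mSB n : measurable_fun setT (SB n) by exact: measurable_residual_sum.
have phi_sum n := charfun_sums (mX n) (mY n) (mXs n) (mYs n) (copies n).
have lat n : {ae P' n, forall w, SA n w - m n \is a Num.int}.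
  exact: (rsum_int_ae (mXs n) (copies n) (k n) (Xint n)).
have eventE n : [set w | SA n w - m n = 0] = event_k n.
  apply/seteqP; split => w; rewrite /SA /centered_sum /m /event_k /S /=.
    rewrite /EX; move: (rsum _ _) (_ * mean _ _) => x u; lra.
  by move=> ->; rewrite /EX; move: (_ * mean _ _) => u; lra.
have sN n : 0 < sqrtN n by rewrite sqrtr_gt0 ltr0n.
have sX0 n : 0 < sigmaX n by have /andP[h _] := sX n; exact: lt_le_trans h.
have mE n : measurable (event_k n) by apply: measurable_level; exact: measurable_rsum.
have event_fin n : P' n (event_k n) = (fine (P' n (event_k n)))%:E.
  by rewrite fineK// fin_num_measure.
split.
  move/eqO_exP: kO => [K0 K0_gt0 hK0].
  have [e [Nmin [e_gt0 low]]] := local_lower_bound_uniform c1t_gt0 c1_gt0 K_ge0 kappa_gt0 (ge0 _ K0_gt0).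
  pose a n := 2 * pi * sigmaX n * sqrtN n * fine (P' n (event_k n)).
  have den_gt0 n : 0 < 2 * pi * sigmaX n * sqrtN n by rewrite !mulr_gt0.
  have a_gt0 n : 0 < a n by rewrite mulr_gt0// -lte_fin -event_fin.
  have pe_gt0 : 0 < 2 * pi * e by rewrite !mulr_gt0.
  have ev : \forall n \near \oo, 2 * pi * e <= a n.
    have N_large : \forall n \near \oo, Nmin <= (N n)%:R.
      near=> n; have h : ((Num.truncn Nmin).+1 <= N n)%N.
        by near: n; exact: (N_oo _ (nbhs_infty_ge (Num.truncn Nmin).+1)).
      by apply: le_trans (ltW (truncnS_gt Nmin)) _; rewrite ler_nat.
    near=> n.
    have mn : `|m n| <= K0 * (sigmaX n * sqrtN n).
      rewrite -[sigmaX n * sqrtN n]ger0_norm ?mulr_ge0 ?ge0//.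
      by near: n; exact: hK0.
    have Nn : Nmin <= (N n)%:R by near: n.
    have [[mA _] [A3 _] _ _ _] := up n.
    have EA := mean_center (rintegrable_of_cube mA A3).
    have h := low _ _ _ _ _ _ _ _ _ _ _ _ (m n) _ (up n) EA (esym (sqr_sigmaE _ _)) (sX n) (kap n) (mSA n) (mSB n)
      (lat n) (N_gt0 n) (phi_sum n) mn Nn.
    have ss_gt0 : 0 < sigmaX n * sqrtN n by rewrite mulr_gt0.
    rewrite eventE (ler_pdivrMr _ _ ss_gt0) in h.
    rewrite /a -!mulrA ler_wpM2l// ler_wpM2l ?ge0//.
    by apply: le_trans h _; rewrite -/(sqrtN n) mulrC -mulrA.
  (* The condition on [k] is asymptotic, so the estimate holds from some rank on; the finitely many
     earlier terms have a positive minimum because every event has positive probability. *)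
  have [c5t c5t_gt0 hc5] := inf_of_eventual pe_gt0 a_gt0 ev.
  exists c5t => // n; rewrite event_fin lee_fin ler_pdivrMr// mulrC.
  exact: hc5.
move=> c5t c5t_gt0 llb.
have [[_ _ _ _] main] := hc c5t c5t_gt0.
have b_ge n : bl <= tau n ^+ 2.
  exact: (sqr_tau_ge (mX n) (mY n) c1t_gt0 c3t_gt0 c6_lt1 (sX n) (sY n) (rX n) (rY n) (corr_le n)).
have b_le n : tau n ^+ 2 <= bu.
  exact: (sqr_tau_le (mX n) (mY n) c1t_gt0 c3t_gt0 (sX n) (sY n) (rX n) (rY n)).
pose W n w := U n w - center n.
have mW n : measurable_fun setT (W n) by exact: measurable_funB.
(* On the event the deviation of [S] is the constant [k - N E[X]], so [center] contains exactly the
   regression part of [T], and the residual sum is left. *)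
have on_event n w : event_k n w -> T n w - center n = SB n w.
  rewrite /event_k /= => Sk; rewrite /SB /residual_sum -/(S n w) Sk
    (slopeE c1t_gt0 c3t_gt0 (sX n) (sY n)).
  by rewrite /center /T /EY /EX /r /sigmaY /sigmaX; ring.
have mT n : measurable_fun setT (T n) by exact: measurable_rsum.
have W3 n : rintegrable (P'' n) (fun w => `|W n w| ^+ 3).
  have [_ _ [B3 _] _ _] := up n.
  have SB3 := residual_sum_cube (mX n) (mY n) (mXs n) (mYs n) (copies n) B3.
  have mf : measurable_fun setT (fun z : R => `|z - center n| ^+ 3).
    by apply: measurable_funX; apply: measurableT_comp => //; exact: measurable_funB.
  apply: (rintegrable_cond_law (mU n) (mT n) (mE n) (event_gt0 n) (claw n) mf _ _ _ SB3).
  - by move=> z; exact: exprn_ge0.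
  - by move=> w; exact: exprn_ge0.
  - by move=> w /on_event ->.
have cfW n t : charfun (P'' n) (W n) t =
    ((fine (P' n [set w | SA n w - m n = 0]))^-1)%:C * numerator (P' n) (SA n) (SB n) (m n) t.
  have mF : cmeasurable (fun z : R => expi (t * (z - center n))).
    by apply: cmeasurable_expi; apply: measurable_funM => //; exact: measurable_funB.
  have F1 (z : R) : cnorm (expi (t * (z - center n))) <= 1 by rewrite cnorm_expi.
  rewrite /charfun (Cexp_cond_law (mU n) (mT n) (mE n) (event_gt0 n) (claw n) mF F1).
  rewrite /numerator eventE; congr (_ * _); apply: eq_Cexp => w.
  rewrite indicE; have [|_] := boolP (w \in event_k n); last by rewrite !mul0r.
  by rewrite inE => /on_event ->.
have qE n : q c5t / Num.sqrt (N n)%:R <= fine (P' n [set w | SA n w - m n = 0]).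
  rewrite eventE -lee_fin -event_fin; apply: le_trans (llb n); rewrite lee_fin /q.
  have /andP[_ s1] := sX n; have s0 : 0 < Num.sqrt (N n)%:R :> R := sN n.
  have d1 : 0 < 2 * pi * c1 * Num.sqrt (N n)%:R by rewrite mulr_gt0// mulr_gt0// mulr_gt0.
  have d2 : 0 < 2 * pi * sigmaX n * Num.sqrt (N n)%:R by rewrite mulr_gt0// mulr_gt0// mulr_gt0.
  rewrite -mulrA -invfM ler_wpM2l ?ge0// lef_pV2 ?posrE//.
  by rewrite ler_wpM2r ?ge0// ler_wpM2l ?ge0// mulr_gt0.
have key n := main _ _ _ _ _ _ _ _ _ _ _ _ _ _ _ _ _ (up n) (b_ge n) (b_le n) (kap n) (mSA n) (mSB n)
  (lat n) (N_gt0 n) (phi_sum n) (qE n) (mW n) (W3 n) (cfW n).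
have iW n : rintegrable (P'' n) (W n) := rintegrable_of_cube (mW n) (W3 n).
have VU n := variance_shift (mU n) (W3 n).
have tau_ge0 n : 0 <= tau n by exact: sqrtr_ge0.
split=> n.
- move=> _; have [_ _ h _] := key n.
  rewrite sqrtrM ?ler0n// sqrtr_sqr ger0_norm// in h.
  by rewrite (_ : (fun w => _) = fun w => (W n w - 0) / (Num.sqrt (N n)%:R * tau n))//; apply/funext => w; rewrite subr0.
- have [h _ _ _] := key n; have [iU eU] := mean_shift (iW n).
  by rewrite EmeanE// -EFinB lee_fin eU addrK.
- have [_ h _ _] := key n.
  by rewrite VU -EFinB lee_fin.
- move=> _; have [_ _ _ h] := key n; have [iU eU] := mean_shift (iW n).
  rewrite (_ : (fun w => _) = fun w => (W n w - mean (P'' n) (W n)) /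
    Num.sqrt (mean (P'' n) (fun w => W n w ^+ 2) - mean (P'' n) (W n) ^+ 2))//.
  by apply/funext => w; rewrite /sigma VU eU /W; congr (_ / _); ring.
Unshelve. all: by end_near.
Qed.
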